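(* Let $P$ be a simple $n$-gon and let $G$ be the visibility graph of $P$. If $G$ has more than $2n-3$ edges, then $G$ contains $K_4$ as a subgraph.
   Context: Two points $p,q$ of a simple polygon $P$ see each other if the segment $\overline{pq}$ is disjoint from the exterior of $P$. The visibility graph of $P$ has the vertices of $P$ as vertices, two being adjacent iff they see each other. *)

(* Defs.v *)
From HB Require Import structures.
From mathcomp Require Import all_boot all_order all_algebra.
From mathcomp Require Import boolp reals.
Set Implicit Arguments. Unset Strict Implicit. Unset Printing Implicit Defensive.
Import Order.TTheory GRing.Theory Num.Theory.
Local Open Scope ring_scope.

Definition lerp (R : realType) (a b : R * R) (t : R) : R * R :=
  ((1 - t) * a.1 + t * b.1, (1 - t) * a.2 + t * b.2).

Definition on_seg (R : realType) (a b x : R * R) : Prop :=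
  exists t : R, 0 <= t /\ t <= 1 /\ x = lerp a b t.

Definition boundary (R : realType) (n : nat) (p : 'I_n -> R * R) (x : R * R) : Prop :=
  exists i : 'I_n, on_seg (p i) (p (ordS i)) x.

Definition simple_polygon (R : realType) (n : nat) (p : 'I_n -> R * R) : Prop :=
  (3 <= n)%N /\ injective p /\
  forall i j : 'I_n, i != j -> forall x,
    on_seg (p i) (p (ordS i)) x -> on_seg (p j) (p (ordS j)) x ->
    (j = ordS i /\ x = p j) \/ (i = ordS j /\ x = p i).

Fixpoint free_path (R : realType) (n : nat) (p : 'I_n -> R * R)
    (x : R * R) (s : seq (R * R)) : Prop :=
  match s with
  | [::] => True
  | y :: s' => (forall z, on_seg x y z -> ~ boundary p z) /\ free_path p y s'
  end.

(* exterior of P: the unbounded component of the complement of the boundary,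
   i.e. points off the boundary from which one can travel arbitrarily far
   without meeting the boundary. *)
Definition exterior (R : realType) (n : nat) (p : 'I_n -> R * R) (x : R * R) : Prop :=
  ~ boundary p x /\
  forall M : R, exists s : seq (R * R),
    free_path p x s /\ M < `|(last x s).1| + `|(last x s).2|.

Definition sees (R : realType) (n : nat) (p : 'I_n -> R * R) (a b : R * R) : Prop :=
  forall z, on_seg a b z -> ~ exterior p z.

Definition vis_adj (R : realType) (n : nat) (p : 'I_n -> R * R) (i j : 'I_n) : Prop :=
  i != j /\ sees p (p i) (p j).

(* edge set of the visibility graph (each edge counted once, as i < j) *)
Definition vis_edges (R : realType) (n : nat) (p : 'I_n -> R * R) : {set 'I_n * 'I_n} :=
  [set e : 'I_n * 'I_n | (e.1 < e.2)%N && `[< vis_adj p e.1 e.2 >] ].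

(* Main.v *)
Require Import Defs.
From HB Require Import structures.
From mathcomp Require Import all_boot all_order all_algebra.
From mathcomp Require Import boolp reals.
From mathcomp Require classical_sets.
From mathcomp Require Import ring lra zify.
Set Implicit Arguments. Unset Strict Implicit. Unset Printing Implicit Defensive.
Import Order.TTheory GRing.Theory Num.Theory.
Local Open Scope ring_scope.

(** Call a visible pair of vertices primitive if its segment contains no
    further vertex.

    If a visible segment [ab] contains a vertex [v] in its interior, one side of
    [ab] is interior near [v]; among the vertices seen from [v] on that side take
    the one, [c], closest to [ab].  Then [a], [b], [v], [c] see each other.  If
    two primitive visible segments [ab] and [cd] cross properly at [O], take such
    a crossing with the quadrilateral [acbd] of least area.  If a triangle such
    as [aOc] contained further vertices, the vertices in [aOc] and [aOd] of
    smallest angle with [ab] at [a] would see each other across [ab] and span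
    with [ab] a smaller quadrilateral; so the four sides are visible.

    If neither case occurs, the visible pairs do not interleave in the cyclic
    order of the vertices, hence there are at most [2n - 3] of them: a chord
    [ab] cuts the polygon into two closed polygons, and comparing the ray-crossing
    parities of both along [cd] and along a normal of [ab] shows that interleaved
    primitive pairs must cross.

    Both steps need the Jordan curve theorem in the form "a point off the
    boundary is exterior iff its ray-crossing parity is even".  Parity is
    constant along paths that avoid the boundary; conversely every point off the
    boundary can be moved next to an edge and then along the boundary, on one of
    its two sides, to a fixed edge, whose two sides have different parities. *)

(** * Planar segments *)

Section Plane.
Variable R : realType.
Implicit Types (a b c d p q x y z u v w : R * R) (t s e : R).

(** Visibility only forbids the exterior, so a visible segment may pass through vertices and run
    along edges, and no general position is assumed. Primitive pairs isolate these degeneracies: the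
    open segment of a primitive pair is either an open edge or disjoint from the boundary. Parity is
    set up for arbitrary edge lists whose endpoints cancel modulo 2, so that the same two facts
    (constant off the edges, flipped by one proper crossing) serve the polygon and both closed
    polygons cut off by a chord. All constructions of [K_4] rest on one extremal choice in a
    triangle: turning a side about a corner until it first meets a vertex leaves the swept part free
    of boundary. This serves the crossing case, the case of a vertex inside a segment, and the
    existence of the third neighbour in the latter. The number [2n - 3] is the count for a
    triangulated [n]-gon, [n] sides and [n - 3] diagonals; it comes out of a recursion on index
    intervals. *)

Definition orient a b c : R :=
  (b.1 - a.1) * (c.2 - a.2) - (b.2 - a.2) * (c.1 - a.1).

Lemma orient_lerp a b x y t :
  orient a b (lerp x y t) = (1 - t) * orient a b x + t * orient a b y.
Proof. by rewrite /orient /lerp /=; ring. Qed.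

Lemma orient_rot a b c : orient b c a = orient a b c.
Proof. by rewrite /orient; ring. Qed.

Lemma orient_swap a b c : orient b a c = - orient a b c.
Proof. by rewrite /orient; ring. Qed.

Lemma orient_aab a b : orient a a b = 0. Proof. by rewrite /orient; ring. Qed.
Lemma orient_aba a b : orient a b a = 0. Proof. by rewrite /orient; ring. Qed.
Lemma orient_abb a b : orient a b b = 0. Proof. by rewrite /orient; ring. Qed.

(** Both [orient p q z - orient p q z'] and [orient z z' q - orient z z' p] are the cross product of
    [q - p] and [z - z'], so the two segments share one test for being parallel. *)
Lemma orient_quad p q z z' :
  orient p q z + orient z z' p = orient p q z' + orient z z' q.
Proof. by rewrite /orient; ring. Qed.

Lemma lerp0 a b : lerp a b 0 = a.
Proof. by case: a b => [a1 a2] [b1 b2]; rewrite /lerp /=; congr pair; ring. Qed.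

Lemma lerp1 a b : lerp a b 1 = b.
Proof. by case: a b => [a1 a2] [b1 b2]; rewrite /lerp /=; congr pair; ring. Qed.

Lemma lerpC a b t : lerp a b t = lerp b a (1 - t).
Proof. by rewrite /lerp; congr pair; ring. Qed.

Lemma lerpxx a t : lerp a a t = a.
Proof. by case: a => [a1 a2]; rewrite /lerp /=; congr pair; ring. Qed.

Lemma lerp_lerp a b t s e :
  lerp (lerp a b t) (lerp a b s) e = lerp a b ((1 - e) * t + e * s).
Proof. by rewrite /lerp /=; congr pair; ring. Qed.

Lemma lerp_lerpl a b t s : lerp a (lerp a b t) s = lerp a b (s * t).
Proof. by rewrite /lerp /=; congr pair; ring. Qed.

Lemma lerp_lerpr a b t s : lerp (lerp a b t) b s = lerp a b ((1 - s) * t + s).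
Proof. by rewrite /lerp /=; congr pair; ring. Qed.

Lemma on_segl a b : on_seg a b a.
Proof. by exists 0; rewrite lerp0; do !split => //; lra. Qed.

Lemma on_segr a b : on_seg a b b.
Proof. by exists 1; rewrite lerp1; do !split => //; lra. Qed.

Lemma on_segC a b x : on_seg a b x -> on_seg b a x.
Proof.
by move=> [t [t0 [t1 ->]]]; exists (1 - t); rewrite -lerpC; do !split => //; lra.
Qed.

Lemma on_seg_lerp a b t : 0 <= t -> t <= 1 -> on_seg a b (lerp a b t).
Proof. by move=> t0 t1; exists t. Qed.

Lemma conv01 t s e : 0 <= e -> e <= 1 -> 0 <= t -> 0 <= s ->
  0 <= (1 - e) * t + e * s.
Proof. by move=> *; rewrite addr_ge0 // mulr_ge0 // subr_ge0. Qed.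

Lemma conv01_le t s e k : 0 <= e -> e <= 1 -> t <= k -> s <= k ->
  (1 - e) * t + e * s <= k.
Proof.
move=> e0 e1 tk sk.
have := @conv01 (k - t) (k - s) e e0 e1; lra.
Qed.

Lemma conv_gt0 t s e : 0 <= e -> e <= 1 -> 0 < t -> 0 < s ->
  0 < (1 - e) * t + e * s.
Proof.
move=> e0 e1 t0 s0; have [->|en0] := eqVneq e 0; first by lra.
have : 0 < e by rewrite lt_neqAle eq_sym en0.
by move=> ep; rewrite ltr_wpDl ?mulr_ge0 ?mulr_gt0 ?subr_ge0 // ltW.
Qed.

Lemma conv_gt0l t s e : 0 <= e -> e < 1 -> 0 < t -> 0 <= s ->
  0 < (1 - e) * t + e * s.
Proof.
by move=> e0 e1 t0 s0; rewrite ltr_pwDl ?mulr_ge0 ?mulr_gt0 ?subr_gt0 // ltW.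
Qed.

Lemma conv_gt0r t s e : 0 < e -> e <= 1 -> 0 <= t -> 0 < s ->
  0 < (1 - e) * t + e * s.
Proof.
by move=> e0 e1 t0 s0; rewrite ltr_wpDl ?mulr_ge0 ?mulr_gt0 ?subr_ge0 // ltW.
Qed.

Lemma on_seg_sub a b x y z :
  on_seg a b x -> on_seg a b y -> on_seg x y z -> on_seg a b z.
Proof.
move=> [t [t0 [t1 ->]]] [s [s0 [s1 ->]]] [e [e0 [e1 ->]]].
rewrite lerp_lerp; apply: on_seg_lerp; first exact: conv01.
exact: conv01_le.
Qed.

Lemma on_seg_split a b x z :
  on_seg a b x -> on_seg a b z -> on_seg a x z \/ on_seg x b z.
Proof.
move=> [t [t0 [t1 ->]]] [s [s0 [s1 ->]]].
have [st|ts] := leP s t.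
  left; have [t00|tn0] := eqVneq t 0.
    have -> : s = 0 by lra.
    by rewrite lerp0; exact: on_segl.
  have tp : 0 < t by rewrite lt_neqAle eq_sym tn0.
  exists (s / t); rewrite lerp_lerpl divfK //; split; first exact: divr_ge0.
  by rewrite ler_pdivrMr // mul1r.
right; have tp : 0 < 1 - t by lra.
exists ((s - t) / (1 - t)); split; first by apply: divr_ge0; lra.
split; first by rewrite ler_pdivrMr // mul1r; lra.
rewrite lerp_lerpr; congr lerp; field; lra.
Qed.

Lemma orient_on_seg a b x : on_seg a b x -> orient a b x = 0.
Proof. by move=> [t [_ [_ ->]]]; rewrite orient_lerp orient_aba orient_abb; ring. Qed.

Definition sqd a b : R := (b.1 - a.1) ^+ 2 + (b.2 - a.2) ^+ 2.

Lemma sqd_gt0 a b : a != b -> 0 < sqd a b.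
Proof.
move=> ab; rewrite /sqd lt_neqAle addr_ge0 ?sqr_ge0 // andbT eq_sym.
rewrite paddr_eq0 ?sqr_ge0 // !sqrf_eq0 !subr_eq0.
apply: contra ab => /andP[/eqP h1 /eqP h2].
by case: a b h1 h2 => [a1 a2] [b1 b2] /= -> ->.
Qed.

(** The parameter on the line [ab] of the foot of the perpendicular from [x]. *)
Definition proj a b x : R :=
  ((b.1 - a.1) * (x.1 - a.1) + (b.2 - a.2) * (x.2 - a.2)) / sqd a b.

Lemma proj_lerp a b x y t :
  proj a b (lerp x y t) = (1 - t) * proj a b x + t * proj a b y.
Proof. by rewrite /proj /lerp /=; ring. Qed.

Lemma proj_l a b : proj a b a = 0.
Proof. by rewrite /proj !subrr !mulr0 addr0 mul0r. Qed.

Lemma proj_r a b : a != b -> proj a b b = 1.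
Proof. by move=> /sqd_gt0 h; rewrite /proj -!expr2 divff // lt0r_neq0. Qed.

Lemma projK a b x : a != b -> orient a b x = 0 -> x = lerp a b (proj a b x).
Proof.
move=> /sqd_gt0 /lt0r_neq0 h.
case: x => x1 x2; rewrite /proj /lerp /orient /= => o.
have e1 : (b.1 - a.1) * (x2 - a.2) = (b.2 - a.2) * (x1 - a.1) by lra.
congr pair; apply: (mulfI h).
  transitivity (sqd a b * a.1 + (b.1 - a.1) *
     ((b.1 - a.1) * (x1 - a.1) + (b.2 - a.2) * (x2 - a.2))); last by field.
  rewrite mulrDr [X in _ + (_ + X)]mulrCA e1 /sqd; ring.
transitivity (sqd a b * a.2 + (b.2 - a.2) *
     ((b.1 - a.1) * (x1 - a.1) + (b.2 - a.2) * (x2 - a.2))); last by field.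
rewrite mulrDr [X in _ + (X + _)]mulrCA -e1 /sqd; ring.
Qed.

Lemma orient_line u w a b : u != w ->
  orient u w a = 0 -> orient u w b = 0 -> orient a b u = 0 /\ orient a b w = 0.
Proof.
move=> uw ha hb; rewrite (projK uw ha) (projK uw hb); rewrite /orient /lerp /=.
by split; ring.
Qed.

(** Writing [r / (r - k)] over a square avoids distinguishing the sign of [r - k]. *)
Lemma div_sq01 (r k : R) : r * k <= 0 -> 0 < (r - k) ^+ 2 ->
  0 <= r * (r - k) / (r - k) ^+ 2 /\ r * (r - k) / (r - k) ^+ 2 <= 1.
Proof.
move=> h pos; split.
  by apply: divr_ge0; [nra | exact: ltW].
by rewrite ler_pdivrMr // mul1r; nra.
Qed.

(** Cramer's rule: by [orient_quad] the two differences of orientations are opposite, so one nonzero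
    denominator serves the parameters on both segments. The sign conditions are weak, so that
    touching endpoints are covered. *)
Lemma seg_meet a b c d :
  orient a b c * orient a b d <= 0 -> orient c d a * orient c d b <= 0 ->
  orient a b c != orient a b d -> exists2 x, on_seg a b x & on_seg c d x.
Proof.
set o1 := orient a b c; set o2 := orient a b d.
set o3 := orient c d a; set o4 := orient c d b.
move=> h12 h34 n12.
have q : o1 + o3 = o2 + o4 by rewrite /o1 /o2 /o3 /o4 orient_quad.
have n : o1 - o2 != 0 by rewrite subr_eq0.
have n2 : (o1 - o2) ^+ 2 != 0 by rewrite sqrf_eq0.
have pos : 0 < (o1 - o2) ^+ 2 by rewrite lt_neqAle eq_sym n2 sqr_ge0.
pose t := o1 / (o1 - o2); pose s := - o3 / (o1 - o2).
have tE : t = (o1 * (o1 - o2)) / (o1 - o2) ^+ 2 by rewrite /t; field.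
have sE : s = (o3 * (o3 - o4)) / (o1 - o2) ^+ 2.
  have -> : o3 - o4 = - (o1 - o2) by lra.
  by rewrite /s; field.
have e34 : (o1 - o2) ^+ 2 = (o3 - o4) ^+ 2.
  have -> : o3 - o4 = - (o1 - o2) by lra.
  by rewrite sqrrN.
have pos34 : 0 < (o3 - o4) ^+ 2 by rewrite -e34.
exists (lerp c d t).
  have [s0 s1] : 0 <= s /\ s <= 1 by rewrite sE e34; exact: div_sq01.
  exists s; do 2!split=> //.
  have o12 : o1 - o2 = (b.1 - a.1) * (c.2 - d.2) - (b.2 - a.2) * (c.1 - d.1).
    by rewrite /o1 /o2 /orient; ring.
  rewrite /lerp; congr pair; apply: (mulfI n).
    rewrite /t /s /=; transitivity ((o1 - o2 - o1) * c.1 + o1 * d.1); first by field.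
    transitivity ((o1 - o2 + o3) * a.1 - o3 * b.1); last by field.
    by rewrite o12 /o1 /o2 /o3 /orient; ring.
  rewrite /t /s /=; transitivity ((o1 - o2 - o1) * c.2 + o1 * d.2); first by field.
  transitivity ((o1 - o2 + o3) * a.2 - o3 * b.2); last by field.
  by rewrite o12 /o1 /o2 /o3 /orient; ring.
have [t0 t1] : 0 <= t /\ t <= 1 by rewrite tE; exact: div_sq01.
exact: on_seg_lerp.
Qed.

End Plane.

(** * Crossing parity *)

Section Parity.
Variable R : realType.
Implicit Types (a b c d p q x y z u v w : R * R) (t s : R).
Implicit Types (E : seq ((R * R) * (R * R))).

(* [hit p q z]: the upward vertical ray from [z] meets the segment [pq]; the
   abscissae are compared half-openly, so a ray through a vertex is counted
   consistently by the two edges at that vertex. *)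
Definition hit p q z : bool :=
  ((p.1 <= z.1) && ~~ (q.1 <= z.1) && (orient p q z < 0)) ||
  (~~ (p.1 <= z.1) && (q.1 <= z.1) && (0 < orient p q z)).

(** Dual of [hit]: [p] lies in the strip swept by the upward rays from the points of [zz']. Vertex
    and point abscissae are compared exactly as in [hit], so that both notions agree in the boundary
    cases. *)
Definition above z z' p : bool :=
  ((p.1 <= z'.1) && ~~ (p.1 <= z.1) && (0 < orient z z' p)) ||
  ((p.1 <= z.1) && ~~ (p.1 <= z'.1) && (orient z z' p < 0)).

Lemma hitC p q z : hit p q z = hit q p z.
Proof.
rewrite /hit orient_swap oppr_lt0 oppr_gt0.
by case: (p.1 <= z.1); case: (q.1 <= z.1); rewrite /= ?orbF ?orbT.
Qed.

(** Linear relations whose coefficients are differences of abscissae; through [sgn_conv], two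
    orientations of equal sign then determine the sign of a third. *)
Lemma orient_coords p q z z' :
  [/\ orient p q z * (z'.1 - p.1) - orient p q z' * (z.1 - p.1)
       = - orient z z' p * (q.1 - p.1),
      orient p q z * (z'.1 - q.1) - orient p q z' * (z.1 - q.1)
       = - orient z z' q * (q.1 - p.1),
      orient z z' p * (q.1 - z.1) - orient z z' q * (p.1 - z.1)
       = - orient p q z * (z'.1 - z.1) &
      orient z z' p * (q.1 - z'.1) - orient z z' q * (p.1 - z'.1)
       = - orient p q z' * (z'.1 - z.1)].
Proof. by rewrite /orient; split; ring. Qed.

Lemma aboveC z z' p : above z z' p = above z' z p.
Proof.
rewrite /above orient_swap oppr_lt0 oppr_gt0.
by case: (p.1 <= z.1); case: (p.1 <= z'.1); rewrite /= ?orbF ?orbT.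
Qed.

Lemma hit_sorted p q z : p.1 <= q.1 ->
  hit p q z = (p.1 <= z.1) && (z.1 < q.1) && (orient p q z < 0).
Proof.
move=> pq; rewrite /hit -ltNge.
by case: (leP p.1 z.1) => h /=; case: (leP q.1 z.1) => h' //=; rewrite ?orbF //; lra.
Qed.

Lemma above_sorted z z' p : z.1 <= z'.1 ->
  above z z' p = (z.1 < p.1) && (p.1 <= z'.1) && (0 < orient z z' p).
Proof.
move=> zz; rewrite /above -ltNge.
by case: (leP p.1 z'.1) => h /=; case: (leP p.1 z.1) => h' //=; rewrite ?orbF //; lra.
Qed.

Lemma sorted_ind (P : R * R -> R * R -> R * R -> R * R -> Prop) :
  (forall p q z z', P p q z z' -> P q p z z') ->
  (forall p q z z', P p q z z' -> P p q z' z) ->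
  (forall p q z z', p.1 <= q.1 -> z.1 <= z'.1 -> P p q z z') ->
  forall p q z z', P p q z z'.
Proof.
move=> P1 P2 P3 p q z z'.
have [h1|/ltW h1] := leP p.1 q.1; have [h2|/ltW h2] := leP z.1 z'.1.
- exact: P3.
- by apply: P2; exact: P3.
- by apply: P1; exact: P3.
- by apply: P1; apply: P2; exact: P3.
Qed.

(** The left side of the equation is nonzero and has the common sign of [r1] and [r2], so [r3] has
    the opposite one. *)
Lemma sgn_conv (r1 r2 r3 k1 k2 k3 : R) : 0 <= k1 -> 0 <= k2 -> 0 < k1 + k2 ->
  0 <= k3 -> 0 < r1 * r2 -> r1 * k1 + r2 * k2 = - r3 * k3 ->
  [/\ r1 < 0, r2 < 0 & 0 < r3] \/ [/\ 0 < r1, 0 < r2 & r3 < 0].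
Proof.
move=> k10 k20 k12 k30 r12 eq.
have [r10|r10|r10] := ltrgtP r1 0.
- have r20 : r2 < 0 by rewrite nmulr_rgt0 in r12.
  left; split => //; rewrite ltNge; apply/negP => r30.
  have h1 : r1 * k1 <= 0 by rewrite mulr_le0_ge0 // ltW.
  have h2 : r2 * k2 <= 0 by rewrite mulr_le0_ge0 // ltW.
  have h3 : r3 * k3 <= 0 by rewrite mulr_le0_ge0.
  have /eqP : r1 * k1 = 0 by lra.
  have /eqP : r2 * k2 = 0 by lra.
  by rewrite !mulf_eq0 (lt_eqF r10) (lt_eqF r20) /= => /eqP ? /eqP ?; lra.
- have r20 : 0 < r2 by rewrite pmulr_rgt0 in r12.
  right; split => //; rewrite ltNge; apply/negP => r30.
  have h1 : 0 <= r1 * k1 by rewrite mulr_ge0 // ltW.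
  have h2 : 0 <= r2 * k2 by rewrite mulr_ge0 // ltW.
  have h3 : 0 <= r3 * k3 by rewrite mulr_ge0.
  have /eqP : r1 * k1 = 0 by lra.
  have /eqP : r2 * k2 = 0 by lra.
  by rewrite !mulf_eq0 (gt_eqF r10) (gt_eqF r20) /= => /eqP ? /eqP ?; lra.
- by move: r12; rewrite r10 mul0r ltxx.
Qed.

Lemma mulr_gt0_sgn (r1 r2 : R) : 0 < r1 * r2 ->
  (r1 < 0 /\ r2 < 0) \/ (0 < r1 /\ 0 < r2).
Proof.
case: (ltrgtP r1 0) => [h1|h1|->]; last by rewrite mul0r ltxx.
  by rewrite nmulr_rgt0 //; left.
by rewrite pmulr_rgt0 //; right.
Qed.

Lemma mulr_lt0_sgn (r1 r2 : R) : r1 * r2 < 0 ->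
  (r1 < 0 /\ 0 < r2) \/ (0 < r1 /\ r2 < 0).
Proof.
case: (ltrgtP r1 0) => [h1|h1|->]; last by rewrite mul0r ltxx.
  by rewrite nmulr_rlt0 //; left.
by rewrite pmulr_rlt0 //; right.
Qed.

(** The strip above [zz'] is bounded by two vertical rays and [zz'] itself. An edge that misses
    [zz'] can enter or leave the strip through the rays only, so modulo 2 its hits count its
    endpoints in the strip. *)
Lemma hit_same_side p q z z' :
  0 < orient p q z * orient p q z' \/ 0 < orient z z' p * orient z z' q ->
  hit p q z (+) hit p q z' = above z z' p (+) above z z' q.
Proof.
move: p q z z'; apply: sorted_ind.
- move=> p q z z' H; rewrite (orient_swap p q z) (orient_swap p q z') mulrNN.
  by rewrite [X in _ \/ _ < X]mulrC ![hit q p _]hitC addbC [RHS]addbC -(addbC (hit p q z)).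
- move=> p q z z' H.
  rewrite [X in _ < X \/ _]mulrC (orient_swap z z' p) (orient_swap z z' q) mulrNN.
  by rewrite -!(aboveC z z') addbC.
move=> p q z z' pq zz; rewrite !hit_sorted // !above_sorted //.
have [] := orient_coords p q z z'.
set o1 := orient p q z; set o2 := orient p q z'.
set o3 := orient z z' p; set o4 := orient z z' q.
move: o1 o2 o3 o4 p.1 q.1 z.1 z'.1 pq zz => o1 o2 o3 o4 px qx zx wx pq zz i1 i2 i3 i4 h.
case: (leP px zx) => pz; case: (leP qx zx) => qz;
case: (leP px wx) => pw; case: (leP qx wx) => qw;
rewrite /= ?andbF ?andbT ?addbF ?addFb //=; try lra.
- case: h => h.
    have : [/\ o1 < 0, o2 < 0 & 0 < o4] \/ [/\ 0 < o1, 0 < o2 & o4 < 0].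
      by apply: (@sgn_conv o1 o2 o4 (wx - qx) (qx - zx) (qx - px)); lra.
    by case=> [[h1 _ h2]|[h1 _ h2]]; rewrite ?(lt_gtF h1) ?(lt_gtF h2) ?h1 ?h2.
  have : [/\ o3 < 0, o4 < 0 & 0 < o1] \/ [/\ 0 < o3, 0 < o4 & o1 < 0].
    by apply: (@sgn_conv o3 o4 o1 (qx - zx) (zx - px) (wx - zx)); lra.
  by case=> [[_ h1 h2]|[_ h1 h2]]; rewrite ?(lt_gtF h1) ?(lt_gtF h2) ?h1 ?h2.
- suff : (o1 < 0) = (o2 < 0) by move=> ->; rewrite addbb.
  case: h => h.
    by case: (mulr_gt0_sgn h) => [[h1 h2]|[h1 h2]]; rewrite ?(lt_gtF h1) ?(lt_gtF h2) ?h1 ?h2.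
  have : [/\ o3 < 0, o4 < 0 & 0 < o1] \/ [/\ 0 < o3, 0 < o4 & o1 < 0].
    by apply: (@sgn_conv o3 o4 o1 (qx - zx) (zx - px) (wx - zx)); lra.
  have : [/\ o3 < 0, o4 < 0 & 0 < o2] \/ [/\ 0 < o3, 0 < o4 & o2 < 0].
    by apply: (@sgn_conv o3 o4 o2 (qx - wx) (wx - px) (wx - zx)); lra.
  by case=> [[h1 _ h2]|[h1 _ h2]] [[h3 _ h4]|[h3 _ h4]]; try lra;
    rewrite ?(lt_gtF h2) ?(lt_gtF h4) ?h2 ?h4.
- suff : (0 < o3) = (0 < o4) by move=> ->; rewrite addbb.
  case: h => h; last first.
    by case: (mulr_gt0_sgn h) => [[h1 h2]|[h1 h2]]; rewrite ?(lt_gtF h1) ?(lt_gtF h2) ?h1 ?h2.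
  have : [/\ o1 < 0, o2 < 0 & 0 < o3] \/ [/\ 0 < o1, 0 < o2 & o3 < 0].
    by apply: (@sgn_conv o1 o2 o3 (wx - px) (px - zx) (qx - px)); lra.
  have : [/\ o1 < 0, o2 < 0 & 0 < o4] \/ [/\ 0 < o1, 0 < o2 & o4 < 0].
    by apply: (@sgn_conv o1 o2 o4 (wx - qx) (qx - zx) (qx - px)); lra.
  by case=> [[h1 _ h2]|[h1 _ h2]] [[h3 _ h4]|[h3 _ h4]]; try lra;
    rewrite ?(lt_gtF h2) ?(lt_gtF h4) ?h2 ?h4.
- case: h => h.
    have : [/\ o1 < 0, o2 < 0 & 0 < o3] \/ [/\ 0 < o1, 0 < o2 & o3 < 0].
      by apply: (@sgn_conv o1 o2 o3 (wx - px) (px - zx) (qx - px)); lra.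
    by case=> [[_ h1 h2]|[_ h1 h2]]; rewrite ?(lt_gtF h1) ?(lt_gtF h2) ?h1 ?h2.
  have : [/\ o3 < 0, o4 < 0 & 0 < o2] \/ [/\ 0 < o3, 0 < o4 & o2 < 0].
    by apply: (@sgn_conv o3 o4 o2 (qx - wx) (wx - px) (wx - zx)); lra.
  by case=> [[h1 _ h2]|[h1 _ h2]]; rewrite ?(lt_gtF h1) ?(lt_gtF h2) ?h1 ?h2.
Qed.

(** Here the edge passes once through the third side of the strip, the segment [zz'], which changes
    the count by one. *)
Lemma hit_cross p q z z' :
  orient p q z * orient p q z' < 0 -> orient z z' p * orient z z' q < 0 ->
  hit p q z (+) hit p q z' = ~~ (above z z' p (+) above z z' q).
Proof.
move: p q z z'; apply: sorted_ind.
- move=> p q z z' H; rewrite (orient_swap p q z) (orient_swap p q z') mulrNN.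
  by rewrite [X in _ -> X < _ -> _]mulrC -!(hitC p q) addbC [above _ _ q (+) _]addbC
     -(addbC (hit p q z)).
- move=> p q z z' H.
  rewrite [X in X < _ -> _]mulrC (orient_swap z z' p) (orient_swap z z' q) mulrNN.
  by rewrite -!(aboveC z z') addbC.
move=> p q z z' pq zz; rewrite !hit_sorted // !above_sorted //.
have all0 : p.1 = q.1 -> z.1 = p.1 -> orient p q z = 0.
  by move=> h1 h2; rewrite /orient h2 h1; ring.
have i5 := orient_quad p q z z'.
have [] := orient_coords p q z z'.
move: all0 i5.
set o1 := orient p q z; set o2 := orient p q z'.
set o3 := orient z z' p; set o4 := orient z z' q.
move: o1 o2 o3 o4 p.1 q.1 z.1 z'.1 pq zz => o1 o2 o3 o4 px qx zx wx pq zz.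
move=> all0 i5 i1 i2 i3 i4 h h'.
have sg : [/\ o1 < 0, 0 < o2, 0 < o3 & o4 < 0] \/ [/\ 0 < o1, o2 < 0, o3 < 0 & 0 < o4].
  case: (mulr_lt0_sgn h) => -[h1 h2]; case: (mulr_lt0_sgn h') => -[h3 h4]; try lra.
    by left.
  by right.
case: (leP px zx) => pz; case: (leP qx zx) => qz;
case: (leP px wx) => pw; case: (leP qx wx) => qw;
rewrite /= ?andbF ?andbT ?addbF ?addFb ?negbK //=; try lra.
(* All four abscissae would coincide, and then [z] would lie on the line [pq]. *)
- exfalso; suff : qx = wx /\ px = qx.
    by move=> [e1 e2]; case: sg => -[s1 _ _ _]; move: s1; rewrite all0 ?ltxx //; lra.
  case: sg => -[s1 s2 s3 s4].
    have k1 : o1 * (wx - qx) <= 0 by rewrite nmulr_rle0 // subr_ge0.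
    have k2 : 0 <= o2 * (zx - qx) by rewrite mulr_ge0 ?subr_ge0 // ltW.
    have k3 : o4 * (qx - px) <= 0 by rewrite nmulr_rle0 // subr_ge0.
    have /eqP : o1 * (wx - qx) = 0 by lra.
    rewrite mulf_eq0 (lt_eqF s1) subr_eq0 /= => /eqP ->; split => //.
    have /eqP : o4 * (qx - px) = 0 by lra.
    by rewrite mulf_eq0 (lt_eqF s4) subr_eq0 /= => /eqP ->.
  have k1 : 0 <= o1 * (wx - qx) by rewrite pmulr_rge0 // subr_ge0.
  have k2 : o2 * (zx - qx) <= 0 by rewrite nmulr_rle0 ?subr_ge0.
  have k3 : 0 <= o4 * (qx - px) by rewrite pmulr_rge0 // subr_ge0.
  have /eqP : o1 * (wx - qx) = 0 by lra.
  rewrite mulf_eq0 (gt_eqF s1) subr_eq0 /= => /eqP ->; split => //.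
  have /eqP : o4 * (qx - px) = 0 by lra.
  by rewrite mulf_eq0 (gt_eqF s4) subr_eq0 /= => /eqP ->.
- by case: sg => -[s1 s2 s3 s4]; rewrite ?s1 ?s4 ?(lt_gtF s1) ?(lt_gtF s4).
- by case: sg => -[s1 s2 s3 s4]; rewrite ?s1 ?s2 ?(lt_gtF s1) ?(lt_gtF s2).
- by case: sg => -[s1 s2 s3 s4]; rewrite ?s3 ?s4 ?(lt_gtF s3) ?(lt_gtF s4).
- by case: sg => -[s1 s2 s3 s4]; rewrite ?s2 ?s3 ?(lt_gtF s2) ?(lt_gtF s3).
- exfalso; case: sg => -[s1 s2 s3 s4].
    have k1 : 0 < o1 * (wx - px) by rewrite nmulr_rgt0 // subr_lt0.
    have k2 : o2 * (zx - px) < 0 by rewrite pmulr_rlt0 ?subr_lt0.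
    have k3 : 0 <= o3 * (qx - px) by rewrite pmulr_rge0 ?subr_ge0.
    by lra.
  have k1 : o1 * (wx - px) < 0 by rewrite pmulr_rlt0 // subr_lt0.
  have k2 : 0 < o2 * (zx - px) by rewrite nmulr_rgt0 ?subr_lt0.
  have k3 : o3 * (qx - px) <= 0 by rewrite nmulr_rle0 ?subr_ge0.
  by lra.
Qed.

End Parity.

(** * Parity of a cyclic list of edges *)

Section CycleParity.
Variable R : realType.
Implicit Types (a b c d p q x y z u v w : R * R) (t s : R).
Implicit Types (E : seq ((R * R) * (R * R))).

Definition parity E z : bool := \big[addb/false]_(e <- E) hit e.1 e.2 z.

(* Every point is an endpoint of an even number of edges of [E]. *)
Definition cyclic E := forall g : R * R -> bool,
  \big[addb/false]_(e <- E) (g e.1 (+) g e.2) = false.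

Definition off E z := forall e, e \in E -> ~ on_seg e.1 e.2 z.

Definition off_seg E z z' := forall x, on_seg z z' x -> off E x.

(** Disjoint segments neither of which is strictly on one side of the other's line are collinear;
    then all orientations vanish, and the strict inequalities in [hit] and [above] make both sides
    false. *)
Lemma hit_disjoint p q z z' :
  (forall x, on_seg p q x -> ~ on_seg z z' x) ->
  hit p q z (+) hit p q z' = above z z' p (+) above z z' q.
Proof.
move=> dis.
have [h|h1] := ltP 0 (orient p q z * orient p q z').
  by apply: hit_same_side; left.
have [h|h2] := ltP 0 (orient z z' p * orient z z' q).
  by apply: hit_same_side; right.
have [e1|n] := eqVneq (orient p q z) (orient p q z'); last first.
  by have [x x1 x2] := seg_meet h1 h2 n; case: (dis x).
have e3 : orient z z' p = orient z z' q by have := orient_quad p q z z'; lra.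
have z1 : orient p q z' = 0.
  by apply/eqP; rewrite -sqrf_eq0 expr2 eq_le -{1}e1 h1 -expr2 sqr_ge0.
have z2 : orient z z' q = 0.
  by apply/eqP; rewrite -sqrf_eq0 expr2 eq_le -{1}e3 h2 -expr2 sqr_ge0.
by rewrite /hit /above e1 e3 z1 z2 !ltxx !andbF.
Qed.

(** Summed over a cyclic list, the values of [above z z'] at the endpoints cancel. *)
Lemma parity_free E z z' : cyclic E -> off_seg E z z' -> parity E z = parity E z'.
Proof.
move=> cE f; suff : parity E z (+) parity E z' = false.
  by case: (parity E z); case: (parity E z').
rewrite /parity -big_split /= -[RHS](cE (above z z')); apply: eq_big_seq => e eE.
by apply: hit_disjoint => x xe xz; case: (f x xz e eE).
Qed.

Lemma parity_cross E p q z z' t s : cyclic ((p, q) :: E) ->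
  off_seg E z z' -> 0 < t < 1 -> 0 < s < 1 -> lerp p q t = lerp z z' s ->
  orient p q z != 0 -> parity ((p, q) :: E) z = ~~ parity ((p, q) :: E) z'.
Proof.
move=> cE f /andP[t0 t1] /andP[s0 s1] xE oz.
have h1 : (1 - s) * orient p q z + s * orient p q z' = 0.
  by rewrite -orient_lerp -xE orient_lerp orient_aba orient_abb; ring.
have h2 : (1 - t) * orient z z' p + t * orient z z' q = 0.
  by rewrite -orient_lerp xE orient_lerp orient_aba orient_abb; ring.
have conv0 (r k k' : R) : 0 < r -> r < 1 -> (1 - r) * k + r * k' = 0 -> k != 0 -> k * k' < 0.
  move=> r0 r1 h kn.
  have -> : k' = - ((1 - r) / r * k).
    apply: (mulfI (lt0r_neq0 r0)); transitivity (- ((1 - r) * k)); first by lra.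
    by field; exact: lt0r_neq0.
  rewrite mulrN oppr_lt0 mulrCA; apply: mulr_gt0; first by apply: divr_gt0; lra.
  by rewrite -expr2 lt_neqAle eq_sym sqrf_eq0 kn sqr_ge0.
have n1 : orient p q z * orient p q z' < 0 by apply: (conv0 s).
have n2 : orient z z' p * orient z z' q < 0.
  apply: (conv0 t) => //; apply/eqP => z0.
  move: h2; rewrite z0 mulr0 add0r => /eqP; rewrite mulf_eq0 (gt_eqF t0) /= => /eqP z1.
  have := orient_quad p q z z'; rewrite z0 z1 !addr0 => e.
  by move: n1; rewrite e -expr2 ltNge sqr_ge0.
suff : parity ((p, q) :: E) z (+) parity ((p, q) :: E) z' = true.
  by case: (parity _ z); case: (parity _ z').
rewrite -[RHS]/(~~ false) -[in RHS](cE (above z z')) /parity !big_cons /=.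
rewrite addbACA hit_cross // addNb; congr (~~ (_ (+) _)).
rewrite -big_split; apply: eq_big_seq => e eE.
by apply: hit_disjoint => x xe xz; case: (f x xz e eE).
Qed.

End CycleParity.

(** * Clearance *)

Section Clearance.
Variable R : realType.
Implicit Types (a b c d p q x y z u v w : R * R) (t s r : R).
Implicit Types (E : seq ((R * R) * (R * R))).

(** The separating line is a parallel to [ab] through the nearer of [c] and [d], or the line [cd],
    or, if all points are collinear, the perpendicular to [cd] at the end facing [ab]. It is strict
    on the side of [ab], whose endpoints are the ones to be perturbed. *)
Lemma separate a b c d : c != d -> (forall x, on_seg a b x -> ~ on_seg c d x) ->
  exists k : R * R * R,
  [/\ k.1.1 * a.1 + k.1.2 * a.2 < k.2, k.1.1 * b.1 + k.1.2 * b.2 < k.2,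
      k.2 <= k.1.1 * c.1 + k.1.2 * c.2 & k.2 <= k.1.1 * d.1 + k.1.2 * d.2].
Proof.
move=> cd dis.
have [h|h1] := ltP 0 (orient a b c * orient a b d).
  case: (mulr_gt0_sgn h) => -[hc hd]; [
    exists (b.2 - a.2, a.1 - b.1, (b.2 - a.2) * a.1 + (a.1 - b.1) * a.2
              + Num.min (- orient a b c) (- orient a b d))
  | exists (a.2 - b.2, b.1 - a.1, (a.2 - b.2) * a.1 + (b.1 - a.1) * a.2
              + Num.min (orient a b c) (orient a b d))];
  by rewrite /=; move: hc hd; rewrite minEle; case: ifP; rewrite /orient; split; lra.
have [h|h2] := ltP 0 (orient c d a * orient c d b).
  case: (mulr_gt0_sgn h) => -[ha hb]; [
    exists (c.2 - d.2, d.1 - c.1, (c.2 - d.2) * c.1 + (d.1 - c.1) * c.2)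
  | exists (d.2 - c.2, c.1 - d.1, (d.2 - c.2) * c.1 + (c.1 - d.1) * c.2)];
  by rewrite /=; move: ha hb; rewrite /orient; split; lra.
have [e1|n] := eqVneq (orient a b c) (orient a b d); last first.
  by have [x x1 x2] := seg_meet h1 h2 n; case: (dis x).
have e3 : orient c d a = orient c d b by have := orient_quad a b c d; lra.
have z2 : orient c d b = 0.
  by apply/eqP; rewrite -sqrf_eq0 expr2 eq_le -{1}e3 h2 -expr2 sqr_ge0.
rewrite z2 in e3.
have pa := projK cd e3; have pb := projK cd z2.
have N : 0 < sqd c d by apply: sqd_gt0.
have out x : orient c d x = 0 -> ~ on_seg c d x -> proj c d x < 0 \/ 1 < proj c d x.
  move=> ox nx; have [|h] := ltP (proj c d x) 0; [by left|right].
  by rewrite ltNge; apply/negP => h'; apply: nx; rewrite (projK cd ox); apply: on_seg_lerp.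
have val x : proj c d x * sqd c d =
    (d.1 - c.1) * x.1 + (d.2 - c.2) * x.2 - ((d.1 - c.1) * c.1 + (d.2 - c.2) * c.2).
  by rewrite /proj divfK ?lt0r_neq0 //; ring.
have vala := val a; have valb := val b; have vald := val d.
rewrite proj_r // mul1r in vald.
have [] := out a e3 (dis _ (on_segl a b)) => ha; have [] := out b z2 (dis _ (on_segr a b)) => hb.
- exists (d.1 - c.1, d.2 - c.2, (d.1 - c.1) * c.1 + (d.2 - c.2) * c.2) => /=.
  have ha' : proj c d a * sqd c d < 0 by rewrite nmulr_rlt0.
  have hb' : proj c d b * sqd c d < 0 by rewrite nmulr_rlt0.
  by split; lra.
(* Here [a] and [b] lie beyond different ends of [cd], so [ab] would contain [c]; the next case is
   its mirror image. *)
- exfalso; apply: (dis c (ex_intro _ (- proj c d a / (proj c d b - proj c d a)) _)).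
    have pos : 0 < proj c d b - proj c d a by lra.
    split; first by apply: divr_ge0; lra.
    split; first by rewrite ler_pdivrMr // mul1r; lra.
    have -> T : lerp a b T = lerp (lerp c d (proj c d a)) (lerp c d (proj c d b)) T.
      by rewrite -pa -pb.
    rewrite lerp_lerp -[LHS](lerp0 c d); congr lerp.
    by field; rewrite lt0r_neq0.
  exact: on_segl.
- exfalso; apply: (dis c (ex_intro _ ((proj c d a) / (proj c d a - proj c d b)) _)).
    have pos : 0 < proj c d a - proj c d b by lra.
    split; first by apply: divr_ge0; lra.
    split; first by rewrite ler_pdivrMr // mul1r; lra.
    have -> T : lerp a b T = lerp (lerp c d (proj c d a)) (lerp c d (proj c d b)) T.
      by rewrite -pa -pb.
    rewrite lerp_lerp -[LHS](lerp0 c d); congr lerp.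
    by field; rewrite lt0r_neq0.
  exact: on_segl.
exists (c.1 - d.1, c.2 - d.2, (c.1 - d.1) * d.1 + (c.2 - d.2) * d.2) => /=.
have ha' : sqd c d < proj c d a * sqd c d by rewrite ltr_pMl.
have hb' : sqd c d < proj c d b * sqd c d by rewrite ltr_pMl.
by split; lra.
Qed.

Definition close (r : R) x y := `|x.1 - y.1| < r /\ `|x.2 - y.2| < r.

Lemma close_refl r x : 0 < r -> close r x x.
Proof. by move=> r0; rewrite /close !subrr normr0. Qed.

Lemma close_le r r' x y : r <= r' -> close r x y -> close r' x y.
Proof. by move=> rr [h1 h2]; split; apply: lt_le_trans rr. Qed.

Lemma close_lin (r k1 k2 : R) a a' : 0 < r -> close r a' a ->
  k1 * a'.1 + k2 * a'.2 <= k1 * a.1 + k2 * a.2 + (`|k1| + `|k2|) * r.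
Proof.
move=> r0 [h1 h2].
have e1 : k1 * (a'.1 - a.1) <= `|k1| * r.
  by apply: le_trans (ler_norm _) _; rewrite normrM ler_wpM2l // ltW.
have e2 : k2 * (a'.2 - a.2) <= `|k2| * r.
  by apply: le_trans (ler_norm _) _; rewrite normrM ler_wpM2l // ltW.
by lra.
Qed.

Lemma seg_clear a b c d : c != d -> (forall x, on_seg a b x -> ~ on_seg c d x) ->
  exists2 r, 0 < r & forall a' b', close r a' a -> close r b' b ->
    forall x, on_seg a' b' x -> ~ on_seg c d x.
Proof.
move=> cd dis; have [[[k1 k2] k] /= [ha hb hc hd]] := separate cd dis.
(* The summand 1 makes [N] positive and leaves a slack: a perturbation within [r = m / N] changes
   the linear form by at most [m - r]. *)
pose N := `|k1| + `|k2| + 1.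
have N0 : 0 < N by rewrite /N; have := normr_ge0 k1; have := normr_ge0 k2; lra.
pose m := Num.min (k - (k1 * a.1 + k2 * a.2)) (k - (k1 * b.1 + k2 * b.2)).
have m0 : 0 < m by rewrite lt_min; apply/andP; split; lra.
have [m1 m2] : m <= k - (k1 * a.1 + k2 * a.2) /\ m <= k - (k1 * b.1 + k2 * b.2).
  by rewrite /m; split; rewrite ge_min lexx ?orbT.
pose r := m / N; have r0 : 0 < r by exact: divr_gt0.
have rN : r * N = m by rewrite /r divfK // lt0r_neq0.
exists r => // a' b' ca cb x [t [t0 [t1 xE]]] [s [s0 [s1 xE']]].
have la := close_lin k1 k2 r0 ca; have lb := close_lin k1 k2 r0 cb.
have e : (`|k1| + `|k2|) * r = m - r by rewrite -rN /N; ring.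
have va : 0 < k - (k1 * a'.1 + k2 * a'.2) by lra.
have vb : 0 < k - (k1 * b'.1 + k2 * b'.2) by lra.
have := conv_gt0 t0 t1 va vb.
have hc' : 0 <= k1 * c.1 + k2 * c.2 - k by lra.
have hd' : 0 <= k1 * d.1 + k2 * d.2 - k by lra.
have := conv01 s0 s1 hc' hd'.
have x1 : x.1 = (1 - t) * a'.1 + t * b'.1 by rewrite xE.
have x2 : x.2 = (1 - t) * a'.2 + t * b'.2 by rewrite xE.
have y1 : x.1 = (1 - s) * c.1 + s * d.1 by rewrite xE'.
have y2 : x.2 = (1 - s) * c.2 + s * d.2 by rewrite xE'.
move=> h1 h2.
have : 0 <= k1 * x.1 + k2 * x.2 - k by rewrite y1 y2; lra.
have : 0 < k - (k1 * x.1 + k2 * x.2) by rewrite x1 x2; lra.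
lra.
Qed.

Definition nondeg E := forall e, e \in E -> e.1 != e.2.

Lemma off_seg_clear E a b : nondeg E -> off_seg E a b ->
  exists2 r, 0 < r & forall a' b', close r a' a -> close r b' b -> off_seg E a' b'.
Proof.
elim: E => [|e E IH] nd fE; first by exists 1 => // a' b' _ _ x _ e; rewrite in_nil.
have [|x xs e' e'E|r1 r10 h1] := IH.
- by move=> e' e'E; apply: nd; rewrite inE e'E orbT.
- by apply: (fE x xs); rewrite inE e'E orbT.
have [||r2 r20 h2] := @seg_clear a b e.1 e.2.
- by apply: nd; rewrite inE eqxx.
- by move=> x xs; apply: (fE x xs); rewrite inE eqxx.
exists (Num.min r1 r2) => [|a' b' ca cb x xs e']; first by rewrite lt_min r10 r20.
have cl (u v : R * R) : close (Num.min r1 r2) u v -> close r1 u v /\ close r2 u v.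
  by move=> h; split; apply: close_le h; rewrite ge_min lexx ?orbT.
case: (cl _ _ ca) => ca1 ca2; case: (cl _ _ cb) => cb1 cb2.
rewrite inE => /orP[/eqP ->|e'E]; first exact: (h2 a' b').
exact: (h1 a' b').
Qed.

Lemma off_clear E x : nondeg E -> off E x ->
  exists2 r, 0 < r & forall a' b', close r a' x -> close r b' x -> off_seg E a' b'.
Proof.
move=> nd fx; apply: off_seg_clear => // y [t [_ [_ ->]]]; rewrite lerpxx.
exact: fx.
Qed.

Lemma lerp_close x y r : 0 < r ->
  exists2 t0, 0 < t0 < 1 & forall t, 0 <= t <= t0 -> close r (lerp x y t) x.
Proof.
move=> r0; pose N := `|y.1 - x.1| + `|y.2 - x.2| + 1.
have n1 := normr_ge0 (y.1 - x.1); have n2 := normr_ge0 (y.2 - x.2).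
have N0 : 0 < N by rewrite /N; lra.
exists (Num.min (1 / 2) (r / N)).
  apply/andP; split; first by rewrite lt_min; apply/andP; split; [lra | exact: divr_gt0].
  by rewrite gt_min; apply/orP; left; lra.
move=> t /andP[t0]; rewrite le_min => /andP[_ tr].
have tN : t * N <= r by rewrite -ler_pdivlMr.
have key (u v : R) : `|u - v| < N -> `|(1 - t) * v + t * u - v| < r.
  move=> h; have -> : (1 - t) * v + t * u - v = t * (u - v) by ring.
  rewrite normrM (ger0_norm t0); have [->|tn] := eqVneq t 0; first by rewrite mul0r.
  have tp : 0 < t by rewrite lt_neqAle eq_sym tn.
  by apply: lt_le_trans tN; rewrite ltr_pM2l.
by split; apply: key; rewrite /N; lra.
Qed.

Lemma off_near E x y : nondeg E -> off E x ->
  exists2 t0, 0 < t0 < 1 & off_seg E x (lerp x y t0).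
Proof.
move=> nd fx; have [r r0 h] := off_clear nd fx.
have [t0 t01 ht] := lerp_close x y r0; exists t0 => //.
apply: h; first exact: close_refl.
by apply: ht; rewrite lexx andbT; case/andP: t01 => /ltW.
Qed.

End Clearance.

(** * First boundary point on a segment; points far away *)

Section FirstHit.
Variable R : realType.
Implicit Types (a b c d p q x y z u v w : R * R) (t s r : R).
Implicit Types (E : seq ((R * R) * (R * R))).

(** The infimum of the parameters that lie on an edge is attained, because avoiding the edges is an
    open condition by [off_near]. *)
Lemma first_hit E z w : nondeg E -> off E z -> ~ off_seg E z w ->
  exists t, [/\ 0 < t, t <= 1, ~ off E (lerp z w t) &
    forall s, 0 <= s -> s < t -> off E (lerp z w s)].
Proof.
move=> nd fz nf.
pose S : R -> Prop := fun t => 0 <= t /\ t <= 1 /\ ~ off E (lerp z w t).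
have S0 : exists t, S t.
  apply/not_existsP => h; apply: nf => x [t [t0 [t1 ->]]].
  by apply: contrapT => h'; apply: (h t).
have lb : classical_sets.lbound S 0 by move=> t [].
have hi : classical_sets.has_inf S by split; [case: S0 => t St; exists t | exists 0].
have T0 : 0 <= inf S by apply: lb_le_inf; [case: hi|].
have T1 t : S t -> inf S <= t by apply: ge_inf; exists 0.
have Tle1 : inf S <= 1 by case: S0 => t St; apply: le_trans (T1 t St) _; case: St => _ [].
have before s : 0 <= s -> s < inf S -> off E (lerp z w s).
  move=> s0 sT; apply: contrapT => h.
  have /T1 : S s by split=> //; split=> //; lra.
  by rewrite leNgt sT.
have nT : ~ off E (lerp z w (inf S)).
  move=> fT; have [e e01 fe] := off_near w nd fT.
  (* At parameter 1 there is no room to move on towards [w], but then every element of [S] equals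
     the infimum. *)
  have [Teq|Tlt] := eqVneq (inf S) 1.
    case: S0 => t St; have := T1 t St; case: St => t0 [t1 nt].
    by rewrite Teq => ?; apply: nt; have -> : t = inf S by lra.
  have T1' : 0 < 1 - inf S by rewrite subr_gt0 lt_neqAle Tlt.
  have eps0 : 0 < e * (1 - inf S) by apply: mulr_gt0 => //; case/andP: e01.
  have [t St tlt] := inf_adherent eps0 hi.
  have tT := T1 t St; case: St => t0 [t1]; apply; apply: fe.
  have E' : (1 - e) * inf S + e = inf S + e * (1 - inf S) by ring.
  rewrite lerp_lerpr E'.
  exists ((t - inf S) / (e * (1 - inf S))); split; first by apply: divr_ge0; lra.
  split; first by rewrite ler_pdivrMr // mul1r; lra.
  rewrite lerp_lerp; congr lerp; field.
  by rewrite !lt0r_neq0 //; case/andP: e01.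
exists (inf S); split=> //; rewrite lt_neqAle T0 andbT eq_sym.
by apply/eqP => e; apply: nT; rewrite e lerp0.
Qed.

Lemma edges_bounded E : exists2 B : R, 0 <= B & forall e, e \in E ->
  [/\ `|e.1.1| <= B, `|e.1.2| <= B, `|e.2.1| <= B & `|e.2.2| <= B].
Proof.
elim: E => [|e E [B B0 IH]]; first by exists 0.
exists (B + `|e.1.1| + `|e.1.2| + `|e.2.1| + `|e.2.2|).
  by rewrite !addr_ge0.
have := normr_ge0 e.1.1; have := normr_ge0 e.1.2.
have := normr_ge0 e.2.1; have := normr_ge0 e.2.2 => h1 h2 h3 h4 e'.
rewrite inE => /orP[/eqP ->|/IH[]]; first by split; lra.
by move=> *; split; lra.
Qed.

(** Beyond [B + B] one coordinate exceeds [B] in absolute value, so the point is right of, left of,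
    above or below the square containing all edges; in the first three cases no edge is hit. *)
Lemma far_outside E : cyclic E -> exists M : R, forall z,
  M < `|z.1| + `|z.2| -> off E z /\ parity E z = false.
Proof.
move=> cE; have [B B0 hB] := edges_bounded E.
exists (B + B) => z hz.
have zB : B < `|z.1| \/ B < `|z.2|.
  by have [|h] := ltP B `|z.1|; [left|right; lra].
split.
  move=> e /hB[b1 b2 b3 b4] [t [t0 [t1 zE]]].
  have key (u v : R) : `|u| <= B -> `|v| <= B -> `|(1 - t) * u + t * v| <= B.
    rewrite !ler_norml => /andP[h1 h2] /andP[h3 h4]; apply/andP; split.
      have := @conv01 R (u + B) (v + B) t t0 t1; lra.
    exact: conv01_le.
  have : `|z.1| <= B by rewrite zE; apply: key.
  have : `|z.2| <= B by rewrite zE; apply: key.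
  lra.
have bnd e : e \in E -> 
    [/\ - B <= e.1.1 <= B, - B <= e.1.2 <= B, - B <= e.2.1 <= B & - B <= e.2.2 <= B].
  by move=> /hB[]; rewrite !ler_norml.
rewrite /parity; case: zB; rewrite ltr_normr => /orP[zp|zn].
- rewrite big1_seq // => e /andP[_ /bnd[/andP[? ?] _ /andP[? ?] _]].
  have h1 : e.1.1 <= z.1 by lra.
  have h2 : e.2.1 <= z.1 by lra.
  by rewrite /hit h1 h2.
- rewrite big1_seq // => e /andP[_ /bnd[/andP[? ?] _ /andP[? ?] _]].
  have h1 : (e.1.1 <= z.1) = false by apply/negP; lra.
  have h2 : (e.2.1 <= z.1) = false by apply/negP; lra.
  by rewrite /hit h1 h2.
- rewrite big1_seq // => e /andP[_ /bnd[_ /andP[? ?] _ /andP[? ?]]].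
  have oE : orient e.1 e.2 z = (e.2.1 - z.1) * (z.2 - e.1.2) + (z.1 - e.1.1) * (z.2 - e.2.2).
    by rewrite /orient; ring.
  rewrite /hit; case: (leP e.1.1 z.1) => h1; case: (leP e.2.1 z.1) => h2 //=.
    rewrite orbF; apply/negbTE; rewrite -leNgt oE.
    by apply: addr_ge0; apply: mulr_ge0; lra.
  apply/negbTE; rewrite -leNgt oE -oppr_ge0 opprD -!mulNr.
  by apply: addr_ge0; apply: mulr_ge0; lra.
(* Below the square an edge is hit exactly when the vertical through [z] separates its endpoints, so
   the parity is a cyclic sum. *)
rewrite -[RHS](cE (fun p => p.1 <= z.1)); apply: eq_big_seq => e.
move=> /bnd[_ /andP[? ?] _ /andP[? ?]].
have oE : orient e.1 e.2 z = (e.2.1 - z.1) * (z.2 - e.1.2) + (z.1 - e.1.1) * (z.2 - e.2.2).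
  by rewrite /orient; ring.
rewrite /hit; case: (leP e.1.1 z.1) => h1; case: (leP e.2.1 z.1) => h2 //=.
  rewrite orbF oE -oppr_gt0 opprD -!mulrN.
  by apply: ltr_pwDl; [apply: mulr_gt0|apply: mulr_ge0]; lra.
rewrite oE -mulrNN -[X in _ + X]mulrNN.
by apply: ltr_wpDl; [apply: mulr_ge0|apply: mulr_gt0]; lra.
Qed.

End FirstHit.

(** * Simple polygons and the Jordan curve theorem *)

Section Polygon.
Variables (R : realType) (n : nat) (p : 'I_n -> R * R).
Hypothesis sp : simple_polygon p.
Implicit Types (a b c d q x y z u v w : R * R) (t s r : R) (i j k : 'I_n).

(** The predicate on indices makes it possible to set aside one edge, the two edges at a vertex, or
    an arc. *)
Definition edges (Q : pred 'I_n) : seq ((R * R) * (R * R)) :=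
  [seq (p i, p (ordS i)) | i <- enum 'I_n & Q i].

Lemma mem_edges (Q : pred 'I_n) e :
  reflect (exists2 i, Q i & e = (p i, p (ordS i))) (e \in edges Q).
Proof.
apply: (iffP mapP) => [[i]|[i Qi ->]].
  by rewrite mem_filter => /andP[Qi _] ->; exists i.
by exists i => //; rewrite mem_filter Qi mem_enum.
Qed.

Lemma big_edges (Q : pred 'I_n) (F : (R * R) * (R * R) -> bool) :
  \big[addb/false]_(e <- edges Q) F e = \big[addb/false]_(i | Q i) F (p i, p (ordS i)).
Proof. by rewrite big_map big_filter big_enum_cond. Qed.

Lemma n_ge3 : (3 <= n)%N. Proof. by case: sp. Qed.

Lemma p_inj : injective p. Proof. by case: sp => _ []. Qed.

Lemma ordS_neq i : ordS i != i.
Proof.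
apply/eqP => /(congr1 val) /= h; have n3 := n_ge3; have lti := ltn_ord i.
case: (ltnP i.+1 n) => h1; first by move: h; rewrite modn_small; lia.
have e : i.+1 = n by lia.
by move: h; rewrite e modnn; lia.
Qed.

Lemma ordSS_neq i : ordS (ordS i) != i.
Proof.
apply/eqP => /(congr1 val) /= h; have n3 := n_ge3; have lti := ltn_ord i.
move: h; rewrite -addn1 modnDml addn1.
case: (ltnP i.+2 n) => [h1|h1]; first by rewrite modn_small; lia.
case: (ltnP i.+1 n) => h2.
  have -> : i.+2 = n by lia.
  by rewrite modnn; lia.
have -> : i.+2 = (1 + n)%N by lia.
by rewrite modnDr modn_small; lia.
Qed.

Lemma edge_neq i : p i != p (ordS i).
Proof. by apply/eqP => /p_inj /eqP; rewrite eq_sym (negPf (ordS_neq i)). Qed.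

Lemma nondeg_edges Q : nondeg (edges Q).
Proof. by move=> e /mem_edges[i _ ->]; exact: edge_neq. Qed.

Notation P := (edges predT).

Lemma offP z : off P z <-> ~ boundary p z.
Proof.
split=> [h [i hi]|h e /mem_edges[i _ ->] hi]; last by apply: h; exists i.
by apply: (h (p i, p (ordS i))) => //; apply/mem_edges; exists i.
Qed.

Lemma off_edges Q z : off (edges Q) z <-> forall i, Q i -> ~ on_seg (p i) (p (ordS i)) z.
Proof.
split=> [h i Qi|h e /mem_edges[i Qi ->]]; last exact: h.
by apply: (h (p i, p (ordS i))); apply/mem_edges; exists i.
Qed.

Lemma boundary_vertex i : boundary p (p i).
Proof. by exists i; exact: on_segl. Qed.

Lemma edges_meet i j x : i != j ->
    on_seg (p i) (p (ordS i)) x -> on_seg (p j) (p (ordS j)) x ->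
    (j = ordS i /\ x = p j) \/ (i = ordS j /\ x = p i).
Proof. by move=> ij; case: sp => _ [_ h]; exact: h. Qed.

Lemma vertex_on_edge i k : on_seg (p i) (p (ordS i)) (p k) -> k = i \/ k = ordS i.
Proof.
move=> h; have [->|ik] := eqVneq k i; [by left|right].
rewrite eq_sym in ik.
case: (edges_meet ik h (on_segl _ _)) => [[]//|[e /p_inj e']].
by rewrite e' eqxx in ik.
Qed.

Lemma lerp_inj a b t s : a != b -> lerp a b t = lerp a b s -> t = s.
Proof.
move=> ab /(congr1 (proj a b)); rewrite !proj_lerp proj_l proj_r //; lra.
Qed.

Lemma open_edge_vertex i t k : 0 < t < 1 -> lerp (p i) (p (ordS i)) t <> p k.
Proof.
move=> /andP[t0 t1] h.
have /vertex_on_edge : on_seg (p i) (p (ordS i)) (p k).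
  by rewrite -h; apply: on_seg_lerp; lra.
case=> e; move: h; rewrite e.
  rewrite -[RHS](lerp0 (p i) (p (ordS i))) => /(lerp_inj (edge_neq i)); lra.
rewrite -[RHS](lerp1 (p i) (p (ordS i))) => /(lerp_inj (edge_neq i)); lra.
Qed.

Lemma open_edge_off i t : 0 < t < 1 ->
  off (edges (predC1 i)) (lerp (p i) (p (ordS i)) t).
Proof.
move=> t01; apply/off_edges => j /= ji h.
have h' : on_seg (p i) (p (ordS i)) (lerp (p i) (p (ordS i)) t).
  by case/andP: t01 => *; apply: on_seg_lerp; lra.
by case: (edges_meet ji h h') => -[_]; exact: open_edge_vertex.
Qed.

Lemma off_split i z : off (edges (predC1 i)) z -> ~ on_seg (p i) (p (ordS i)) z -> off P z.
Proof.
move=> /off_edges h1 h2; apply/off_edges => j _.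
by have [->|ji] := eqVneq j i => //; apply: h1.
Qed.

Lemma open_or_vertex i x : on_seg (p i) (p (ordS i)) x ->
  (exists k, x = p k) \/ exists2 t, 0 < t < 1 & x = lerp (p i) (p (ordS i)) t.
Proof.
move=> [t [t0 [t1 ->]]].
have [->|tn0] := eqVneq t 0; first by left; exists i; rewrite lerp0.
have [->|tn1] := eqVneq t 1; first by left; exists (ordS i); rewrite lerp1.
by right; exists t => //; rewrite !lt_neqAle t0 t1 tn1 eq_sym tn0.
Qed.

Lemma off_segP z w : (forall x, on_seg z w x -> ~ boundary p x) <-> off_seg P z w.
Proof. by split=> h x /h /offP. Qed.

Lemma cyclicP : cyclic P.
Proof.
move=> g; rewrite big_edges big_split /=.
by rewrite [X in _ (+) X = _](_ : _ = \big[addb/false]_(i < n) g (p i)) ?addbb //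
  [RHS](reindex_inj (@ordS_inj n)).
Qed.

Lemma parityD1 i z :
  parity P z = parity ((p i, p (ordS i)) :: edges (predC1 i)) z.
Proof.
rewrite /parity big_cons !big_edges (bigD1 i) //=; congr (_ (+) _).
Qed.

Lemma cyclicD1 i : cyclic ((p i, p (ordS i)) :: edges (predC1 i)).
Proof.
move=> g; rewrite big_cons !big_edges -[RHS](cyclicP g) big_edges [RHS](bigD1 i) //=.
Qed.

Definition reach y y' := exists2 l, free_path p y l & last y l = y'.

Lemma reach_refl y : reach y y. Proof. by exists [::]. Qed.

Lemma reach_seg y y' : off_seg P y y' -> reach y y'.
Proof. by move=> /off_segP h; exists [:: y']. Qed.

Lemma free_path_cat y l l' :
  free_path p y l -> free_path p (last y l) l' -> free_path p y (l ++ l').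
Proof. by elim: l y => //= w l IH y [h1 h2] h3; split=> //; exact: IH. Qed.

Lemma reach_trans y y' y'' : reach y y' -> reach y' y'' -> reach y y''.
Proof.
move=> [l fl <-] [l' fl' <-]; exists (l ++ l'); last by rewrite last_cat.
exact: free_path_cat.
Qed.

Lemma off_segC E y y' : off_seg E y y' -> off_seg E y' y.
Proof. by move=> h x /on_segC /h. Qed.

Lemma reach_sym y y' : reach y y' -> reach y' y.
Proof.
move=> [l fl <-]; elim: l y fl => [|w l IH] y /=; first by move=> _; exact: reach_refl.
move=> [/off_segP h /IH h']; apply: reach_trans h' _.
by apply: reach_seg; exact: off_segC.
Qed.

Lemma reach_parity y y' : reach y y' -> parity P y = parity P y'.
Proof.
move=> [l fl <-]; elim: l y fl => [|w l IH] y //= [/off_segP h /IH <-].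
by apply: parity_free => //; exact: cyclicP.
Qed.

End Polygon.

(** * Moving along one side of an edge *)

Section EdgeGerms.
Variables (R : realType) (n : nat) (p : 'I_n -> R * R).
Hypothesis sp : simple_polygon p.
Implicit Types (a b c d q x y z u v w : R * R) (t s r : R) (i j k : 'I_n).

Notation P := (edges p predT).
Notation pS i := (p (ordS i)).

(** Here [y] stands for one side of edge [i]: a segment leads from [y] to a foot in the open edge,
    transversally and without meeting the boundary before the foot. *)
Definition germ i y := orient (p i) (pS i) y != 0 /\
  exists2 t, 0 < t < 1 & forall s, 0 < s -> s <= 1 ->
     off P (lerp (lerp (p i) (pS i) t) y s).

Lemma off_orient i z : off (edges p (predC1 i)) z -> orient (p i) (pS i) z != 0 -> off P z.
Proof.
by move=> h1 h2; apply: off_split h1 _ => /orient_on_seg h; rewrite h eqxx in h2.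
Qed.

Lemma orient_base i t y s :
  orient (p i) (pS i) (lerp (lerp (p i) (pS i) t) y s) = s * orient (p i) (pS i) y.
Proof. by rewrite !orient_lerp orient_aba orient_abb; ring. Qed.

Lemma germ_reach_near i y t r : (forall s, 0 < s -> s <= 1 ->
     off P (lerp (lerp (p i) (pS i) t) y s)) -> 0 < r ->
  exists s, [/\ 0 < s, s < 1, close r (lerp (lerp (p i) (pS i) t) y s) (lerp (p i) (pS i) t) &
    reach p y (lerp (lerp (p i) (pS i) t) y s)].
Proof.
move=> h r0; set x := lerp (p i) _ t.
have [s /andP[s0 s1] hs] := lerp_close x y r0.
exists s; split=> //; first by apply: hs; rewrite lexx ltW.
apply: reach_seg => w [e [e0 [e1 ->]]].
rewrite -{1}(lerp1 x y) lerp_lerp; apply: h; last by apply: conv01_le => //; lra.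
by apply: conv_gt0 => //; lra.
Qed.

(** Both points slide towards their feet until they are within the clearance between the part of the
    edge joining the feet and all other edges. The segment joining them then stays strictly on one
    side of edge [i]. *)
Lemma tube i y y' : germ i y -> germ i y' ->
  0 < orient (p i) (pS i) y * orient (p i) (pS i) y' -> reach p y y'.
Proof.
move=> [oy [t t01 ht]] [oy' [t' t01' ht']] same.
have fE : off_seg (edges p (predC1 i)) (lerp (p i) (pS i) t) (lerp (p i) (pS i) t').
  case/andP: t01 => t0 t1; case/andP: t01' => t0' t1'.
  move=> x [e [e0 [e1 ->]]]; rewrite lerp_lerp; apply: open_edge_off => //.
  rewrite conv_gt0 //=.
  have := @conv_gt0 R (1 - t) (1 - t') e; lra.
have [r r0 hr] := off_seg_clear (@nondeg_edges _ _ _ sp (predC1 i)) fE.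
have [s [s0 s1 cs rs]] := germ_reach_near ht r0.
have [s' [s0' s1' cs' rs']] := germ_reach_near ht' r0.
apply: reach_trans rs _; apply: reach_trans (reach_sym rs'); apply: reach_seg.
move=> w wseg; apply: (@off_orient i); first exact: (hr _ _ cs cs').
case: wseg => [e [e0 [e1 ->]]]; rewrite orient_lerp !orient_base.
case: (mulr_gt0_sgn same) => -[h1 h2].
  rewrite lt_eqF // -oppr_gt0 opprD -!mulrN.
  by apply: conv_gt0 => //; rewrite mulr_gt0 // oppr_gt0.
by rewrite gt_eqF //; apply: conv_gt0 => //; rewrite mulr_gt0.
Qed.

(** The edge is crossed at the foot [x], in the direction of [lerp x y (-1)], the reflection of [y]
    in [x]; a short enough crossing meets no other edge. *)
Lemma germ_flip i y : germ i y -> exists y',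
  [/\ germ i y', orient (p i) (pS i) y * orient (p i) (pS i) y' < 0 &
      parity P y = ~~ parity P y'].
Proof.
move=> [oy [t t01 ht]]; set x := lerp (p i) (pS i) t in ht.
have [r r0 hr] := off_clear (@nondeg_edges _ _ _ sp (predC1 i)) (open_edge_off sp (i := i) t01).
have [s [s0 s1 cs rs]] := germ_reach_near ht r0.
have [e /andP[e0 e1] he] := lerp_close x (lerp x y (-1)) r0.
have oz : orient (p i) (pS i) (lerp x y (-1)) = - orient (p i) (pS i) y.
  by rewrite /x orient_base; ring.
have oz' f : orient (p i) (pS i) (lerp x (lerp x y (-1)) f) = - (f * orient (p i) (pS i) y).
  by rewrite {1}/x orient_base oz; ring.
exists (lerp x (lerp x y (-1)) e); split.
- split; first by rewrite oz' oppr_eq0 mulf_neq0 // gt_eqF.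
  exists t => // f f0 f1; apply: (@off_orient i).
    apply: (hr x (lerp x (lerp x y (-1)) e)); first exact: close_refl.
      by apply: he; rewrite lexx ltW.
    by apply: on_seg_lerp => //; exact: ltW.
  rewrite {1}/x orient_base oz'; apply: mulf_neq0; first by rewrite gt_eqF.
  by rewrite oppr_eq0; apply: mulf_neq0 => //; rewrite gt_eqF.
- rewrite oz' mulrN oppr_lt0 mulrCA; apply: mulr_gt0 => //.
  by rewrite -expr2 lt_neqAle eq_sym sqrf_eq0 oy sqr_ge0.
rewrite (reach_parity rs) !(parityD1 _ i).
have k0 : 0 < s + e by rewrite addr_gt0.
apply: (@parity_cross _ _ _ _ _ _ t (s / (s + e))) => //.
- exact: cyclicD1.
- by apply: hr => //; apply: he; rewrite lexx ltW.
- by rewrite divr_gt0 //= ltr_pdivrMr // mul1r ltrDl.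
- rewrite -/x lerp_lerpl -{1}(lerp0 x y) lerp_lerp; congr lerp; field.
  by rewrite gt_eqF.
by rewrite orient_base mulf_neq0 // gt_eqF.
Qed.

Lemma germ_opp i y y' : germ i y -> germ i y' ->
  orient (p i) (pS i) y * orient (p i) (pS i) y' < 0 -> parity P y = ~~ parity P y'.
Proof.
move=> gy gy' op; have [y1 [g1 o1 ->]] := germ_flip gy; congr negb.
apply: reach_parity; apply: tube g1 gy' _.
by case: (mulr_lt0_sgn op) => -[h1 h2]; case: (mulr_lt0_sgn o1) => -[h3 h4]; nra.
Qed.

End EdgeGerms.

(** * Passing from an edge to the preceding one *)

Section VertexGerms.
Variables (R : realType) (n : nat) (p : 'I_n -> R * R).
Hypothesis sp : simple_polygon p.
Implicit Types (a b c d q x y z u v w : R * R) (t s r e f : R) (i j k : 'I_n).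

Notation P := (edges p predT).
Notation pS i := (p (ordS i)).

(** Affine coordinates at [v], chosen later so that both edges at the vertex lie on coordinate
    axes. *)
Definition frame v d d' s t : R * R :=
  (v.1 + s * d.1 + t * d'.1, v.2 + s * d.2 + t * d'.2).

Lemma frame_lerp v d d' s t s' t' e :
  lerp (frame v d d' s t) (frame v d d' s' t') e
  = frame v d d' ((1 - e) * s + e * s') ((1 - e) * t + e * t').
Proof. by rewrite /lerp /frame /=; congr pair; ring. Qed.

Definition other_edges i : pred 'I_n := [pred k | (k != i) && (k != ordS i)].

Lemma vertex_off i : off (edges p (other_edges i)) (pS i).
Proof.
apply/off_edges => k /andP[ki kSi] /(vertex_on_edge sp)[e|/ordS_inj e].
  by rewrite e eqxx in kSi.
by rewrite e eqxx in ki.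
Qed.

Lemma off_split2 i z : off (edges p (other_edges i)) z ->
  ~ on_seg (p i) (pS i) z -> ~ on_seg (pS i) (pS (ordS i)) z -> off P z.
Proof.
move=> /off_edges h1 h2 h3; apply/off_edges => k _.
have [->|ki] := eqVneq k i => //; have [->|kSi] := eqVneq k (ordS i) => //.
by apply: h1; rewrite /other_edges /= ki.
Qed.

Lemma vertex_clear i : exists2 r, 0 < r & forall a b, close r a (pS i) -> close r b (pS i) ->
  off_seg (edges p (other_edges i)) a b.
Proof. exact: off_clear (@nondeg_edges _ _ _ sp _) (@vertex_off i). Qed.

Lemma frames_close v d d' r s : 0 < r -> 0 <= s -> exists2 e, 0 < e < 1 &
  forall s' t, `|s'| <= e * s -> `|t| <= e * s -> close r (frame v d d' s' t) v.
Proof.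
move=> r0 s0; pose D := `|d.1| + `|d.2| + `|d'.1| + `|d'.2|.
have D0 : 0 <= D by rewrite /D !addr_ge0.
have [e e01 he] := @lerp_close R (0, 0) (s * D, 0) r r0.
exists e => // s' t hs ht.
case/andP: e01 => e0 e1.
have [] := he e; first by rewrite lexx ltW.
rewrite /lerp /= !mulr0 add0r subr0 => h _.
have h' : e * (s * D) < r by apply: le_lt_trans (ler_norm _) h.
have key (k k' : R) : `|k| + `|k'| <= D -> `|s' * k + t * k'| < r.
  move=> kD; apply: le_lt_trans (ler_normD _ _) _; rewrite !normrM.
  apply: le_lt_trans _ h'; rewrite mulrA.
  apply: (@le_trans _ _ (e * s * `|k| + e * s * `|k'|)).
    by apply: lerD; apply: ler_wpM2r.
  rewrite -mulrDr; apply: ler_wpM2l => //.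
  by rewrite mulr_ge0 // ltW.
have n1 := normr_ge0 d.1; have n2 := normr_ge0 d.2.
have n3 := normr_ge0 d'.1; have n4 := normr_ge0 d'.2.
rewrite /close /frame /=; split.
  have -> : v.1 + s' * d.1 + t * d'.1 - v.1 = s' * d.1 + t * d'.1 by ring.
  by apply: key; rewrite /D; lra.
have -> : v.2 + s' * d.2 + t * d'.2 - v.2 = s' * d.2 + t * d'.2 by ring.
by apply: key; rewrite /D; lra.
Qed.

(** With axes along the two edges, these lie on the half-axes [s >= 0] and [t >= 0]. On the side of
    the positive quadrant, [q e e] is a germ of both edges. On the other side the path goes round
    the corner through [q (-e) e], [q (-e) (-e)] and [q e (-e)]. *)
Lemma germ_turn_corner i y : orient (p i) (pS i) (pS (ordS i)) != 0 ->
  germ p (ordS i) y -> exists2 y', germ p i y' & reach p y y'.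
Proof.
set u := p i; set v := pS i; set w := pS (ordS i) => c0 gy.
pose d := (u.1 - v.1, u.2 - v.2); pose d' := (w.1 - v.1, w.2 - v.2).
pose q := frame v d d'; pose c := orient u v w.
have [r r0 hr] := vertex_clear i.
have [e /andP[e0 e1] he] := frames_close v d d' r0 (@ler01 R).
rewrite mulr1 in he.
have oi s t : orient u v (q s t) = t * c.
  by rewrite /c /q /orient /frame /d /d' /=; ring.
have oj s t : orient v w (q s t) = s * c.
  by rewrite /c /q /orient /frame /d /d' /=; ring.
have bi t : lerp u v t = q (1 - t) 0.
  by rewrite /q /frame /lerp /d /d' /=; congr pair; ring.
have bj t : lerp v w t = q 0 t.
  by rewrite /q /frame /lerp /d /d' /=; congr pair; ring.
have inj s t s' t' : q s t = q s' t' -> s = s' /\ t = t'.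
  move=> h; have := oi s t; have := oj s t; rewrite h oi oj => h1 h2.
  by split; apply: (mulIf c0).
have offi s t : t != 0 \/ s < 0 -> ~ on_seg u v (q s t).
  move=> h [f [f0 [f1]]]; rewrite bi => /inj[h1 h2].
  by case: h; [rewrite h2 eqxx | lra].
have offj s t : s != 0 \/ t < 0 -> ~ on_seg v w (q s t).
  move=> h [f [f0 [f1]]]; rewrite bj => /inj[h1 h2].
  by case: h; [rewrite h1 eqxx | lra].
have offP' s t : `|s| <= e -> `|t| <= e -> t != 0 \/ s < 0 -> s != 0 \/ t < 0 -> off P (q s t).
  move=> hs ht h1 h2; apply: (@off_split2 i); [|exact: offi|exact: offj].
  apply: (hr (q s t) (q s t)); [exact: he|exact: he|exact: on_segl].
have small f g : 0 <= f -> f <= 1 -> `|g| <= e -> `|f * g| <= e.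
  move=> f0 f1 h; rewrite normrM (ger0_norm f0) -[e]mul1r.
  by apply: ler_pM => //.
have Ne : `|e| <= e by rewrite gtr0_norm.
have NNe : `|- e| <= e by rewrite normrN.
have en0 : e != 0 by rewrite gt_eqF.
have gj s t : t = e -> `|s| <= e -> s != 0 -> germ p (ordS i) (q s t).
  move=> -> hs sn0; split; first by rewrite oj mulf_neq0.
  exists e; first by rewrite e0 e1.
  move=> f f0 f1; rewrite -/v -/w bj frame_lerp mulr0 add0r.
  have -> : (1 - f) * e + f * e = e by ring.
  apply: offP' => //; first by apply: small => //; exact: ltW.
    by left.
  by left; rewrite mulf_neq0 // gt_eqF.
have gi s t : s = e -> `|t| <= e -> t != 0 -> germ p i (q s t).
  move=> -> ht tn0; split; first by rewrite oi mulf_neq0.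
  exists (1 - e); first by apply/andP; split; lra.
  move=> f f0 f1; rewrite -/u -/v bi frame_lerp mulr0 add0r.
  have -> : (1 - f) * (1 - (1 - e)) + f * e = e by ring.
  apply: offP' => //; first by apply: small => //; exact: ltW.
    by left; rewrite mulf_neq0 // gt_eqF.
  by left.
have [same|] := ltP 0 (orient v w y * c).
  exists (q e e); first exact: gi.
  apply: tube gy (gj e e _ _ _) _ => //.
  by rewrite oj mulrCA mulr_gt0.
move=> opp; have {opp} opp : orient v w y * c < 0.
  by rewrite lt_neqAle opp andbT mulf_neq0 //; case: gy.
have NE0 : - e != 0 by rewrite oppr_eq0.
exists (q e (- e)); first exact: gi.
apply: (@reach_trans _ _ _ _ (q (- e) e)).
  apply: tube gy (gj _ _ _ _ _) _ => //.
  by rewrite oj mulNr mulrN mulrCA oppr_gt0 pmulr_rlt0.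
have conv f : 0 <= f -> f <= 1 -> `|(1 - f) * e + f * - e| <= e.
  move=> f0 f1; have -> : (1 - f) * e + f * - e = (1 - 2 * f) * e by ring.
  rewrite normrM (gtr0_norm e0) ger_pMl // ler_norml; lra.
have conv' f : 0 <= f -> f <= 1 -> `|(1 - f) * - e + f * e| <= e.
  move=> f0 f1; have := conv f f0 f1; rewrite -normrN.
  by have -> : - ((1 - f) * e + f * - e) = (1 - f) * - e + f * e by ring.
apply: (@reach_trans _ _ _ _ (q (- e) (- e))); apply: reach_seg => x [f [f0 [f1 ->]]].
  rewrite frame_lerp; have -> : (1 - f) * - e + f * - e = - e by ring.
  apply: offP' => //; [exact: conv | right; lra | by left].
rewrite frame_lerp; have -> : (1 - f) * - e + f * - e = - e by ring.
apply: offP' => //; [exact: conv' | by left | right; lra].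
Qed.

End VertexGerms.

(** * The Jordan curve theorem in terms of parity *)

Section JordanCurve.
Variables (R : realType) (n : nat) (p : 'I_n -> R * R).
Hypothesis sp : simple_polygon p.
Implicit Types (a b c d q x y z u v w : R * R) (t s r e f : R) (i j k : 'I_n).

Notation P := (edges p predT).
Notation pS i := (p (ordS i)).

(** If the boundary folded back at the vertex, one of the two collinear edges would contain the far
    end of the other. *)
Lemma straight_angle i : orient (p i) (pS i) (pS (ordS i)) = 0 ->
  exists2 k, 0 < k & pS (ordS i) = lerp (pS i) (p i) (- k).
Proof.
move=> o; have pr := projK (edge_neq sp i) o.
set m := proj _ _ _ in pr.
exists (m - 1); last by rewrite pr /lerp /=; congr pair; ring.
rewrite subr_gt0 ltNge; apply/negP => m1.
have [m0|m0] := leP 0 m.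
  have /(vertex_on_edge sp)[/eqP|/eqP] : on_seg (p i) (pS i) (pS (ordS i)).
    by rewrite pr; exact: on_seg_lerp.
  - by rewrite (negPf (ordSS_neq sp i)).
  by rewrite (negPf (ordS_neq sp (ordS i))).
have h : 0 < 1 - m by lra.
have /(vertex_on_edge sp)[/eqP|/eqP] : on_seg (pS i) (pS (ordS i)) (p i).
  exists (1 / (1 - m)); split; first by apply: divr_ge0; lra.
  split; first by rewrite ler_pdivrMr // mul1r; lra.
  have -> e : lerp (pS i) (pS (ordS i)) e = lerp (p i) (pS i) (1 - e + e * m).
    by rewrite pr /lerp /=; congr pair; ring.
  by rewrite -[LHS](lerp0 (p i) (pS i)); congr lerp; field; lra.
- by rewrite eq_sym (negPf (ordS_neq sp i)).
by rewrite eq_sym (negPf (ordSS_neq sp i)).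
Qed.

(** Both edges lie on the first axis, on opposite sides of [v]. As the second edge is [k] times as
    long as the first, its foot of parameter [e] is at [s = - (k * e)]; this is why the clearance is
    taken for [1 + k]. The height [b] is [e] or [- e], according to the side of [y]. *)
Lemma germ_turn_straight i y : orient (p i) (pS i) (pS (ordS i)) = 0 ->
  germ p (ordS i) y -> exists2 y', germ p i y' & reach p y y'.
Proof.
move=> o gy; have [k k0 wE] := straight_angle o.
have uv := edge_neq sp i.
set u := p i in uv wE *; set v := pS i in uv wE *; set w := pS (ordS i) in wE *.
pose d := (u.1 - v.1, u.2 - v.2); pose d' := (v.2 - u.2, u.1 - v.1).
pose q := frame v d d'; pose N := sqd u v.
have N0 : 0 < N by exact: sqd_gt0.
have [r r0 hr] := vertex_clear sp i.
have M0 : 0 <= 1 + k by lra.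
have [e /andP[e0 e1] he] := frames_close v d d' r0 M0.
have oi s t : orient u v (q s t) = - (t * N).
  by rewrite /N /sqd /q /orient /frame /d /d' /=; ring.
have oj s t : orient v w (q s t) = - (k * t * N).
  by rewrite wE /N /sqd /q /orient /frame /lerp /d /d' /=; ring.
have bi t : lerp u v t = q (1 - t) 0.
  by rewrite /q /frame /lerp /d /d' /=; congr pair; ring.
have bj t : lerp v w t = q (- (k * t)) 0.
  by rewrite wE /q /frame /lerp /d /d' /=; congr pair; ring.
have n0 := gt_eqF N0; have nk := gt_eqF k0; have ne := gt_eqF e0.
have offP' s t : `|s| <= e * (1 + k) -> `|t| <= e * (1 + k) -> t != 0 -> off P (q s t).
  move=> hs ht tn; apply: (@off_split2 _ _ _ i).
  - by apply: (hr (q s t) (q s t)); [exact: he|exact: he|exact: on_segl].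
  - by move=> /orient_on_seg; rewrite oi => /eqP; rewrite oppr_eq0 mulf_eq0 n0 (negPf tn).
  by move=> /orient_on_seg; rewrite oj => /eqP; rewrite oppr_eq0 !mulf_eq0 n0 nk (negPf tn).
have ek : 0 < e * k by rewrite mulr_gt0.
have [b bb hb] : exists2 t, `|t| = e & 0 < orient v w y * - (k * t * N).
  case: gy => oy _; move: oy; rewrite neq_lt -/v -/w => /orP[oy|oy].
    exists e; rewrite ?gtr0_norm // nmulr_rgt0 // oppr_lt0 !mulr_gt0 //.
  exists (- e); rewrite ?normrN ?gtr0_norm // pmulr_rgt0 //.
  by rewrite mulrN mulNr opprK !mulr_gt0.
have b0 : b != 0 by rewrite -normr_eq0 bb ne.
have leb f : 0 <= f -> f <= 1 -> `|f * b| <= e * (1 + k).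
  move=> f0 f1; rewrite normrM bb (ger0_norm f0).
  have : f * e <= e by rewrite ger_pMl.
  lra.
have gj : germ p (ordS i) (q (- (k * e)) b).
  split; first by rewrite oj oppr_eq0 !mulf_neq0 ?n0 ?nk.
  exists e; first by rewrite e0 e1.
  move=> f f0 f1; rewrite -/v -/w bj frame_lerp mulr0 add0r.
  have -> : (1 - f) * - (k * e) + f * - (k * e) = - (k * e) by ring.
  apply: offP'; first by rewrite normrN gtr0_norm mulrC //; lra.
    by apply: leb => //; exact: ltW.
  by rewrite mulf_neq0 // gt_eqF.
have gi : germ p i (q e b).
  split; first by rewrite oi oppr_eq0 mulf_neq0 ?n0.
  exists (1 - e); first by apply/andP; split; lra.
  move=> f f0 f1; rewrite -/u -/v bi frame_lerp mulr0 add0r.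
  have -> : (1 - f) * (1 - (1 - e)) + f * e = e by ring.
  apply: offP'; first by rewrite gtr0_norm //; lra.
    by apply: leb => //; exact: ltW.
  by rewrite mulf_neq0 // gt_eqF.
exists (q e b) => //; apply: (@reach_trans _ _ _ _ (q (- (k * e)) b)).
  by apply: (tube sp) gy gj _; rewrite oj.
apply: reach_seg => x [f [f0 [f1 ->]]]; rewrite frame_lerp.
have -> : (1 - f) * b + f * b = b by ring.
apply: offP' => //; last by rewrite -[b]mul1r; apply: leb.
rewrite ler_norml; apply/andP; split.
  have := @conv01 R (e * (1 + k) - k * e) (e * (1 + k) + e) f f0 f1; lra.
by apply: conv01_le => //; lra.
Qed.

Lemma germ_turn i y : germ p (ordS i) y -> exists2 y', germ p i y' & reach p y y'.
Proof.
have [|] := eqVneq (orient (p i) (pS i) (pS (ordS i))) 0.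
  exact: germ_turn_straight.
exact: germ_turn_corner.
Qed.

Lemma germ_first i0 i y : i0 = 0%N :> nat -> germ p i y ->
  exists2 y', germ p i0 y' & reach p y y'.
Proof.
move=> i00; move eq_m : (nat_of_ord i) => m; elim: m i y eq_m => [|m IH] i y im gy.
  have -> : i0 = i by apply: val_inj; rewrite /= i00 im.
  by exists y => //; exact: reach_refl.
have ltm : (m < n)%N by have := ltn_ord i; lia.
have iE : i = ordS (Ordinal ltm).
  by apply: val_inj; rewrite /= modn_small; have := ltn_ord i; lia.
rewrite iE in gy; have [y1 g1 r1] := germ_turn gy.
have [|y2 g2 r2] := IH _ _ _ g1; first by rewrite /=; lia.
by exists y2 => //; exact: reach_trans r1 r2.
Qed.

(** A pair holds the values at 0 and 1 of an affine function; if nonzero, it has at most one root,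
    and the interval can be cut off at that root. This is used to aim at a point of an edge past all
    vertices. *)
Lemma avoid_zeros (L : seq (R * R)) : (forall q, q \in L -> q != (0, 0)) ->
  forall l r : R, l < r -> exists l' r', [/\ l <= l', l' < r', r' <= r &
    forall t, l' < t < r' -> forall q, q \in L -> (1 - t) * q.1 + t * q.2 != 0].
Proof.
elim: L => [|q L IH] nz l r lr; first by exists l, r.
have [|l1 [r1 [h1 h2 h3 h4]]] := IH _ l r lr.
  by move=> q' q'L; apply: nz; rewrite inE q'L orbT.
have qn : q != (0, 0) by apply: nz; rewrite inE eqxx.
have one : exists l' r', [/\ l1 <= l', l' < r', r' <= r1 &
    forall t, l' < t < r' -> (1 - t) * q.1 + t * q.2 != 0].
  have [e|ne] := eqVneq q.1 q.2.
    exists l1, r1; split=> // t _; rewrite e.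
    have -> : (1 - t) * q.2 + t * q.2 = q.2 by ring.
    by apply: contra qn => /eqP e'; rewrite [q]surjective_pairing e e'.
  have nd : q.1 - q.2 != 0 by rewrite subr_eq0.
  pose T := q.1 / (q.1 - q.2).
  have uniqT t : (1 - t) * q.1 + t * q.2 == 0 -> t = T.
    by move=> /eqP h; apply: (mulIf nd); rewrite /T divfK //; lra.
  have [Tl|Tl] := leP T l1.
    exists l1, r1; split=> // t /andP[t1 t2]; apply/negP => /uniqT; lra.
  exists l1, (Num.min T r1); split=> //; first by rewrite lt_min Tl.
    by rewrite ge_min lexx orbT.
  move=> t /andP[t1]; rewrite lt_min => /andP[t2 _]; apply/negP => /uniqT; lra.
have [l2 [r2 [k1 k2 k3 k4]]] := one.
exists l2, r2; split=> //; try lra.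
move=> t t12 q'; rewrite inE => /orP[/eqP ->|q'L]; first exact: k4.
by apply: h4 => //; case/andP: t12 => ? ?; apply/andP; split; lra.
Qed.

(** The translate of [x] by [b - a] turned counterclockwise by a right angle, so it moves to the
    left of [ab]. *)
Definition normal a b x : R * R := (x.1 - (b.2 - a.2), x.2 + (b.1 - a.1)).

Lemma orient_normal a b x : orient a b (normal a b x) = orient a b x + sqd a b.
Proof. by rewrite /orient /normal /sqd /=; ring. Qed.

Lemma reach_off_line a b z : a != b -> off P z ->
  exists2 z', reach p z z' & off P z' /\ orient a b z' != 0.
Proof.
move=> ab fz; have [o|o] := eqVneq (orient a b z) 0; last first.
  by exists z; [exact: reach_refl|].
have [t /andP[t0 t1] h] := off_near (normal a b z) (@nondeg_edges _ _ _ sp _) fz.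
exists (lerp z (normal a b z) t); first exact: reach_seg.
split; first by apply: h; exact: on_segr.
by rewrite orient_lerp orient_normal o mulr0 !add0r mulf_neq0 // gt_eqF // sqd_gt0.
Qed.

(** After a small move off the line of edge 0, the point aims at a place on that edge such that the
    line of sight contains no vertex; the first boundary point is then interior to an edge and
    serves as foot. *)
Lemma reach_germ z : off P z -> exists i y, germ p i y /\ reach p z y.
Proof.
have n3 := n_ge3 sp.
have lt0n : (0 < n)%N by lia.
pose i0 := Ordinal lt0n; set a := p i0; set b := pS i0.
have ab : a != b := edge_neq sp i0.
move=> /(reach_off_line ab)[z' rz [fz oz]].
pose L := [seq (orient z' (p k) a, orient z' (p k) b) | k <- enum 'I_n].
have nzk k : z' != p k.
  by apply/eqP => h; move/offP: fz; apply; rewrite h; exact: boundary_vertex.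
have nz q : q \in L -> q != (0, 0).
  move=> /mapP[k _ ->]; apply/eqP => -[oa ob].
  have [h _] := orient_line (nzk k) oa ob.
  by rewrite h eqxx in oz.
have [l [r [h1 h2 h3 h4]]] := avoid_zeros nz (@ltr01 R).
pose t := (l + r) / 2.
have t01 : l < t < r by rewrite /t; apply/andP; split; lra.
have nv k : orient z' (p k) (lerp a b t) != 0.
  rewrite orient_lerp; apply: (h4 t t01 (orient z' (p k) a, orient z' (p k) b)).
  by apply/mapP; exists k => //; rewrite mem_enum.
have bx : on_seg a b (lerp a b t).
  by case/andP: t01 => *; apply: on_seg_lerp; lra.
have [|s [s0 s1 nh bef]] := first_hit (@nondeg_edges _ _ _ sp predT) fz (w := lerp a b t).
  move=> /(_ _ (on_segr _ _)) /off_edges /(_ i0 isT); exact.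
have [j hj] : boundary p (lerp z' (lerp a b t) s).
  by apply: contrapT => h; apply: nh; apply/offP.
exists j, z'; split=> //.
have [[k hk]|[f f01 hf]] := open_or_vertex hj.
  have /negP[] := nv k; rewrite -hk; apply/eqP.
  by rewrite /orient /lerp /=; ring.
have off' e : 0 < e -> e <= 1 -> off P (lerp (lerp (p j) (pS j) f) z' e).
  move=> e0 e1; rewrite -hf lerpC -{1}(lerp0 z' (lerp a b t)) lerp_lerp.
  have eq : (1 - (1 - e)) * 0 + (1 - e) * s = (1 - e) * s by ring.
  by rewrite eq; apply: bef; [rewrite mulr_ge0 //; lra | rewrite gtr_pMl //; lra].
split; last by exists f.
(* If [z'] were on the line of edge [j], it would be on the edge or beyond one of its ends; in the
   latter case the free segment from the foot to [z'] would contain that end. *)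
apply/eqP => o; have zE := projK (edge_neq sp j) o; set m := proj _ _ _ in zE.
have [m0|m0] := leP 0 m; last first.
  have d0 : 0 < f - m by case/andP: f01; lra.
  apply: (@off' (f / (f - m)) _ _ (p j, pS j)).
  - by rewrite divr_gt0 //; case/andP: f01.
  - by rewrite ler_pdivrMr // mul1r; lra.
  - by apply/mem_edges; exists j.
  rewrite zE lerp_lerp /=.
  have -> : (1 - f / (f - m)) * f + f / (f - m) * m = 0 by field; rewrite gt_eqF.
  by rewrite lerp0; exact: on_segl.
have [m1|m1] := leP m 1.
  move/off_edges: fz => /(_ j isT); apply; rewrite zE; exact: on_seg_lerp.
have d0 : 0 < m - f by case/andP: f01; lra.
apply: (@off' ((1 - f) / (m - f)) _ _ (p j, pS j)).
- by rewrite divr_gt0 //; case/andP: f01; lra.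
- by rewrite ler_pdivrMr // mul1r; lra.
- by apply/mem_edges; exists j.
rewrite zE lerp_lerp /=.
have -> : (1 - (1 - f) / (m - f)) * f + (1 - f) / (m - f) * m = 1 by field; rewrite gt_eqF.
by rewrite lerp1; exact: on_segr.
Qed.

Lemma even_reach z z' : off P z -> off P z' -> parity P z = parity P z' -> reach p z z'.
Proof.
have n3 := n_ge3 sp.
have lt0n : (0 < n)%N by lia.
pose i0 := Ordinal lt0n.
have toi0 x : off P x -> exists2 y, germ p i0 y & reach p x y.
  move=> /reach_germ[i [y [gy ry]]].
  have [//|y' gy' ry'] := @germ_first i0 _ _ _ gy.
  by exists y' => //; exact: reach_trans ry ry'.
move=> /toi0[y gy ry] /toi0[y' gy' ry'] par.
apply: (reach_trans ry); apply: reach_trans (reach_sym ry').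
have [] := ltrgtP 0 (orient (p i0) (pS i0) y * orient (p i0) (pS i0) y').
- exact: tube.
- move=> /(germ_opp sp gy gy'); rewrite -(reach_parity ry) -(reach_parity ry') par.
  by case: (parity _ _).
move=> /esym/eqP; rewrite mulf_eq0; case: gy gy' => [/negPf -> _] [/negPf -> _] //.
Qed.

Theorem exterior_parity z : off P z -> exterior p z <-> parity P z = false.
Proof.
move=> fz; have [M hM] := far_outside (cyclicP p).
split=> [[_ /(_ M)[l [fl /hM[_ <-]]]]|pz].
  by apply: reach_parity; exists l.
split; first by apply/offP.
(* [F] is farther than [M], hence of even parity, and farther than the requested distance [M']. *)
move=> M'; pose F : R * R := (`|M| + `|M'| + 1, 0).
have FE : `|F.1| + `|F.2| = `|M| + `|M'| + 1.
  by rewrite /= normr0 addr0 ger0_norm // !addr_ge0.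
have hM' : M < `|F.1| + `|F.2|.
  by rewrite FE; have := ler_norm M; have := normr_ge0 M'; lra.
have [fF pF] := hM F hM'.
have [|l fl lF] := @even_reach z F fz fF; first by rewrite pz.
exists l; split=> //; rewrite lF FE.
by have := ler_norm M'; have := normr_ge0 M; lra.
Qed.

End JordanCurve.

(** * Visible segments *)

Section Visibility.
Variables (R : realType) (n : nat) (p : 'I_n -> R * R).
Hypothesis sp : simple_polygon p.
Implicit Types (x y z u v w : R * R) (t s r e f : R) (a b c d i j k m : 'I_n).

Notation P := (edges p predT).
Notation pS i := (p (ordS i)).

Definition open_seg x y z := exists2 t, 0 < t < 1 & z = lerp x y t.

Lemma open_seg_on x y z : open_seg x y z -> on_seg x y z.
Proof. by move=> [t /andP[t0 t1] ->]; apply: on_seg_lerp; lra. Qed.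

Lemma open_segC x y z : open_seg x y z -> open_seg y x z.
Proof.
move=> [t /andP[t0 t1] ->]; exists (1 - t); last by rewrite -lerpC.
by apply/andP; split; lra.
Qed.

Lemma on_open_seg x y z : on_seg x y z -> z <> x -> z <> y -> open_seg x y z.
Proof.
move=> [t [t0 [t1 ->]]] nx ny; exists t => //; rewrite !lt_neqAle t0 t1 !andbT.
apply/andP; split; apply/eqP => h.
  by apply: nx; rewrite -h lerp0.
by apply: ny; rewrite h lerp1.
Qed.

Lemma on_seg_lerp3 x y t s r : (t <= s /\ s <= r) \/ (r <= s /\ s <= t) ->
  on_seg (lerp x y t) (lerp x y r) (lerp x y s).
Proof.
have key t' r' : t' <= s -> s <= r' -> on_seg (lerp x y t') (lerp x y r') (lerp x y s).
  move=> h1 h2; have [e|ne] := eqVneq t' r'.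
    have -> : s = t' by lra.
    exact: on_segl.
  have d0 : 0 < r' - t' by rewrite subr_gt0 lt_neqAle ne; lra.
  exists ((s - t') / (r' - t')); split; first by apply: divr_ge0; lra.
  split; first by rewrite ler_pdivrMr // mul1r; lra.
  by rewrite lerp_lerp; congr lerp; field; rewrite gt_eqF.
by case=> -[h1 h2]; [|apply: on_segC]; apply: key.
Qed.

Lemma sees_parity x y z : sees p x y -> on_seg x y z -> off P z -> parity P z.
Proof.
move=> h zs fz; apply: contrapT => /negP/negbTE pz.
by apply: (h z zs); apply/(exterior_parity sp fz).
Qed.

Lemma sees_intro x y : (forall z, on_seg x y z -> off P z -> parity P z) -> sees p x y.
Proof.
move=> h z zs ext; have fz : off P z by apply/offP; case: ext.
by move/(exterior_parity sp fz): ext; rewrite (h z zs fz).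
Qed.

Lemma sees_sub x y x' y' : sees p x y -> on_seg x y x' -> on_seg x y y' -> sees p x' y'.
Proof. by move=> h hx hy z hz; apply: h; exact: on_seg_sub hz. Qed.

Lemma seesC x y : sees p x y -> sees p y x.
Proof. by move=> h z /on_segC; exact: h. Qed.

(* An edge crossing a visible segment would separate inside from outside
   along that segment. *)
Lemma sees_edge_collinear x y k f t : sees p x y -> 0 < t < 1 -> 0 < f < 1 ->
  lerp x y t = lerp (p k) (pS k) f ->
  orient (p k) (pS k) x = 0 /\ orient (p k) (pS k) y = 0.
Proof.
move=> sxy /andP[t0 t1] f01 zE.
set o := orient (p k) (pS k).
have oz : (1 - t) * o x + t * o y = 0.
  by rewrite -orient_lerp zE orient_lerp orient_aba orient_abb; ring.
have [ox|ox] := eqVneq (o x) 0.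
  split=> //; move: oz; rewrite ox mulr0 add0r => /eqP.
  by rewrite mulf_eq0 gt_eqF // => /eqP.
have oy : o y != 0.
  apply/eqP => h; move: oz; rewrite h mulr0 addr0 => /eqP; rewrite mulf_eq0 (negPf ox).
  by rewrite orbF gt_eqF // subr_gt0.
exfalso.
have [r r0 hr] := off_clear (@nondeg_edges _ _ _ sp _) (open_edge_off sp (i := k) f01).
rewrite -zE in hr.
have [e /andP[e0 e1] he] := lerp_close (lerp x y t) x r0.
have [e' /andP[e0' e1'] he'] := lerp_close (lerp x y t) y r0.
set z := lerp x y t in zE hr he he'.
have cx : close r (lerp z x e) z by apply: he; rewrite lexx ltW.
have cy : close r (lerp z y e') z by apply: he'; rewrite lexx ltW.
have oz0 : orient (p k) (pS k) z = 0.
  by rewrite zE orient_lerp orient_aba orient_abb; ring.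
have ox' : orient (p k) (pS k) (lerp z x e) != 0.
  by rewrite orient_lerp oz0 mulr0 add0r mulf_neq0 // gt_eqF.
have oy' : orient (p k) (pS k) (lerp z y e') != 0.
  by rewrite orient_lerp oz0 mulr0 add0r mulf_neq0 // gt_eqF.
have fs := hr _ _ cx cy.
have fx : off P (lerp z x e) by apply: off_orient ox'; apply: fs; exact: on_segl.
have fy : off P (lerp z y e') by apply: off_orient oy'; apply: fs; exact: on_segr.
have zs : on_seg x y z by apply: on_seg_lerp; exact: ltW.
have px : parity P (lerp z x e).
  apply: (sees_parity sxy) => //; apply: on_seg_sub zs (on_segl _ _) _.
  by apply: on_seg_lerp; exact: ltW.
have py : parity P (lerp z y e').
  apply: (sees_parity sxy) => //; apply: on_seg_sub zs (on_segr _ _) _.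
  by apply: on_seg_lerp; exact: ltW.
pose D := t * e + e' * (1 - t).
have D0 : 0 < D by rewrite addr_gt0 ?mulr_gt0 ?subr_gt0.
have := @parity_cross R (edges p (predC1 k)) (p k) (pS k) (lerp z x e) (lerp z y e') f (t * e / D)
  (cyclicD1 p k) fs f01.
rewrite -!(parityD1 p k) px py => cross; suff : true = ~~ true by []; apply: cross => //.
  rewrite divr_gt0 ?mulr_gt0 //= ltr_pdivrMr // mul1r /D ltrDl.
  by rewrite mulr_gt0 ?subr_gt0.
rewrite -zE /z.
have -> : lerp (lerp x y t) x e = lerp x y (t * (1 - e)).
  by rewrite /lerp /=; congr pair; ring.
rewrite lerp_lerpr lerp_lerp; congr lerp.
by rewrite /D; field; rewrite -/D gt_eqF.
Qed.

Definition prim i j := [/\ i != j, sees p (p i) (p j) &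
  forall k, on_seg (p i) (p j) (p k) -> k = i \/ k = j].

Lemma primC i j : prim i j -> prim j i.
Proof.
move=> [ij s h]; split; [by rewrite eq_sym | exact: seesC |].
by move=> k /on_segC /h[]; [right|left].
Qed.

Lemma vertex_neq i j : i != j -> p i != p j.
Proof. by move=> ij; apply/eqP => /(p_inj sp) /eqP; rewrite (negPf ij). Qed.

Lemma prim_vertex i j x k : prim i j -> open_seg (p i) (p j) x -> x <> p k.
Proof.
move=> [ij _ h] ox xk; have := open_seg_on ox; rewrite xk => /h.
case: ox => t /andP[t0 t1]; rewrite xk => e [kE|kE]; move: e; rewrite kE.
  by rewrite -{1}(lerp0 (p i) (p j)) => /(lerp_inj (vertex_neq ij)); lra.
by rewrite -{1}(lerp1 (p i) (p j)) => /(lerp_inj (vertex_neq ij)); lra.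
Qed.

(** There is no vertex on the open segment, so the edge is met in its own interior, where a visible
    segment cannot cross it. *)
Lemma prim_edge i j x k : prim i j -> open_seg (p i) (p j) x ->
  on_seg (p k) (pS k) x ->
  [/\ orient (p k) (pS k) (p i) = 0, orient (p k) (pS k) (p j) = 0 &
      exists2 f, 0 < f < 1 & x = lerp (p k) (pS k) f].
Proof.
move=> pij ox /open_or_vertex[[m xm]|[f f01 xE]]; first by case: (prim_vertex pij ox xm).
have [_ sij _] := pij; case: (ox) => t t01 xE'.
have [h1 h2] := sees_edge_collinear sij t01 f01 (etrans (esym xE') xE).
by split=> //; exists f.
Qed.

Lemma prim_edge_line i j x k y : prim i j -> open_seg (p i) (p j) x ->
  on_seg (p k) (pS k) x -> on_seg (p k) (pS k) y -> orient (p i) (p j) y = 0.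
Proof.
move=> pij ox xk [t [_ [_ ->]]]; have [h1 h2 _] := prim_edge pij ox xk.
have [h3 h4] := orient_line (edge_neq sp k) h1 h2.
by rewrite orient_lerp h3 h4; ring.
Qed.

(** An edge meeting the open segment is collinear with it. Neither of the two contains an end of the
    other in its interior, so they coincide, against non-adjacency. In the proof [s] and [t] are the
    parameters of [p i] and [p j] on the edge, and they are forced to be 0 and 1. *)
Lemma prim_chord i j x : prim i j -> j <> ordS i -> i <> ordS j ->
  open_seg (p i) (p j) x -> off P x.
Proof.
move=> pij nij nji ox; apply/off_edges => k _ xk.
have [oi oj [f /andP[f0 f1] xE]] := prim_edge pij ox xk.
have [ij _ h] := pij.
have kk := edge_neq sp k.
have iE := projK kk oi; have jE := projK kk oj.
set s := proj _ _ _ in iE; set t := proj _ _ _ in jE.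
case: ox => e /andP[e0 e1]; rewrite xE iE jE lerp_lerp => /(lerp_inj kk) fE.
have ends l : lerp (p k) (pS k) l = p i \/ lerp (p k) (pS k) l = p j -> l = s \/ l = t.
  by rewrite iE jE; case=> /(lerp_inj kk); [left|right].
have hk : on_seg (p i) (p j) (p k) -> 0 = s \/ 0 = t.
  by move=> /h hk; apply: ends; rewrite lerp0; case: hk => ->; [left|right].
have hkS : on_seg (p i) (p j) (pS k) -> 1 = s \/ 1 = t.
  by move=> /h hk'; apply: ends; rewrite lerp1; case: hk' => ->; [left|right].
have btw l : (s <= l /\ l <= t) \/ (t <= l /\ l <= s) ->
    on_seg (p i) (p j) (lerp (p k) (pS k) l).
  by move=> hl; rewrite iE jE; apply: on_seg_lerp3.
have b0 : (s <= 0 /\ 0 <= t) \/ (t <= 0 /\ 0 <= s) -> 0 = s \/ 0 = t.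
  by move=> /btw; rewrite lerp0.
have b1 : (s <= 1 /\ 1 <= t) \/ (t <= 1 /\ 1 <= s) -> 1 = s \/ 1 = t.
  by move=> /btw; rewrite lerp1.
have fs : (s <= f /\ f <= t) \/ (t <= f /\ f <= s).
  have [st|ts] := leP s t; [left|right]; rewrite fE; split.
  - have := @conv01 R 0 (t - s) e; lra.
  - by apply: conv01_le => //; lra.
  - have := @conv01 R (s - t) 0 e; lra.
  - by apply: conv01_le => //; lra.
have onE l m : lerp (p k) (pS k) l = p m -> 0 <= l -> l <= 1 -> l = 0 \/ l = 1.
  move=> lE l0 l1; have /(vertex_on_edge sp)[mk|mk] : on_seg (p k) (pS k) (p m).
  - by rewrite -lE; exact: on_seg_lerp.
  - by left; move: lE; rewrite mk -{2}(lerp0 (p k) (pS k)) => /(lerp_inj kk).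
  by right; move: lE; rewrite mk -{2}(lerp1 (p k) (pS k)) => /(lerp_inj kk).
have [[h1 h2]|[h1 h2]] := fs.
  have s0 : s = 0.
    have [s0|s0] := leP s 0.
      have : 0 = s \/ 0 = t by apply: b0; left; lra.
      by case; lra.
    by case: (onE s i (esym iE)); lra.
  have t1 : t = 1.
    have [t1|t1] := leP 1 t.
      have : 1 = s \/ 1 = t by apply: b1; left; lra.
      by case; lra.
    by case: (onE t j (esym jE)); lra.
  by apply: nij; move: iE jE; rewrite s0 t1 lerp0 lerp1 => /(p_inj sp) -> /(p_inj sp) ->.
have s1 : s = 1.
  have [s1|s1] := leP 1 s.
    have : 1 = s \/ 1 = t by apply: b1; right; lra.
    by case; lra.
  by case: (onE s i (esym iE)); lra.
have t0 : t = 0.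
  have [t0|t0] := leP t 0.
    have : 0 = s \/ 0 = t by apply: b0; right; lra.
    by case; lra.
  by case: (onE t j (esym jE)); lra.
by apply: nji; move: iE jE; rewrite s1 t0 lerp0 lerp1 => /(p_inj sp) -> /(p_inj sp) ->.
Qed.

End Visibility.

(** * Vertices of smallest angle in a triangle *)

Section Wedge.
Variables (R : realType) (n : nat) (p : 'I_n -> R * R).
Hypothesis sp : simple_polygon p.
Implicit Types (x y z u v w : R * R) (t s r e f : R) (a b c d i j k m : 'I_n).

Notation P := (edges p predT).
Notation pS i := (p (ordS i)).

(** The vertex on the segment nearest to [p i] has no vertex in front of it. *)
Lemma prim_first i j : i != j -> sees p (p i) (p j) ->
  exists k, on_seg (p i) (p j) (p k) /\ prim p i k.
Proof.
move=> ij sij; have nij := vertex_neq sp ij.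
pose Q := [pred k | (k != i) && `[< on_seg (p i) (p j) (p k) >]].
have Qj : Q j by rewrite /Q /= eq_sym ij; apply/asboolP; exact: on_segr.
pose F k := proj (p i) (p j) (p k).
case: (arg_minP F Qj) => k /andP[ki /asboolP ok] kmin.
exists k; split=> //; split; first by rewrite eq_sym.
  by apply: sees_sub sij (on_segl _ _) ok.
move=> m om; have [->|mi] := eqVneq m i; [by left|right].
have /kmin : Q m.
  by rewrite /Q /= mi; apply/asboolP; apply: on_seg_sub om => //; exact: on_segl.
case: om => t [t0 [t1 mE]]; rewrite /F mE proj_lerp proj_l mulr0 add0r.
have Fk : 0 < proj (p i) (p j) (p k).
  case: ok => s [s0 [s1 kE]]; rewrite kE proj_lerp proj_l proj_r // mulr0 mulr1 add0r.
  rewrite lt_neqAle s0 andbT; apply/eqP => s00; move: kE; rewrite -s00 lerp0.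
  by move/(p_inj sp)/eqP; rewrite (negPf ki).
rewrite ler_pMl // => ht; have t11 : t = 1 by lra.
by apply: (p_inj sp); rewrite mE t11 lerp1.
Qed.

Section Barycentric.
Variables A B C : R * R.
Hypothesis D0 : orient A B C != 0.

Definition cA z := orient z B C / orient A B C.
Definition cB z := orient A z C / orient A B C.
Definition cC z := orient A B z / orient A B C.

Lemma cA_lerp x y t : cA (lerp x y t) = (1 - t) * cA x + t * cA y.
Proof. by rewrite /cA /orient /lerp /=; ring. Qed.
Lemma cB_lerp x y t : cB (lerp x y t) = (1 - t) * cB x + t * cB y.
Proof. by rewrite /cB /orient /lerp /=; ring. Qed.
Lemma cC_lerp x y t : cC (lerp x y t) = (1 - t) * cC x + t * cC y.
Proof. by rewrite /cC /orient /lerp /=; ring. Qed.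

Lemma bary_sum z : cA z + cB z + cC z = 1.
Proof.
rewrite /cA /cB /cC -!mulrDl -[RHS](divff D0); congr (_ / _).
by rewrite /orient; ring.
Qed.

Lemma bary_vertices : [/\ cA A = 1, cB A = 0 & cC A = 0] /\
  [/\ cA B = 0, cB B = 1 & cC B = 0] /\ [/\ cA C = 0, cB C = 0 & cC C = 1].
Proof.
rewrite /cA /cB /cC !divff //; do !split=> //.
all: by rewrite ?orient_aab ?orient_abb ?orient_aba ?mul0r.
Qed.

Lemma bary_point z : z = (cA z * A.1 + cB z * B.1 + cC z * C.1,
                          cA z * A.2 + cB z * B.2 + cC z * C.2).
Proof.
case: z => z1 z2; rewrite /cA /cB /cC; set z := (z1, z2); congr pair; apply: (mulfI D0).
  transitivity (orient z B C * A.1 + orient A z C * B.1 + orient A B z * C.1).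
    by rewrite /orient /=; ring.
  by field.
transitivity (orient z B C * A.2 + orient A z C * B.2 + orient A B z * C.2).
  by rewrite /orient /=; ring.
by field.
Qed.

End Barycentric.

(* The maximiser of [cB / cC] is the vertex seen from [A] under the smallest
   angle with [AB]: an edge entering the wedge could only end at a vertex with
   a larger quotient or leave through [AB] or [BC]. *)
Lemma wedge_free A B k : orient A B (p k) != 0 ->
  (forall i y, on_seg (p i) (pS i) y ->
    0 < cA A B (p k) y -> 0 < cB A B (p k) y -> 0 < cC A B (p k) y ->
    forall x, on_seg (p i) (pS i) x ->
    0 <= cA A B (p k) x -> 0 < cB A B (p k) x -> 0 <= cC A B (p k) x ->
    cA A B (p k) x * cC A B (p k) x = 0 -> False) ->
  exists m, [/\ 0 <= cA A B (p k) (p m), 0 <= cB A B (p k) (p m),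
    0 < cC A B (p k) (p m) &
    forall y, 0 < cA A B (p k) y -> 0 < cB A B (p k) y -> 0 < cC A B (p k) y ->
      cC A B (p k) y * cB A B (p k) (p m) < cB A B (p k) y * cC A B (p k) (p m) ->
      off P y].
Proof.
move=> D0 H.
have [_ [_ [vA vB vC]]] := bary_vertices D0.
have lA := cA_lerp A B (p k); have lB := cB_lerp A B (p k); have lC := cC_lerp A B (p k).
move: (cA A B (p k)) (cB A B (p k)) (cC A B (p k)) H vA vB vC lA lB lC
  => gA gB gC H vA vB vC lA lB lC.
pose Q := [pred m | (0 <= gA (p m)) && (0 <= gB (p m)) && (0 < gC (p m))].
have Qk : Q k by rewrite /Q /= vA vB vC lexx ltr01.
case: (arg_maxP (fun m => gB (p m) / gC (p m)) Qk) => m /andP[/andP[m1 m2] m3] mmax.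
exists m; split=> // y yA yB yC yphi; apply/off_edges => i _ yi.
have HH := H i y yi yA yB yC.
(* The comparison of quotients with denominators cleared. Being affine, [phi] is at least [phi y] at
   one end of the edge through [y]. *)
pose phi z := gB z * gC (p m) - gC z * gB (p m).
have lphi x z t : phi (lerp x z t) = (1 - t) * phi x + t * phi z.
  by rewrite /phi lB lC; ring.
have phiy : 0 < phi y by rewrite /phi; lra.
have phiB z : 0 < phi z -> 0 <= gC z -> 0 < gB z.
  rewrite /phi => h1 h2; have h3 : 0 <= gC z * gB (p m) by rewrite mulr_ge0.
  by rewrite -(pmulr_lgt0 _ m3); lra.
suff key (u : 'I_n) : on_seg (p i) (pS i) (p u) -> phi y <= phi (p u) -> False.
  have [h|h] := leP (phi y) (phi (p i)); first exact: (key i (on_segl _ _)).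
  apply: (key (ordS i) (on_segr _ _)); rewrite leNgt; apply/negP => h'.
  case: yi => t [t0 [t1 yE]]; have := lphi (p i) (pS i) t; rewrite -yE.
  have := @conv_gt0 R (phi y - phi (p i)) (phi y - phi (pS i)) t t0 t1; lra.
move=> ui phiu.
have on s : 0 <= s -> s <= 1 -> on_seg (p i) (pS i) (lerp y (p u) s).
  by move=> s0 s1; apply: on_seg_sub yi ui _; exact: on_seg_lerp.
have phis s : 0 <= s -> s <= 1 -> 0 < phi (lerp y (p u) s).
  by move=> s0 s1; rewrite lphi; apply: conv_gt0 => //; lra.
set hA := gA (p u); set hC := gC (p u).
(* The sign of [W] decides whether the way from [y] to [p u] leaves the triangle through [AB], where
   [gC] vanishes, or through [BC], where [gA] vanishes. It cannot leave through [AC], since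
   [phi > 0] keeps [gB] positive. *)
pose W := gC y * hA - hC * gA y.
have viaC : hC < 0 -> 0 <= W -> False.
  move=> hC0 W0; have d0 : 0 < gC y - hC by lra.
  pose s := gC y / (gC y - hC).
  have s0 : 0 <= s by apply: divr_ge0; lra.
  have s1 : s <= 1 by rewrite ler_pdivrMr // mul1r; lra.
  have eA : gA (lerp y (p u) s) = W / (gC y - hC).
    by rewrite lA /W /s -/hA; field; rewrite gt_eqF.
  have eC : gC (lerp y (p u) s) = 0.
    by rewrite lC /s -/hC; field; rewrite gt_eqF.
  apply: (HH _ (on s s0 s1)).
  - by rewrite eA; apply: divr_ge0 => //; exact: ltW.
  - by apply: phiB; [exact: phis|rewrite eC].
  - by rewrite eC.
  by rewrite eC mulr0.
have viaA : hA < 0 -> W <= 0 -> False.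
  move=> hA0 W0; have d0 : 0 < gA y - hA by lra.
  pose s := gA y / (gA y - hA).
  have s0 : 0 <= s by apply: divr_ge0; lra.
  have s1 : s <= 1 by rewrite ler_pdivrMr // mul1r; lra.
  have eC : gC (lerp y (p u) s) = - W / (gA y - hA).
    by rewrite lC /W /s -/hC; field; rewrite gt_eqF.
  have eA : gA (lerp y (p u) s) = 0.
    by rewrite lA /s -/hA; field; rewrite gt_eqF.
  have eC0 : 0 <= gC (lerp y (p u) s) by rewrite eC; apply: divr_ge0; lra.
  apply: (HH _ (on s s0 s1)) => //.
  - by rewrite eA.
  - by apply: phiB; [exact: phis|].
  by rewrite eA mul0r.
have [hC0|hC0] := ltP hC 0.
  have [W0|W0] := leP 0 W; first exact: viaC.
  apply: viaA; last exact: ltW.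
  have h1 : hC * gA y < 0 by rewrite nmulr_rlt0.
  have : gC y * hA < 0 by move: W0; rewrite /W; lra.
  by rewrite pmulr_rlt0.
have [hA0|hA0] := ltP hA 0.
  apply: viaA => //; rewrite /W.
  have h1 : 0 <= hC * gA y by rewrite mulr_ge0 // ltW.
  have : gC y * hA < 0 by rewrite pmulr_rlt0.
  lra.
have phiu0 : 0 < phi (p u) by lra.
have uB : 0 < gB (p u) by apply: phiB.
have [hC1|hC1] := eqVneq hC 0.
  by apply: (HH (p u) ui) => //; rewrite -/hC hC1 mulr0.
have uC : 0 < gC (p u) by rewrite lt_neqAle eq_sym hC1.
have Qu : Q u by rewrite /Q /= hA0 (ltW uB) uC.
have h : gB (p u) / gC (p u) <= gB (p m) / gC (p m) := mmax u Qu.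
have : gB (p u) * gC (p m) <= gB (p m) * gC (p u).
  by rewrite -ler_pdivrMr // mulrAC -ler_pdivlMr.
by move: phiu0; rewrite /phi; lra.
Qed.

End Wedge.

(** * Crossing chords *)

Section Crossing.
Variables (R : realType) (n : nat) (p : 'I_n -> R * R).
Hypothesis sp : simple_polygon p.
Implicit Types (x y z u v w O : R * R) (t s r e f : R) (a b c d i j k m : 'I_n).

Notation P := (edges p predT).
Notation pS i := (p (ordS i)).

Lemma vertex_not_off k : ~ off P (p k).
Proof. by move=> /offP; apply; exact: boundary_vertex. Qed.

(** A point of the side off the boundary is pushed towards [B] into the open triangle without
    changing its parity. *)
Lemma tri_sees a B k : orient (p a) B (p k) != 0 ->
  (forall y, 0 < cA (p a) B (p k) y -> 0 < cB (p a) B (p k) y ->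
     0 < cC (p a) B (p k) y -> off P y /\ parity P y) ->
  sees p (p a) (p k).
Proof.
move=> D0 h; apply: (sees_intro sp) => z zs fz.
have [[a1 b1 c1] [[a2 b2 c2] [a3 b3 c3]]] := bary_vertices D0.
case: (on_open_seg zs) => [e|e|s /andP[s0 s1] zE].
- by rewrite e in fz; case: (vertex_not_off fz).
- by rewrite e in fz; case: (vertex_not_off fz).
have [t /andP[t0 t1] ft] := off_near B (@nondeg_edges _ _ _ sp _) fz.
rewrite (parity_free (cyclicP p) ft).
have [|||_ //] := h (lerp z B t).
- rewrite cA_lerp zE cA_lerp a1 a2 a3 !mulr1 !mulr0 !addr0.
  by rewrite mulr_gt0 // subr_gt0.
- rewrite cB_lerp zE cB_lerp b1 b2 b3 !mulr1 !mulr0 !addr0 !mulr0 add0r //.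
- rewrite cC_lerp zE cC_lerp c1 c2 c3 !mulr1 !mulr0 !addr0 add0r.
  by rewrite mulr_gt0 // subr_gt0.
Qed.

(** Seen from [A], the points between [O] on [AB] and [p m] make a smaller angle with [AB] than
    [p m], so they belong to the free part. *)
Lemma wedge_ray A B k m O : orient A B (p k) != 0 ->
  0 <= cA A B (p k) (p m) -> 0 <= cB A B (p k) (p m) -> 0 < cC A B (p k) (p m) ->
  (forall y, 0 < cA A B (p k) y -> 0 < cB A B (p k) y -> 0 < cC A B (p k) y ->
      cC A B (p k) y * cB A B (p k) (p m) < cB A B (p k) y * cC A B (p k) (p m) ->
      off P y) ->
  0 <= cA A B (p k) O -> 0 < cA A B (p k) O \/ 0 < cA A B (p k) (p m) ->
  0 < cB A B (p k) O -> cC A B (p k) O = 0 ->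
  forall s, 0 < s -> s < 1 -> off P (lerp O (p m) s).
Proof.
move=> D0 m1 m2 m3 free a0 a1 b0 c0 s s0 s1; apply: free.
- rewrite cA_lerp; case: a1 => a1; [apply: conv_gt0l|apply: conv_gt0r] => //; exact: ltW.
- by rewrite cB_lerp; apply: conv_gt0l => //; exact: ltW.
- by rewrite cC_lerp c0 mulr0 add0r mulr_gt0.
rewrite cB_lerp cC_lerp c0 mulr0 add0r mulrDl -subr_gt0.
set X := (X in 0 < X).
have -> : X = (1 - s) * (cB A B (p k) O * cC A B (p k) (p m)) by rewrite /X; ring.
by apply: mulr_gt0; [rewrite subr_gt0 | exact: mulr_gt0].
Qed.

(** The orientation condition excludes overlapping collinear segments. *)
Definition cross a b c d := [/\ prim p a b, prim p c d,
  orient (p a) (p b) (p c) != 0 &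
  exists2 O, open_seg (p a) (p b) O & open_seg (p c) (p d) O].

Lemma cross_opp a b c d : cross a b c d ->
  orient (p a) (p b) (p c) * orient (p a) (p b) (p d) < 0.
Proof.
move=> [_ _ o [O [t _ OE] [s /andP[s0 s1] OE']]].
have : orient (p a) (p b) O = 0 by rewrite OE orient_lerp orient_aba orient_abb; ring.
rewrite OE' orient_lerp; move: (orient _ _ (p d)) => o'; set o1 := orient _ _ _ => h.
have -> : o' = - ((1 - s) / s * o1).
  have -> : o' = s * o' / s by field; rewrite gt_eqF.
  have -> : s * o' = - ((1 - s) * o1) by lra.
  by field; rewrite gt_eqF.
rewrite mulrN oppr_lt0 mulrCA mulr_gt0 //; first by rewrite divr_gt0 // subr_gt0.
by rewrite -expr2 lt_neqAle eq_sym sqrf_eq0 o sqr_ge0.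
Qed.

Lemma cross_swapl a b c d : cross a b c d -> cross b a c d.
Proof.
move=> [h1 h2 h3 [O O1 O2]]; split=> //; first exact: primC.
  by rewrite orient_swap oppr_eq0.
by exists O => //; exact: open_segC.
Qed.

Lemma cross_swapr a b c d : cross a b c d -> cross a b d c.
Proof.
move=> h; have := cross_opp h; case: h => [h1 h2 h3 [O O1 O2]] op; split=> //.
- exact: primC.
- by apply/eqP => e; rewrite e mulr0 ltxx in op.
by exists O => //; exact: open_segC.
Qed.

Lemma collinear3 u v x y z : u != v -> orient u v x = 0 -> orient u v y = 0 ->
  orient u v z = 0 -> orient x y z = 0.
Proof.
move=> uv hx hy hz; rewrite (projK uv hx) (projK uv hy) (projK uv hz).
by rewrite /orient /lerp /=; ring.
Qed.

(** An edge through [O] would be collinear with both segments, hence these with each other. *)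
Lemma cross_point_off a b c d O : prim p a b -> prim p c d ->
  orient (p a) (p b) (p c) != 0 ->
  open_seg (p a) (p b) O -> open_seg (p c) (p d) O -> off P O.
Proof.
move=> pab pcd o O1 O2; apply/off_edges => k _ Ok.
have [ha hb _] := prim_edge sp pab O1 Ok; have [hc _ _] := prim_edge sp pcd O2 Ok.
by rewrite (collinear3 (edge_neq sp k) ha hb hc) eqxx in o.
Qed.

Lemma chord_off a b O : prim p a b -> open_seg (p a) (p b) O -> off P O ->
  forall x, open_seg (p a) (p b) x -> off P x.
Proof.
move=> pab O1 fO x; apply: (prim_chord sp) => // e; move/off_edges: fO.
  by move=> /(_ a isT); apply; rewrite -e; exact: open_seg_on.
by move=> /(_ b isT); apply; rewrite -e; apply: on_segC; exact: open_seg_on.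
Qed.

(** No edge enters the triangle [aOc] through [aO] or [Oc], because these lie on chords whose
    interiors are free of boundary points. For the same reason a vertex with vanishing [cA], being
    on [Oc], can only be [c]. *)
Lemma cross_wedge a b c d O : prim p a b -> prim p c d ->
  orient (p a) (p b) (p c) != 0 ->
  open_seg (p a) (p b) O -> open_seg (p c) (p d) O ->
  orient (p a) O (p c) != 0 /\
  exists m, [/\ 0 <= cB (p a) O (p c) (p m), 0 < cC (p a) O (p c) (p m),
    (forall y, 0 < cA (p a) O (p c) y -> 0 < cB (p a) O (p c) y ->
       0 < cC (p a) O (p c) y ->
      cC (p a) O (p c) y * cB (p a) O (p c) (p m)
        < cB (p a) O (p c) y * cC (p a) O (p c) (p m) -> off P y),
    0 <= cA (p a) O (p c) (p m) &
    m = c \/ 0 < cA (p a) O (p c) (p m)].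
Proof.
move=> pab pcd o O1 O2.
have fO := cross_point_off pab pcd o O1 O2.
have free1 := chord_off pab O1 fO; have free2 := chord_off pcd O2 fO.
have D0 : orient (p a) O (p c) != 0.
  case: O1 => t /andP[t0 t1] ->.
  have -> : orient (p a) (lerp (p a) (p b) t) (p c) = t * orient (p a) (p b) (p c).
    by rewrite /orient /lerp /=; ring.
  by rewrite mulf_neq0 // gt_eqF.
have open1 x : cC (p a) O (p c) x = 0 -> 0 < cB (p a) O (p c) x ->
    0 <= cA (p a) O (p c) x -> open_seg (p a) (p b) x.
  move=> hC hB hA; have s1 := bary_sum D0 x.
  case: O1 => t /andP[t0 t1] OE.
  move: (bary_point D0 x) s1 hB; rewrite hC.
  move: (cA _ _ _ x) (cB _ _ _ x) (cC _ _ _ x) hA hC => kA kB kC hA hC xE s1 hB.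
  exists (kB * t); last first.
    have cAE : kA = 1 - kB by lra.
    by rewrite -lerp_lerpl -OE xE cAE /lerp; congr pair; ring.
  rewrite mulr_gt0 //=; have : kB * t <= t by rewrite ger_pMl //; lra.
  lra.
have open2 x : cA (p a) O (p c) x = 0 -> 0 < cB (p a) O (p c) x ->
    0 <= cC (p a) O (p c) x -> open_seg (p c) (p d) x.
  move=> hA hB hC; have s1 := bary_sum D0 x.
  case: O2 => t /andP[t0 t1] OE.
  move: (bary_point D0 x) s1 hB; rewrite hA.
  move: (cA _ _ _ x) (cB _ _ _ x) (cC _ _ _ x) hA hC => kA kB kC hA hC xE s1 hB.
  exists (kB * t); last first.
    have cCE : kC = 1 - kB by lra.
    by rewrite -lerp_lerpl -OE xE cCE /lerp; congr pair; ring.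
  rewrite mulr_gt0 //=; have : kB * t <= t by rewrite ger_pMl //; lra.
  lra.
split=> //; have [|m [m1 m2 m3 m4]] := wedge_free D0.
  move=> i y _ _ _ _ x xi xA xB xC /eqP; rewrite mulf_eq0 => /orP[]/eqP h.
    by have /off_edges/(_ i isT) : off P x by apply: free2; apply: open2.
  by have /off_edges/(_ i isT) : off P x by apply: free1; apply: open1.
exists m; split=> //.
have [h|h] := eqVneq (cA (p a) O (p c) (p m)) 0; last by right; rewrite lt_neqAle eq_sym h.
left; have [h'|h'] := eqVneq (cB (p a) O (p c) (p m)) 0; last first.
  have h0 : 0 < cB (p a) O (p c) (p m) by rewrite lt_neqAle eq_sym h'.
  by case: (@vertex_not_off m); apply: free2; apply: open2 => //; exact: ltW.
apply: (p_inj sp); have := bary_sum D0 (p m); rewrite h h' !add0r => h''.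
by rewrite (bary_point D0 (p m)) h h' h'' !mul0r !add0r !mul1r -surjective_pairing.
Qed.

End Crossing.

(** * The crossing of least area *)

Section CrossingK4.
Variables (R : realType) (n : nat) (p : 'I_n -> R * R).
Hypothesis sp : simple_polygon p.
Implicit Types (x y z u v w O : R * R) (t s r e f : R) (a b c d i j k m : 'I_n).

Notation P := (edges p predT).
Notation pS i := (p (ordS i)).

Definition has_K4 := exists f : 'I_4 -> 'I_n,
  injective f /\ forall i j : 'I_4, i != j -> vis_adj p (f i) (f j).

Lemma has_K4_intro a b c d : uniq [:: a; b; c; d] ->
  sees p (p a) (p b) -> sees p (p a) (p c) -> sees p (p a) (p d) ->
  sees p (p b) (p c) -> sees p (p b) (p d) -> sees p (p c) (p d) -> has_K4.
Proof.
move=> u ab ac ad bc bd cd; pose f (i : 'I_4) := nth a [:: a; b; c; d] i.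
have fI : injective f.
  move=> i j /eqP; rewrite (nth_uniq a _ _ u) ?ltn_ord // => /eqP; exact: val_inj.
exists f; split=> // i j ij; split.
  by apply: contra ij => /eqP/fI ->.
by case: i ij => [[|[|[|[|//]]]] hi]; case: j => [[|[|[|[|//]]]] hj] //= _;
  rewrite /f //=; try exact: seesC.
Qed.

(** In both triangles the side opposite [A] is on the line [CC'], and [cA] is the distance from that
    line relative to that of [A]. So the wedges on the two sides of [AO] share this coordinate. *)
Lemma cA_same (A O C C' : R * R) t z : O = lerp C C' t -> 0 < t < 1 ->
  cA A O C z = cA A O C' z.
Proof.
move=> -> /andP[t0 t1]; rewrite /cA.
have e1 w : orient w (lerp C C' t) C = - t * orient w C C'.
  by rewrite /orient /lerp /=; ring.
have e2 w : orient w (lerp C C' t) C' = (1 - t) * orient w C C'.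
  by rewrite /orient /lerp /=; ring.
rewrite !e1 !e2 -!mulf_div !divff ?mul1r //.
  by rewrite gt_eqF // subr_gt0.
by rewrite oppr_eq0 gt_eqF.
Qed.

Lemma cC_height A B C O t z : O = lerp A B t -> 0 < t -> orient A B C != 0 ->
  orient A B z = cC A O C z * orient A B C.
Proof.
move=> -> t0 o; rewrite /cC.
have e w : orient A (lerp A B t) w = t * orient A B w.
  by rewrite /orient /lerp /=; ring.
by rewrite !e; field; rewrite o gt_eqF.
Qed.

(** If the wedge in [aOc] returns [c] itself, that triangle is empty. Otherwise [m] is strictly
    closer to [ab] than [c], the vertex [m'] of the wedge in [aOd] is no farther than [d], and [mm']
    meets [ab] between [a] and [O], with free rays to both ends. *)
Lemma cross_improve a b c d : cross p a b c d -> sees p (p a) (p c) \/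
  exists m m', cross p a b m m' /\
   `|orient (p a) (p b) (p m)| + `|orient (p a) (p b) (p m')|
     < `|orient (p a) (p b) (p c)| + `|orient (p a) (p b) (p d)|.
Proof.
move=> X; have op := cross_opp X; have X' := cross_swapr X.
case: (X) => pab pcd oc [O O1 O2].
have [_ pdc od _] := X'.
have fO := cross_point_off sp pab pcd oc O1 O2.
have free1 := chord_off sp pab O1 fO.
have [_ sab _] := pab.
have par1 x : open_seg (p a) (p b) x -> parity P x.
  by move=> hx; apply: (sees_parity sp sab); [exact: open_seg_on|exact: free1].
have [D1 [m [mB mC mfree mA mcase]]] := cross_wedge sp pab pcd oc O1 O2.
have [D2 [m' [mB' mC' mfree' mA' _]]] := cross_wedge sp pab pdc od O1 (open_segC O2).
have [[a1 b1 c1] [[a2 b2 c2] [a3 b3 c3]]] := bary_vertices D1.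
case: mcase => mcase.
  left; rewrite mcase in mfree mB; apply: (tri_sees sp D1) => y yA yB yC.
  have fy s : 0 < s -> s <= 1 -> off P (lerp O y s).
    move=> s0 s1; apply: mfree.
    - by rewrite cA_lerp a2 mulr0 add0r mulr_gt0.
    - by rewrite cB_lerp b2; apply: conv_gt0 => //; exact: ltW.
    - by rewrite cC_lerp c2 mulr0 add0r mulr_gt0.
    rewrite b3 c3 mulr0 mulr1 cB_lerp b2; apply: conv_gt0 => //; exact: ltW.
  split; first by rewrite -(lerp1 O y); apply: fy.
  rewrite -(parity_free (cyclicP p) (z := O)); first exact: par1.
  move=> z [s [s0 [s1 ->]]]; have [->|sn] := eqVneq s 0; first by rewrite lerp0.
  by apply: fy => //; rewrite lt_neqAle eq_sym sn.
right; exists m, m'.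
case: (O1) => t1 /andP[t10 t11] OE1; case: (O2) => t2 t201 OE2.
set G := orient (p a) (p b).
have Gm : G (p m) = cC (p a) O (p c) (p m) * G (p c) by apply: cC_height OE1 _ _.
have Gm' : G (p m') = cC (p a) O (p d) (p m') * G (p d) by apply: cC_height OE1 _ _.
have opm : G (p m) * G (p m') < 0.
  rewrite Gm Gm' mulrACA pmulr_rlt0 //; exact: mulr_gt0.
have FE z : cA (p a) O (p c) z = cA (p a) O (p d) z := cA_same _ _ OE2 t201.
have dG : G (p m) - G (p m') != 0.
  apply/eqP => h; have e : G (p m) = G (p m') by lra.
  by move: opm; rewrite e -expr2 ltNge sqr_ge0.
(* The parameter at which [mm'] meets the line [ab], that is, where [G] vanishes. *)
pose tau := G (p m) / (G (p m) - G (p m')).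
have tau01 : 0 < tau < 1.
  have [[h1 h2]|[h1 h2]] := mulr_lt0_sgn opm.
    have d0 : 0 < G (p m') - G (p m) by lra.
    have -> : tau = - G (p m) / (G (p m') - G (p m)).
      by rewrite /tau; field; rewrite dG gt_eqF.
    by apply/andP; split; [apply: divr_gt0|rewrite ltr_pdivrMr // mul1r]; lra.
  have d0 : 0 < G (p m) - G (p m') by lra.
  by apply/andP; split; [apply: divr_gt0|rewrite ltr_pdivrMr // mul1r]; lra.
case/andP: (tau01) => tau0 tau1.
pose O' := lerp (p m) (p m') tau.
have GO' : G O' = 0 by rewrite /G /O' orient_lerp -/G /tau; field.
have sm := bary_sum D1 (p m); have sm' := bary_sum D2 (p m').
(* [O'] divides the segment from [a] to [O] with weight [f] at [a]; strict bounds on [f] keep it off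
   both ends. *)
pose f := cA (p a) O (p c) O'.
have f0 : 0 < f.
  by rewrite /f /O' cA_lerp; apply: conv_gt0l => //; [exact: ltW|rewrite FE].
have f1 : f < 1.
  rewrite /f /O' cA_lerp.
  have := @conv_gt0 R (1 - cA (p a) O (p c) (p m)) (1 - cA (p a) O (p c) (p m'))
    tau (ltW tau0) (ltW tau1).
  by have := FE (p m'); lra.
have CO : cC (p a) O (p c) O' = 0.
  by apply: (mulIf oc); rewrite -(cC_height O' OE1) // mul0r.
have CO' : cC (p a) O (p d) O' = 0.
  by apply: (mulIf od); rewrite -(cC_height O' OE1) // mul0r.
have BO : cB (p a) O (p c) O' = 1 - f.
  by have := bary_sum D1 O'; rewrite -/f CO; lra.
have BO' : cB (p a) O (p d) O' = 1 - f.
  by have := bary_sum D2 O'; rewrite -FE -/f CO'; lra.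
have OE' : O' = lerp (p a) (p b) ((1 - f) * t1).
  rewrite -lerp_lerpl -OE1 {1}(bary_point D1 O') -/f CO BO /lerp; congr pair; ring.
have openO' : open_seg (p a) (p b) O'.
  exists ((1 - f) * t1) => //; rewrite mulr_gt0 ?subr_gt0 //=.
  have : (1 - f) * t1 <= t1 by rewrite ger_pMl //; lra.
  lra.
have parO' := par1 _ openO'; have fO' := free1 _ openO'.
have ray1 : forall s, 0 < s -> s < 1 -> off P (lerp O' (p m) s).
  by apply: (wedge_ray D1) => //; rewrite ?BO -/f ?subr_gt0 //; [exact: ltW|left].
have ray2 : forall s, 0 < s -> s < 1 -> off P (lerp O' (p m') s).
  by apply: (wedge_ray D2) => //; rewrite ?BO' -?FE -/f ?subr_gt0 //; [exact: ltW|left].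
have ray0 (u : 'I_n) : (forall s, 0 < s -> s < 1 -> off P (lerp O' (p u) s)) ->
    forall z, on_seg O' (p u) z -> z <> p u -> off P z /\ parity P z.
  move=> ray z [s [s0 [s1 zE]]] zn.
  have sl1 : s < 1 by rewrite lt_neqAle s1 andbT; apply/eqP => e; apply: zn; rewrite zE e lerp1.
  have ray' s' : 0 <= s' -> s' < 1 -> off P (lerp O' (p u) s').
    move=> s0' s1'; have [->|sn] := eqVneq s' 0; first by rewrite lerp0.
    by apply: ray => //; rewrite lt_neqAle eq_sym sn.
  split; first by rewrite zE; exact: ray'.
  rewrite -(parity_free (cyclicP p) (z := O')) // zE => w [e [e0 [e1 ->]]].
  rewrite lerp_lerpl; apply: ray'; first exact: mulr_ge0.
  by apply: le_lt_trans sl1; rewrite ler_piMl.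
have onO' : on_seg (p m) (p m') O' by apply: on_seg_lerp; exact: ltW.
have mids z : on_seg (p m) (p m') z -> z <> p m -> z <> p m' -> off P z /\ parity P z.
  move=> zs n1 n2; case: (on_seg_split onO' zs) => h; last exact: (ray0 m').
  by apply: (ray0 m) => //; exact: on_segC.
have mm : m != m'.
  by apply/eqP => e; move: opm; rewrite e -expr2 ltNge sqr_ge0.
split; first split=> //.
- split=> //.
    apply: (sees_intro sp) => z zs fz; apply: (mids z zs _ _).2 => e; rewrite e in fz;
    exact: (vertex_not_off fz).
  move=> k ks; have [->|km] := eqVneq k m; [by left|right].
  apply/eqP/negPn/negP => km'; have [||f' _] := mids _ ks.
  - by move/(p_inj sp)/eqP; rewrite (negPf km).
  - by move/(p_inj sp)/eqP; rewrite (negPf km').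
  exact: (vertex_not_off f').
- by apply/eqP => e; move: opm; rewrite /G e mul0r ltxx.
- by exists O' => //; exists tau.
rewrite -/G Gm Gm' [`|_ * G (p c)|]normrM [`|_ * G (p d)|]normrM (gtr0_norm mC) (gtr0_norm mC').
have k1 : 0 < `|G (p c)| by rewrite normr_gt0.
apply: ltr_leD; first by rewrite gtr_pMl //; lra.
by rewrite ler_piMl //; lra.
Qed.

(** [F] is twice the area of [acbd] and does not change when the ends of either segment are
    exchanged, so [cross_improve] applied to the four labellings yields all four sides. *)
Lemma cross_K4 a b c d : cross p a b c d -> has_K4.
Proof.
move=> X.
pose Q := [pred q : 'I_n * 'I_n * 'I_n * 'I_n | `[< cross p q.1.1.1 q.1.1.2 q.1.2 q.2 >]].
pose F (q : 'I_n * 'I_n * 'I_n * 'I_n) : R :=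
  `|orient (p q.1.1.1) (p q.1.1.2) (p q.1.2)| + `|orient (p q.1.1.1) (p q.1.1.2) (p q.2)|.
have Q0 : Q (a, b, c, d) by apply/asboolP.
case: (arg_minP F Q0) => -[[[a' b'] c'] d'] /asboolP /= X1 qmin.
have see (u v w x : 'I_n) : cross p u v w x ->
  F (u, v, w, x) = F (a', b', c', d') -> sees p (p u) (p w).
  move=> Y FE; case: (cross_improve Y) => // -[m [m' [Y' lt]]].
  have /qmin : Q (u, v, m, m') by apply/asboolP.
  by rewrite -FE leNgt; move: lt; rewrite /F /= => ->.
have X2 := cross_swapl X1; have X3 := cross_swapr X1; have X4 := cross_swapr X2.
have Fs (u v w x : 'I_n) : F (v, u, w, x) = F (u, v, w, x).
  by rewrite /F /= (orient_swap (p u)) (orient_swap (p u) (p v) (p x)) !normrN.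
have Fr (u v w x : 'I_n) : F (u, v, x, w) = F (u, v, w, x).
  by rewrite /F /= addrC.
have [[ab sab hab] [cd scd hcd] o _] := X1.
have od : orient (p a') (p b') (p d') != 0 by case: X3.
apply: (@has_K4_intro a' b' c' d') => //.
- rewrite /= !inE !negb_or ab cd !andbT /=.
  apply/andP; split.
    by apply/andP; split; apply/eqP => e; [move: o|move: od]; rewrite -e orient_aba eqxx.
  by apply/andP; split; apply/eqP => e; [move: o|move: od]; rewrite -e orient_abb eqxx.
- exact: see X1 _.
- by apply: see X3 _; rewrite Fr.
- by apply: see X2 _; rewrite Fs.
- by apply: see X4 _; rewrite Fr Fs.
Qed.

End CrossingK4.

(** * Vertices inside a visible segment *)

Section GoodSide.
Variables (R : realType) (n : nat) (p : 'I_n -> R * R).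
Hypothesis sp : simple_polygon p.
Implicit Types (x y z u v O q : R * R) (t s r e f : R) (a b c d i j k m w : 'I_n).

Notation P := (edges p predT).
Notation pS i := (p (ordS i)).

Lemma close_trans r1 r2 x y z : close r1 x y -> close r2 y z -> close (r1 + r2) x z.
Proof.
move=> [h1 h2] [h3 h4]; rewrite /close; split.
  have -> : x.1 - z.1 = (x.1 - y.1) + (y.1 - z.1) by ring.
  by apply: le_lt_trans (ler_normD _ _) _; exact: ltrD.
have -> : x.2 - z.2 = (x.2 - y.2) + (y.2 - z.2) by ring.
by apply: le_lt_trans (ler_normD _ _) _; exact: ltrD.
Qed.

(** The vertex is written [pS i] so that its neighbours are [p i] and [pS (ordS i)]. *)
Definition good a b i := exists2 r, 0 < r &
  forall q, close r q (pS i) -> 0 < orient (p a) (p b) q -> off P q /\ parity P q.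

(** The two edges at the vertex stay in the closed right half-plane and all others are out of reach,
    so the left half-disc, which is convex, is free. *)
Lemma half_disc a b i : orient (p a) (p b) (pS i) = 0 ->
  orient (p a) (p b) (p i) <= 0 -> orient (p a) (p b) (pS (ordS i)) <= 0 ->
  exists2 r, 0 < r & forall q q', close r q (pS i) -> close r q' (pS i) ->
    0 < orient (p a) (p b) q -> 0 < orient (p a) (p b) q' ->
    off P q /\ parity P q = parity P q'.
Proof.
move=> g0 g1 g2; have [r r0 hr] := vertex_clear sp i; exists r => // q q' cq cq' gq gq'.
have fs : off_seg P q q'.
  move=> z zs.
  have gz : 0 < orient (p a) (p b) z.
    by case: zs => t [t0 [t1 ->]]; rewrite orient_lerp; apply: conv_gt0.
  apply: (@off_split2 _ _ _ i); first exact: (hr _ _ cq cq').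
    move=> [t [t0 [t1 zE]]]; move: gz; rewrite zE orient_lerp g0 mulr0 addr0 ltNge.
    by rewrite mulr_ge0_le0 // subr_ge0.
  move=> [t [t0 [t1 zE]]]; move: gz; rewrite zE orient_lerp g0 mulr0 add0r ltNge.
  by rewrite mulr_ge0_le0.
split; first by apply: fs; exact: on_segl.
exact: parity_free (cyclicP p) fs.
Qed.

(** A point on the way to [p w] has odd parity; pushed slightly to the left it falls into the
    half-disc, where parity is constant. Each of the two moves takes half of the radius. *)
Lemma near_line_good a b i w : p a != p b -> orient (p a) (p b) (pS i) = 0 ->
  orient (p a) (p b) (p i) <= 0 -> orient (p a) (p b) (pS (ordS i)) <= 0 ->
  orient (p a) (p b) (p w) = 0 -> sees p (pS i) (p w) ->
  (forall x, open_seg (pS i) (p w) x -> off P x) -> good a b i.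
Proof.
move=> ab g0 g1 g2 gw sw fw; have [r r0 hr] := half_disc g0 g1 g2.
have r20 : 0 < r / 2 by lra.
have [e /andP[e0 e1] he] := lerp_close (pS i) (p w) r20.
set x := lerp (pS i) (p w) e in he.
have ox : open_seg (pS i) (p w) x by exists e => //; rewrite e0 e1.
have cx : close (r / 2) x (pS i) by apply: he; rewrite lexx ltW.
have fx := fw _ ox.
have px : parity P x by apply: (sees_parity sp sw) => //; exact: open_seg_on.
have [r' r0' hr'] := off_clear (@nondeg_edges _ _ _ sp predT) fx.
have m0 : 0 < Num.min (r / 2) r' by rewrite lt_min r20.
have [e' /andP[e0' e1'] he'] := lerp_close x (normal (p a) (p b) x) m0.
set q := lerp x (normal (p a) (p b) x) e'.
have cq : close (Num.min (r / 2) r') q x by apply: he'; rewrite lexx ltW.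
have pq : parity P q.
  rewrite -(parity_free (cyclicP p) (z := x)) //; apply: hr'; first exact: close_refl.
  by apply: close_le cq; rewrite ge_min lexx orbT.
have gx : orient (p a) (p b) x = 0 by rewrite orient_lerp g0 gw; ring.
have gq : 0 < orient (p a) (p b) q.
  rewrite orient_lerp orient_normal gx mulr0 !add0r mulr_gt0 //; exact: sqd_gt0.
have cq' : close r q (pS i).
  have -> : r = r / 2 + r / 2 by field.
  by apply: close_trans cx; apply: close_le cq; rewrite ge_min lexx.
exists r => // q' cq'' gq'; have [fq' ->] := hr q' q cq'' cq' gq' gq.
by split.
Qed.

(** Both half-discs are free, and parity flips across the edge between them, so one of them is
    interior. *)
Lemma straight_good a b i : p a != p b -> orient (p a) (p b) (pS i) = 0 ->
  orient (p a) (p b) (p i) = 0 -> orient (p a) (p b) (pS (ordS i)) = 0 ->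
  good a b i \/ good b a i.
Proof.
move=> ab g0 g1 g2.
have [|||r r0 hr] := @half_disc a b i; rewrite ?g1 ?g2 //.
have [|||r1 r10 hr1] := @half_disc b a i; rewrite ?(orient_swap (p a)) ?g0 ?g1 ?g2 ?oppr0 //.
have r20 : 0 < Num.min r r1 / 2 by rewrite divr_gt0 // lt_min r0.
have [e /andP[e0 e1] he] := lerp_close (pS i) (p i) r20.
set x := lerp (pS i) (p i) e in he.
have xE : x = lerp (p i) (pS i) (1 - e) by rewrite /x lerpC.
have e01 : 0 < 1 - e < 1 by apply/andP; split; lra.
have cx : close (Num.min r r1 / 2) x (pS i) by apply: he; rewrite lexx ltW.
have [r' r0' hr'] := off_clear (@nondeg_edges _ _ _ sp _) (open_edge_off sp (i := i) e01).
rewrite -xE in hr'.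
have m0 : 0 < Num.min (Num.min r r1 / 2) r' by rewrite lt_min r20.
have [f1 /andP[f10 f11] hf1] := lerp_close x (normal (p a) (p b) x) m0.
have [f2 /andP[f20 f21] hf2] := lerp_close x (normal (p b) (p a) x) m0.
pose f := Num.min f1 f2.
have f0 : 0 < f by rewrite lt_min f10.
have [fl1 fl2] : f <= f1 /\ f <= f2 by rewrite /f !ge_min !lexx orbT.
set q := lerp x (normal (p a) (p b) x) f; set q' := lerp x (normal (p b) (p a) x) f.
have cq : close (Num.min (Num.min r r1 / 2) r') q x by apply: hf1; rewrite ltW.
have cq' : close (Num.min (Num.min r r1 / 2) r') q' x by apply: hf2; rewrite ltW.
have gx : orient (p a) (p b) x = 0 by rewrite orient_lerp g0 g1; ring.
have gq : 0 < orient (p a) (p b) q.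
  rewrite orient_lerp orient_normal gx mulr0 !add0r mulr_gt0 //; exact: sqd_gt0.
have gq' : 0 < orient (p b) (p a) q'.
  rewrite orient_lerp orient_normal (orient_swap (p a)) gx oppr0 mulr0 !add0r mulr_gt0 //.
  by apply: sqd_gt0; rewrite eq_sym.
have half z : close (Num.min (Num.min r r1 / 2) r') z x -> close (Num.min r r1) z (pS i).
  move=> cz; have -> : Num.min r r1 = Num.min r r1 / 2 + Num.min r r1 / 2 by field.
  by apply: close_trans cx; apply: close_le cz; rewrite ge_min lexx.
have mid z : z = lerp (lerp z (normal (p a) (p b) z) f) (lerp z (normal (p b) (p a) z) f) (1 / 2).
  by case: z => z1 z2; rewrite /lerp /normal /=; congr pair; field.
have flip : parity P q = ~~ parity P q'.
  rewrite !(parityD1 p i); apply: (@parity_cross _ _ _ _ _ _ (1 - e) (1 / 2)) => //.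
  - exact: cyclicD1.
  - apply: hr'; [apply: close_le cq|apply: close_le cq']; by rewrite ge_min lexx orbT.
  - by apply/andP; split; lra.
  - by rewrite -xE; exact: mid.
  apply/eqP => o; have [oa ob] := orient_line ab g1 g0.
  by rewrite (collinear3 (edge_neq sp i) oa ob o) ltxx in gq.
have [pq|pq] := boolP (parity P q).
  left; exists r => // z cz gz.
  have [|fz ->] := hr z q cz _ gz gq; last by split.
  by apply: close_le (half q cq); rewrite ge_min lexx.
right; exists r1 => // z cz gz.
have [|fz ->] := hr1 z q' cz _ gz gq'; last by split=> //; move: pq; rewrite flip negbK.
by apply: close_le (half q' cq'); rewrite ge_min lexx orbT.
Qed.

(** Points [a'] and [b'] close to the vertex towards [a] and [b] have odd parity, and so do slight
    shifts [a2] and [b2] of them. But [a2] and [b2] are separated by the edge [vu] alone, which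
    would flip the parity. *)
Lemma not_two_sided a b i : prim p (ordS i) a -> prim p (ordS i) b ->
  open_seg (p a) (p b) (pS i) -> orient (p a) (p b) (p i) < 0 ->
  0 < orient (p a) (p b) (pS (ordS i)) -> False.
Proof.
move=> pa pb [tau tau01 vE] g1 g2.
have chord w : w = a \/ w = b -> prim p (ordS i) w ->
    forall x, open_seg (pS i) (p w) x -> off P x.
  move=> wE pw x; apply: (prim_chord sp) => //.
    by move=> e; move: g2; rewrite -e; case: wE => ->; rewrite ?orient_aba ?orient_abb ltxx.
  move=> /ordS_inj e; move: g1; rewrite e.
  by case: wE => ->; rewrite ?orient_aba ?orient_abb ltxx.
have g0 : orient (p a) (p b) (pS i) = 0.
  by rewrite vE orient_lerp orient_aba orient_abb; ring.
have [r r0 hr] := vertex_clear sp i.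
have r20 : 0 < r / 2 by lra.
set v := pS i in vE g0 hr pa pb chord *; set u := pS (ordS i) in g2 *.
have [ea /andP[ea0 ea1] hea] := lerp_close v (p a) r20.
have [eb /andP[eb0 eb1] heb] := lerp_close v (p b) r20.
pose e := Num.min ea eb.
have e0 : 0 < e by rewrite lt_min ea0.
have [el1 el2] : e <= ea /\ e <= eb by rewrite /e !ge_min !lexx orbT.
have e1 : e < 1 by lra.
set a' := lerp v (p a) e; set b' := lerp v (p b) e.
have ca' : close (r / 2) a' v by apply: hea; rewrite ltW.
have cb' : close (r / 2) b' v by apply: heb; rewrite ltW.
have oa' : open_seg v (p a) a' by exists e => //; rewrite e0.
have ob' : open_seg v (p b) b' by exists e => //; rewrite e0.
have fa := chord a (or_introl erefl) pa _ oa'.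
have fb := chord b (or_intror erefl) pb _ ob'.
have para : parity P a'.
  by apply: (sees_parity sp _ (open_seg_on oa')) => //; case: pa.
have parb : parity P b'.
  by apply: (sees_parity sp _ (open_seg_on ob')) => //; case: pb.
have [ra ra0 hra] := off_clear (@nondeg_edges _ _ _ sp _) fa.
have [rb rb0 hrb] := off_clear (@nondeg_edges _ _ _ sp _) fb.
have ma0 : 0 < Num.min ra (r / 2) by rewrite lt_min ra0.
have mb0 : 0 < Num.min rb (r / 2) by rewrite lt_min rb0.
(* Moving both points along [u - v] by the same amount keeps [a2 b2] parallel to [ab]; it crosses
   [vu] at parameter [t] and stays away from edge [i], which is on the other side. *)
pose shift (z : R * R) : R * R := (z.1 + (u.1 - v.1), z.2 + (u.2 - v.2)).
have [ta /andP[ta0 ta1] hta] := lerp_close a' (shift a') ma0.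
have [tb /andP[tb0 tb1] htb] := lerp_close b' (shift b') mb0.
pose t := Num.min ta tb.
have t0 : 0 < t by rewrite lt_min ta0.
have [tl1 tl2] : t <= ta /\ t <= tb by rewrite /t !ge_min !lexx orbT.
have t1 : t < 1 by lra.
set a2 := lerp a' (shift a') t; set b2 := lerp b' (shift b') t.
have ca2 : close (Num.min ra (r / 2)) a2 a' by apply: hta; rewrite ltW.
have cb2 : close (Num.min rb (r / 2)) b2 b' by apply: htb; rewrite ltW.
have para2 : parity P a2.
  rewrite -(parity_free (cyclicP p) (z := a')) //; apply: hra; first exact: close_refl.
  by apply: close_le ca2; rewrite ge_min lexx.
have parb2 : parity P b2.
  rewrite -(parity_free (cyclicP p) (z := b')) //; apply: hrb; first exact: close_refl.
  by apply: close_le cb2; rewrite ge_min lexx.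
have rr : r = r / 2 + r / 2 by field.
have cav : close r a2 v.
  by rewrite rr; apply: close_trans ca'; apply: close_le ca2; rewrite ge_min lexx orbT.
have cbv : close r b2 v.
  by rewrite rr; apply: close_trans cb'; apply: close_le cb2; rewrite ge_min lexx orbT.
have gshift z : orient (p a) (p b) (shift z) = orient (p a) (p b) z + orient (p a) (p b) u.
  rewrite -[RHS]subr0 -g0 /orient /shift /=; ring.
have ga2 : orient (p a) (p b) a2 = t * orient (p a) (p b) u.
  by rewrite orient_lerp gshift orient_lerp g0 orient_aba; ring.
have gb2 : orient (p a) (p b) b2 = t * orient (p a) (p b) u.
  by rewrite orient_lerp gshift orient_lerp g0 orient_abb; ring.
have fs : off_seg (edges p (predC1 (ordS i))) a2 b2.
  move=> z zs; apply/off_edges => k /= ki.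
  have [->|ki'] := eqVneq k i; last first.
    have /off_edges := hr _ _ cav cbv z zs; apply.
    by rewrite /other_edges /= ki ki'.
  move=> [f [f0 [f1 zE]]].
  have : orient (p a) (p b) z <= 0.
    by rewrite zE orient_lerp g0 mulr0 addr0 mulr_ge0_le0 ?subr_ge0 // ltW.
  case: zs => f' [f0' [f1' ->]]; rewrite orient_lerp ga2 gb2.
  have : 0 < t * orient (p a) (p b) u by rewrite mulr_gt0.
  by have := @conv_gt0 R (t * orient (p a) (p b) u) (t * orient (p a) (p b) u) f'; lra.
case/andP: (tau01) => tau0 tau1.
have := @parity_cross R _ _ _ a2 b2 t tau (cyclicD1 p (ordS i)) fs _ tau01.
rewrite -!(parityD1 p (ordS i)) para2 parb2 => cr; suff : true = ~~ true by [].
apply: cr; first by rewrite t0.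
  rewrite /a2 /b2 /a' /b' /shift -/v -/u /lerp /= vE /lerp /=; congr pair; ring.
have -> : orient v u a2 = e * orient v u (p a).
  rewrite /a2 /shift /a' /orient /lerp /=; ring.
rewrite mulf_neq0 ?gt_eqF // (_ : orient v u (p a) = tau * orient (p a) (p b) u) ?mulr_gt0 //.
by rewrite vE /orient /lerp /=; ring.
Qed.

Lemma good_side a b i : a != b -> prim p (ordS i) a -> prim p (ordS i) b ->
  open_seg (p a) (p b) (pS i) -> good a b i \/ good b a i.
Proof.
move=> ab pa pb ov; have nab := vertex_neq sp ab.
have g0 : orient (p a) (p b) (pS i) = 0 by apply: orient_on_seg; exact: open_seg_on.
have key (c d : 'I_n) : (c = a /\ d = b) \/ (c = b /\ d = a) -> orient (p c) (p d) (p i) <= 0 ->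
    orient (p c) (p d) (pS (ordS i)) <= 0 ->
    orient (p c) (p d) (p i) != 0 \/ orient (p c) (p d) (pS (ordS i)) != 0 -> good c d i.
  move=> cd h1 h2 h3.
  have ncd : p c != p d by case: cd => -[-> ->] //; rewrite eq_sym.
  have gcd : orient (p c) (p d) (pS i) = 0.
    by case: cd => -[-> ->] //; rewrite orient_swap g0 oppr0.
  have [pc pd] : prim p (ordS i) c /\ prim p (ordS i) d by case: cd => -[-> ->].
  have cnd : c != d by apply: contra ncd => /eqP ->.
  have ends w : w = c \/ w = d -> orient (p c) (p d) (p w) = 0.
    by case=> ->; rewrite ?orient_aba ?orient_abb.
  have chord w : prim p (ordS i) w -> w = c \/ w = d -> w <> i -> w <> ordS (ordS i) -> good c d i.
    move=> pw wcd n1 n2; apply: (near_line_good (w := w)) => //; first exact: ends.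
      by case: pw.
    move=> x; apply: (prim_chord sp) => //.
    by move=> /ordS_inj e; apply: n1.
  (* One of [c], [d] is not a neighbour of the vertex, since otherwise both edges there would lie on
     the line, against [h3]; the segment to it is a chord. *)
  have [ci|ci] := eqVneq c i.
    apply: (chord d) => //; [by right | by move=> e; move: cnd; rewrite ci e eqxx |].
    move=> e; case: h3; first by rewrite -ci orient_aba eqxx.
    by rewrite -e orient_abb eqxx.
  have [cS|cS] := eqVneq c (ordS (ordS i)).
    apply: (chord d) => //; [by right | | by move=> e; move: cnd; rewrite cS e eqxx].
    move=> e; case: h3; last by rewrite -cS orient_aba eqxx.
    by rewrite -e orient_abb eqxx.
  by apply: (chord c) => //; [left | apply/eqP | apply/eqP].
have [z1|n1] := eqVneq (orient (p a) (p b) (p i)) 0;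
  have [z2|n2] := eqVneq (orient (p a) (p b) (pS (ordS i))) 0.
- exact: straight_good.
- have [h|h] := leP (orient (p a) (p b) (pS (ordS i))) 0.
    left; apply: key => //; [by left | by rewrite z1 | by right].
  right; apply: key; rewrite ?(orient_swap (p a)) ?z1 ?oppr0 ?oppr_le0 ?oppr_eq0 //;
    [by right | exact: ltW | by right].
- have [h|h] := leP (orient (p a) (p b) (p i)) 0.
    left; apply: key => //; [by left | by rewrite z2 | by left].
  right; apply: key; rewrite ?(orient_swap (p a)) ?z2 ?oppr0 ?oppr_le0 ?oppr_eq0 //;
    [by right | exact: ltW | by left].
have [h1|h1] := ltrP (orient (p a) (p b) (p i)) 0;
  have [h2|h2] := ltrP (orient (p a) (p b) (pS (ordS i))) 0.
- by left; apply: key => //; [left | exact: ltW | exact: ltW | left].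
- exfalso; apply: (not_two_sided pa pb ov h1).
  by rewrite lt_neqAle eq_sym n2.
- exfalso; apply: (not_two_sided pb pa (open_segC ov)).
    by rewrite orient_swap oppr_lt0 lt_neqAle eq_sym n1.
  by rewrite orient_swap oppr_gt0.
right; apply: key; rewrite ?(orient_swap (p a)) ?oppr_le0 ?oppr_eq0 //; [by right | by left].
Qed.

End GoodSide.

(** * The third neighbour of a vertex inside a visible segment *)

Section Tee.
Variables (R : realType) (n : nat) (p : 'I_n -> R * R).
Hypothesis sp : simple_polygon p.
Implicit Types (x y z u v O q : R * R) (t s r e f : R) (a b c d i j k m w : 'I_n).

Notation P := (edges p predT).
Notation pS i := (p (ordS i)).

Lemma good_ray a b i z : good p a b i -> orient (p a) (p b) (pS i) = 0 ->
  0 < orient (p a) (p b) z ->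
  (forall s, 0 < s -> s <= 1 -> off P (lerp (pS i) z s)) -> parity P z.
Proof.
move=> [r r0 hr] g0 gz fz; have [e /andP[e0 e1] he] := lerp_close (pS i) z r0.
have [||_ pq] := hr (lerp (pS i) z e).
- by apply: he; rewrite lexx ltW.
- by rewrite orient_lerp g0 mulr0 add0r mulr_gt0.
rewrite -(parity_free (cyclicP p) (z := lerp (pS i) z e)) // => x [f [f0 [f1 ->]]].
rewrite -{2}(lerp1 (pS i) z) lerp_lerp; apply: fz; last by apply: conv01_le => //; lra.
by apply: conv_gt0 => //; lra.
Qed.

Lemma good_prim a b i m : good p a b i -> orient (p a) (p b) (pS i) = 0 ->
  0 < orient (p a) (p b) (p m) ->
  (forall s, 0 < s -> s < 1 -> off P (lerp (pS i) (p m) s)) -> prim p (ordS i) m.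
Proof.
move=> gd g0 gm fm; split.
- by apply/eqP => e; move: gm; rewrite -e g0 ltxx.
- apply: (sees_intro sp) => z zs fz.
  case: (on_open_seg zs) => [e|e|s /andP[s0 s1] zE].
  + by rewrite e in fz; case: (vertex_not_off fz).
  + by rewrite e in fz; case: (vertex_not_off fz).
  apply: (good_ray gd g0); rewrite zE; first by rewrite orient_lerp g0 mulr0 add0r mulr_gt0.
  move=> f f0 f1; rewrite lerp_lerpl; apply: fm; first exact: mulr_gt0.
  by apply: le_lt_trans s1; rewrite ger_pMl.
move=> k ks; have [->|ki] := eqVneq k (ordS i); [by left|right].
apply/eqP/negPn/negP => km.
case: (on_open_seg ks) => [/(p_inj sp)/eqP|/(p_inj sp)/eqP|s /andP[s0 s1] kE].
- by rewrite (negPf ki).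
- by rewrite (negPf km).
by case: (@vertex_not_off _ _ p k); rewrite kE; apply: fm.
Qed.

(** Here [w] is to be an end of the segment through [v]. The vertex [m] of smallest angle at [w] in
    the triangle [w v c] is primitively joined to [v]; if it were not [c], it would be closer to
    [ab], against the choice of [c]. The factor [kap] converts orientations about [wv] into heights
    over [ab]. *)
Lemma tee_sees a b i w c kap : good p a b i -> orient (p a) (p b) (pS i) = 0 ->
  kap != 0 -> (forall z, orient (p w) (pS i) z = kap * orient (p a) (p b) z) ->
  prim p (ordS i) w -> prim p (ordS i) c -> 0 < orient (p a) (p b) (p c) ->
  (forall c', prim p (ordS i) c' -> 0 < orient (p a) (p b) (p c') ->
     orient (p a) (p b) (p c) <= orient (p a) (p b) (p c')) ->
  sees p (p w) (p c).
Proof.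
move=> gd g0 kap0 kapE pw pc gc cmin.
set v := pS i; set G := orient (p a) (p b) in gc cmin kapE g0 *.
have D0 : orient (p w) v (p c) != 0 by rewrite kapE mulf_neq0 // gt_eqF.
have [[a1 b1 c1] [[a2 b2 c2] [a3 b3 c3]]] := bary_vertices D0.
have GE z : G z = cC (p w) v (p c) z * G (p c).
  by rewrite /cC !kapE; field; rewrite kap0 gt_eqF.
have ptB x : cB (p w) v (p c) x = 1 -> cA (p w) v (p c) x * cC (p w) v (p c) x = 0 ->
    cA (p w) v (p c) x + cC (p w) v (p c) x = 0 -> x = v.
  move=> hB /eqP; rewrite mulf_eq0 => /orP[]/eqP h h'; rewrite (bary_point D0 x) hB h.
    have -> : cC (p w) v (p c) x = 0 by lra.
    by rewrite !mul0r !add0r !addr0 !mul1r -surjective_pairing.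
  have -> : cA (p w) v (p c) x = 0 by lra.
  by rewrite !mul0r !add0r !addr0 !mul1r -surjective_pairing.
(* The corner [v] is itself on the boundary, but an edge from [v] into the triangle would run
   through the good half-disc. *)
have no_v j y : on_seg (p j) (pS j) y -> 0 < cC (p w) v (p c) y ->
    on_seg (p j) (pS j) v -> False.
  move=> yj yC vj; case: (gd) => r r0 hr.
  have [e /andP[e0 e1] he] := lerp_close v y r0.
  have [||/off_edges/(_ j isT) + _] := hr (lerp v y e).
  - by apply: he; rewrite lexx ltW.
  - by rewrite -/G GE cC_lerp c2 mulr0 add0r; apply: mulr_gt0 => //; exact: mulr_gt0.
  by apply; apply: on_seg_sub vj yj _; apply: on_seg_lerp; exact: ltW.
have openA x : cC (p w) v (p c) x = 0 -> 0 < cB (p w) v (p c) x -> cB (p w) v (p c) x < 1 ->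
    open_seg v (p w) x.
  move=> hC hB hB1; have s1 := bary_sum D0 x; exists (cA (p w) v (p c) x).
    by apply/andP; split; lra.
  have hB' : cB (p w) v (p c) x = 1 - cA (p w) v (p c) x by lra.
  by rewrite {1}(bary_point D0 x) hC hB' /lerp; congr pair; ring.
have openC x : cA (p w) v (p c) x = 0 -> 0 < cB (p w) v (p c) x -> cB (p w) v (p c) x < 1 ->
    open_seg v (p c) x.
  move=> hA hB hB1; have s1 := bary_sum D0 x; exists (cC (p w) v (p c) x).
    by apply/andP; split; lra.
  have hB' : cB (p w) v (p c) x = 1 - cC (p w) v (p c) x by lra.
  by rewrite {1}(bary_point D0 x) hA hB' /lerp; congr pair; ring.
have [|m [m1 m2 m3 m4]] := wedge_free D0.
  move=> j y yj yA yB yC x xj xA xB xC x0; have s1 := bary_sum D0 x.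
  have [B1|B1] := eqVneq (cB (p w) v (p c) x) 1.
    have xv : x = v by apply: ptB => //; lra.
    by apply: (no_v j y yj yC); rewrite -xv.
  have B1' : cB (p w) v (p c) x < 1 by rewrite lt_neqAle B1; lra.
  move/eqP: x0; rewrite mulf_eq0 => /orP[]/eqP h.
    have := prim_edge_line sp pc (openC x h xB B1') xj yj => o.
    by move: yA; rewrite /cA -orient_rot o mul0r ltxx.
  have := prim_edge_line sp pw (openA x h xB B1') xj yj => o.
  by move: yC; rewrite /cC (orient_swap v) o oppr0 mul0r ltxx.
have off_tri : m = c -> forall y, 0 < cA (p w) v (p c) y -> 0 < cB (p w) v (p c) y ->
     0 < cC (p w) v (p c) y -> off P y.
  move=> mc y yA yB yC; apply: m4 => //.
  by rewrite mc b3 c3 mulr0 mulr1.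
have [mc|mc] := eqVneq m c.
  apply: (tri_sees sp D0) => y yA yB yC; split; first exact: off_tri.
  apply: (good_ray gd g0); first by rewrite -/G GE mulr_gt0.
  move=> s s0 s1; apply: off_tri => //.
  - by rewrite cA_lerp a2 mulr0 add0r mulr_gt0.
  - by rewrite cB_lerp b2; apply: conv_gt0 => //; exact: ltW.
  by rewrite cC_lerp c2 mulr0 add0r mulr_gt0.
have s1 := bary_sum D0 (p m).
have mA : 0 < cA (p w) v (p c) (p m).
  rewrite lt_neqAle m1 andbT; apply/eqP => h; rewrite -h in s1.
  have [B0|B0] := eqVneq (cB (p w) v (p c) (p m)) 0.
    have /(p_inj sp)/eqP : p m = p c.
      rewrite (bary_point D0 (p m)) -h B0.
      have -> : cC (p w) v (p c) (p m) = 1 by lra.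
      by rewrite !mul0r !add0r !mul1r -surjective_pairing.
    by rewrite (negPf mc).
  have B0' : 0 < cB (p w) v (p c) (p m) by rewrite lt_neqAle eq_sym B0.
  by have /(prim_vertex sp pc)/(_ erefl) : open_seg v (p c) (p m) by apply: openC => //; lra.
have ray : forall s, 0 < s -> s < 1 -> off P (lerp v (p m) s).
  by apply: (wedge_ray D0) => //; rewrite ?a2 ?b2 //; right.
have gm : 0 < G (p m) by rewrite GE mulr_gt0.
have /cmin/(_ gm) := good_prim gd g0 gm ray.
rewrite leNgt (GE (p m)) gtr_pMl //; have -> // : cC (p w) v (p c) (p m) < 1 by lra.
Qed.

Lemma ray_far x y (M : R) : x != y -> exists2 T, 1 < T &
  M < `|(lerp x y T).1| + `|(lerp x y T).2|.
Proof.
move=> xy; pose d1 := y.1 - x.1; pose d2 := y.2 - x.2.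
have dpos : 0 < `|d1| + `|d2|.
  rewrite lt_neqAle addr_ge0 // andbT eq_sym paddr_eq0 //.
  apply/negP => /andP[/eqP/normr0_eq0 h1 /eqP/normr0_eq0 h2].
  by have := sqd_gt0 xy; rewrite /sqd -/d1 -/d2 h1 h2 expr0n /= addr0 ltxx.
pose K := `|M| + `|x.1| + `|x.2|.
have K0 : 0 <= K by rewrite !addr_ge0.
pose T := (K + 1) / (`|d1| + `|d2|) + 1 + 1.
have Tp : 0 < (K + 1) / (`|d1| + `|d2|) by rewrite divr_gt0 //; lra.
have T1 : 1 < T by rewrite /T; lra.
have h3 : K + 1 < T * (`|d1| + `|d2|).
  have -> : T * (`|d1| + `|d2|) = K + 1 + 2 * (`|d1| + `|d2|).
    by rewrite /T; field; rewrite gt_eqF.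
  by lra.
exists T => //; clearbody T.
have -> : (lerp x y T).1 = T * d1 - (- x.1) by rewrite /lerp /d1 /=; ring.
have -> : (lerp x y T).2 = T * d2 - (- x.2) by rewrite /lerp /d2 /=; ring.
have h1 := lerB_dist (T * d1) (- x.1); have h2 := lerB_dist (T * d2) (- x.2).
rewrite !normrN !normrM (gtr0_norm (lt_trans ltr01 T1)) in h1 h2.
by have := ler_norm M; move: h3; rewrite /K mulrDr; lra.
Qed.

(** Far along the ray the parity is even, so it cannot stay off the boundary. *)
Lemma inside_ray x y e : x != y -> 0 < e < 1 -> off P (lerp x y e) ->
  parity P (lerp x y e) -> exists th, [/\ e < th, boundary p (lerp x y th) &
    forall s, e <= s -> s < th -> off P (lerp x y s)].
Proof.
move=> xy /andP[e0 e1] fq pq; have [M hM] := far_outside (cyclicP p).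
have [T T1 /hM[fF pF]] := ray_far M xy.
have [|t [t0 t1 nh bef]] := first_hit (@nondeg_edges _ _ _ sp predT) fq (w := lerp x y T).
  by move=> fs; move: pF; rewrite -(parity_free (cyclicP p) fs) pq.
have d0 : 0 < T - e by lra.
exists ((1 - t) * e + t * T); split.
- rewrite -subr_gt0; have -> : (1 - t) * e + t * T - e = t * (T - e) by ring.
  exact: mulr_gt0.
- by rewrite -lerp_lerp; apply: contrapT => nb; apply: nh; apply/offP.
move=> s es sth; have := bef ((s - e) / (T - e)); rewrite lerp_lerp.
have -> : (1 - (s - e) / (T - e)) * e + (s - e) / (T - e) * T = s.
  by field; rewrite gt_eqF.
apply; first by apply: divr_ge0; lra.
by rewrite ltr_pdivrMr //; lra.
Qed.

(** The perpendicular at [v] into the good side first hits an edge at [h]. With [c] an end of that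
    edge, the vertex of smallest angle with [vh] in the triangle [v h c] is visible from [v]. *)
Lemma tee_exists a b i : good p a b i -> orient (p a) (p b) (pS i) = 0 ->
  p a != p b -> exists c, prim p (ordS i) c /\ 0 < orient (p a) (p b) (p c).
Proof.
move=> gd g0 ab; set v := pS i; set G := orient (p a) (p b) in g0 *.
case: (gd) => r r0 hr; pose N := normal (p a) (p b) v.
have S0 : 0 < sqd (p a) (p b) by exact: sqd_gt0.
have GN : G N = sqd (p a) (p b) by rewrite /G orient_normal -/G g0 add0r.
have GNs s : G (lerp v N s) = s * sqd (p a) (p b).
  by rewrite /G orient_lerp -/G g0 GN mulr0 add0r.
have [e /andP[e0 e1] he] := lerp_close v N r0.
have near s : 0 < s -> s <= e -> off P (lerp v N s) /\ parity P (lerp v N s).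
  move=> s0 se; apply: hr; first by apply: he; rewrite ltW.
  by rewrite -/G GNs mulr_gt0.
have [fq pq] := near e e0 (lexx e).
have vN : v != N by apply/eqP => e'; move: GN; rewrite -e' g0; lra.
have e01 : 0 < e < 1 by rewrite e0.
have [th [eth nh bef]] := inside_ray vN e01 fq pq.
have th0 : 0 < th by lra.
have before s : 0 < s -> s < th -> off P (lerp v N s).
  move=> s0 sth; have [se|es] := leP s e; first by case: (near s).
  by apply: bef => //; exact: ltW.
set h := lerp v N th in nh.
have fh s : 0 < s -> s < 1 -> off P (lerp v h s).
  move=> s0 s1; rewrite lerp_lerpl; apply: before; first exact: mulr_gt0.
  by rewrite gtr_pMl.
have gh : 0 < G h by rewrite GNs mulr_gt0.
have [k hk] := nh.
have [[c hc]|[f f01 hE]] := open_or_vertex hk.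
  exists c; rewrite -/G -hc; split=> //; apply: (good_prim gd g0); rewrite -hc //.
(* An end no lower than [h] keeps the whole triangle, apart from [v], at positive height. *)
have [c [c' [ckk cE]]] : exists c c', 
    ((c = k /\ c' = ordS k) \/ (c = ordS k /\ c' = k)) /\ G h <= G (p c).
  have [l|l] := leP (G h) (G (p k)); first by exists k, (ordS k); split=> //; left.
  exists (ordS k), k; split; first by right.
  rewrite leNgt; apply/negP => l'; case/andP: f01 => f0 f1.
  have := @conv_gt0 R (G h - G (p k)) (G h - G (pS k)) f (ltW f0) (ltW f1).
  have : G h = (1 - f) * G (p k) + f * G (pS k) by rewrite hE /G orient_lerp.
  lra.
have kk := edge_neq sp k; have cc' : p c != p c'.
  by case: ckk => -[-> ->] //; rewrite eq_sym.
have onk x : on_seg (p c) (p c') x -> on_seg (p k) (pS k) x.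
  by case: ckk => -[-> ->] // /on_segC.
have onk' x : on_seg (p k) (pS k) x -> on_seg (p c) (p c') x.
  by case: ckk => -[-> ->] // /on_segC.
have [f' /andP[f0' f1'] hE'] : exists2 f', 0 < f' < 1 & h = lerp (p c) (p c') f'.
  case/andP: f01 => f0 f1; case: ckk => -[-> ->]; first by exists f => //; rewrite f0.
  exists (1 - f); last by rewrite -lerpC.
  by apply/andP; split; lra.
have gc : 0 < G (p c) by lra.
(* An edge along the perpendicular has its other end [c'] below [h], so it would have been met
   before [h]. *)
have D0 : orient v h (p c) != 0.
  apply/eqP => o.
  have oh : orient v N h = 0 by rewrite /h orient_lerp orient_aba orient_abb; ring.
  have oc : orient v N (p c) = 0.
    have : orient v h (p c) = th * orient v N (p c).
      by rewrite /h /orient /lerp /=; ring.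
    by rewrite o => /esym/eqP; rewrite mulf_eq0 gt_eqF //= => /eqP.
  have oc' : orient v N (p c') = 0.
    move: oh; rewrite hE' orient_lerp oc mulr0 add0r => /eqP.
    by rewrite mulf_eq0 gt_eqF //= => /eqP.
  have pc := projK vN oc; have pc' := projK vN oc'.
  set l := proj _ _ _ in pc; set l' := proj _ _ _ in pc'.
  have thE : th = (1 - f') * l + f' * l'.
    by apply: (lerp_inj vN); rewrite -/h hE' pc pc' lerp_lerp.
  have ll : l <> l' by move=> e'; move/eqP: cc'; rewrite pc pc' e'.
  have lth : th <= l.
    by move: cE; rewrite pc !GNs ler_pM2r.
  have lth' : l' < th.
    have [//|h1] := ltP l' th; exfalso; apply: ll.
    have h2 : (1 - f') * (l - th) + f' * (l' - th) = 0 by rewrite thE; ring.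
    have h3 : 0 <= (1 - f') * (l - th) by rewrite mulr_ge0 //; lra.
    have h4 : 0 <= f' * (l' - th) by rewrite mulr_ge0 //; lra.
    have /eqP : (1 - f') * (l - th) = 0 by lra.
    rewrite mulf_eq0 gt_eqF ?subr_gt0 //= => /eqP h5.
    have /eqP : f' * (l' - th) = 0 by lra.
    by rewrite mulf_eq0 gt_eqF //= => /eqP h6; lra.
  pose s := Num.max l' (th / 2).
  have s0 : 0 < s by rewrite lt_max; apply/orP; right; lra.
  have s1 : s < th by rewrite gt_max lth'; lra.
  have sl : l' <= s by rewrite le_max lexx.
  have /off_edges/(_ k isT) := before s s0 s1; apply; apply: onk.
  rewrite pc pc'; apply: on_seg_lerp3; right; lra.
have [[a1 b1 c1] [[a2 b2 c2] [a3 b3 c3]]] := bary_vertices D0.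
have GE z : G z = cB v h (p c) z * G h + cC v h (p c) z * G (p c).
  have lin : G z = cA v h (p c) z * G v + cB v h (p c) z * G h + cC v h (p c) z * G (p c).
    have s1 := bary_sum D0 z.
    have -> : cA v h (p c) z = 1 - cB v h (p c) z - cC v h (p c) z by lra.
    rewrite {1}(bary_point D0 z).
    have -> : cA v h (p c) z = 1 - cB v h (p c) z - cC v h (p c) z by lra.
    by rewrite /G /orient /=; ring.
  by rewrite lin g0 mulr0 add0r.
have [|m [m1 m2 m3 m4]] := wedge_free D0.
  move=> j y yj yA yB yC x xj xA xB xC x0; have s1 := bary_sum D0 x.
  have jk_absurd : j = k -> False.
    move=> jk; rewrite jk in yj.
    have oy : orient (p c) (p c') y = 0 by apply: orient_on_seg; exact: onk'.
    have oh : orient (p c) (p c') h = 0 by apply: orient_on_seg; exact: onk'.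
    have := collinear3 cc' oy oh (orient_aba (p c) (p c')) => o.
    by move: yA; rewrite /cA o mul0r ltxx.
  have onk_jk l : 0 < l -> l < 1 -> x = lerp (p c) (p c') l -> False.
    move=> l0 l1 xE; apply: jk_absurd; apply/eqP/negPn/negP => jk.
    have : exists2 l', 0 < l' < 1 & x = lerp (p k) (pS k) l'.
      case: ckk xE => -[-> ->] xE; first by exists l => //; rewrite l0.
      by exists (1 - l); [apply/andP; split; lra | rewrite -lerpC].
    move=> [l' l01' xE'].
    by have /off_edges/(_ j jk) := open_edge_off sp (i := k) l01'; rewrite -xE'.
  have [A0|A0] := eqVneq (cA v h (p c) x) 0.
    apply: (onk_jk (cB v h (p c) x * f')); first exact: mulr_gt0.
      by apply: le_lt_trans f1'; rewrite ger_pMl //; lra.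
    rewrite -lerp_lerpl -hE' {1}(bary_point D0 x) A0.
    have -> : cC v h (p c) x = 1 - cB v h (p c) x by lra.
    by rewrite /lerp; congr pair; ring.
  have C0 : cC v h (p c) x = 0 by move/eqP: x0; rewrite mulf_eq0 (negPf A0) => /eqP.
  have A1 : 0 < cA v h (p c) x by rewrite lt_neqAle eq_sym A0.
  have B1 : cB v h (p c) x < 1 by lra.
  have /off_edges/(_ j isT) := fh (cB v h (p c) x) xB B1; apply.
  suff -> : lerp v h (cB v h (p c) x) = x by [].
  rewrite [RHS](bary_point D0 x) C0.
  have -> : cA v h (p c) x = 1 - cB v h (p c) x by lra.
  by rewrite /lerp; congr pair; ring.
have gm : 0 < G (p m).
  rewrite GE; apply: ltr_wpDl; last exact: mulr_gt0.
  by rewrite mulr_ge0 // ltW.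
have sm : sees p v (p m).
  apply: (sees_intro sp) => z zs fz.
  case: (on_open_seg zs) => [e'|e'|s /andP[s0 s1] zE].
  - by rewrite e' in fz; case: (vertex_not_off fz).
  - by rewrite e' in fz; case: (vertex_not_off fz).
  have [l /andP[l0 l1] fl] := off_near h (@nondeg_edges _ _ _ sp _) fz.
  rewrite (parity_free (cyclicP p) fl); set z' := lerp z h l.
  have zA : 0 < cA v h (p c) z'.
    rewrite cA_lerp zE cA_lerp a1 a2 mulr0 addr0 mulr_gt0 ?subr_gt0 //.
    by apply: conv_gt0l => //; exact: ltW.
  have zBC : cB v h (p c) z' = (1 - l) * (s * cB v h (p c) (p m)) + l.
    by rewrite cB_lerp zE cB_lerp b1 b2; ring.
  have zCC : cC v h (p c) z' = (1 - l) * (s * cC v h (p c) (p m)).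
    by rewrite cC_lerp zE cC_lerp c1 c2; ring.
  have zB : 0 < cB v h (p c) z'.
    rewrite zBC; apply: ltr_wpDl => //.
    by apply: mulr_ge0; [lra|apply: mulr_ge0 => //; exact: ltW].
  have zC : 0 < cC v h (p c) z'.
    by rewrite zCC; apply: mulr_gt0; [rewrite subr_gt0 | exact: mulr_gt0].
  apply: (good_ray gd g0).
    by rewrite -/G GE addr_gt0 // mulr_gt0.
  move=> g g0' g1'; apply: m4.
  - by rewrite cA_lerp a1; apply: conv_gt0 => //; exact: ltW.
  - by rewrite cB_lerp b1 mulr0 add0r mulr_gt0.
  - by rewrite cC_lerp c1 mulr0 add0r mulr_gt0.
  rewrite cB_lerp cC_lerp b1 c1 !mulr0 !add0r zBC zCC -subr_gt0.
  set X := (X in 0 < X).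
  have -> : X = g * l * cC v h (p c) (p m) by rewrite /X; ring.
  by apply: mulr_gt0 => //; exact: mulr_gt0.
have im : ordS i != m by apply/eqP => e'; move: gm; rewrite -e' g0 ltxx.
have [k' [ks' pk']] := prim_first sp im sm.
exists k'; split=> //; case: ks' => s [s0 [s1 kE]].
have [ik' _ _] := pk'.
rewrite -/G kE /G orient_lerp -/G -/v g0 mulr0 add0r mulr_gt0 // lt_neqAle s0 andbT eq_sym.
by apply/eqP => s00; move: kE; rewrite s00 lerp0 => /(p_inj sp)/eqP; rewrite eq_sym (negPf ik').
Qed.

Lemma tee_K4 a b m : a != b -> prim p m a -> prim p m b ->
  open_seg (p a) (p b) (p m) -> sees p (p a) (p b) -> has_K4 p.
Proof.
have -> : m = ordS (ord_pred m) by rewrite ord_predK.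
move: (ord_pred m) => i ab pa pb ov sab.
wlog gd : a b ab pa pb ov sab / good p a b i.
  move=> H; have [gd|gd] := good_side sp ab pa pb ov; first exact: (H a b).
  apply: (H b a) => //; [by rewrite eq_sym | exact: open_segC | exact: seesC].
have g0 : orient (p a) (p b) (pS i) = 0 by apply: orient_on_seg; exact: open_seg_on.
have [c0 [pc0 gc0]] := tee_exists gd g0 (vertex_neq sp ab).
pose Q := [pred c | `[< prim p (ordS i) c >] && (0 < orient (p a) (p b) (p c))].
have Q0 : Q c0 by rewrite /Q /= gc0 andbT; apply/asboolP.
case: (arg_minP (fun c => orient (p a) (p b) (p c)) Q0) => c /andP[/asboolP pc gc] cmin.
have cmin' c' : prim p (ordS i) c' -> 0 < orient (p a) (p b) (p c') ->
     orient (p a) (p b) (p c) <= orient (p a) (p b) (p c').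
  by move=> pc' gc'; apply: cmin; rewrite /Q /= gc' andbT; apply/asboolP.
case: (ov) => tau /andP[tau0 tau1] vE.
(* As [v = lerp a b tau], the factor [kap] is [tau] at [a] and [tau - 1] at [b]; the same lowest
   neighbour [c] serves both ends. *)
have sac : sees p (p a) (p c).
  apply: (tee_sees (kap := tau) gd g0 _ _ pa pc gc cmin'); first by rewrite gt_eqF.
  by move=> z; rewrite vE /orient /lerp /=; ring.
have sbc : sees p (p b) (p c).
  apply: (tee_sees (kap := tau - 1) gd g0 _ _ pb pc gc cmin'); first by rewrite lt_eqF // subr_lt0.
  by move=> z; rewrite vE /orient /lerp /=; ring.
case: pa pb pc => [ia sa _] [ib sb _] [ic sc _].
apply: (@has_K4_intro _ _ _ a b (ordS i) c) => //; try exact: seesC.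
rewrite /= !inE !negb_or ab ic (eq_sym a) (eq_sym b) ia ib /= andbT.
by apply/andP; split; apply/eqP => e; move: gc; rewrite e ?orient_aba ?orient_abb ltxx.
Qed.

(** Around an inner vertex [m] of the segment, the nearest vertices [a] and [b] in both directions
    form primitive pairs with it. *)
Lemma nonprim_K4 i j : i != j -> sees p (p i) (p j) -> ~ prim p i j -> has_K4 p.
Proof.
move=> ij sij np.
have [m [mi mj ms]] : exists m, [/\ m != i, m != j & on_seg (p i) (p j) (p m)].
  apply: contrapT => h; apply: np; split=> // k ks.
  have [->|ki] := eqVneq k i; [by left|right].
  by apply/eqP/negPn/negP => kj; apply: h; exists k.
have smi : sees p (p m) (p i) by apply: seesC; exact: sees_sub sij (on_segl _ _) ms.
have smj : sees p (p m) (p j) by exact: sees_sub sij ms (on_segr _ _).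
have [a [as_ pa]] := prim_first sp mi smi; have [b [bs pb]] := prim_first sp mj smj.
have nij := vertex_neq sp ij.
have [t /andP[t0 t1] mE] : open_seg (p i) (p j) (p m).
  by apply: on_open_seg => // /(p_inj sp)/eqP; rewrite ?(negPf mi) ?(negPf mj).
have [la [la0 [la1 aE]]] := as_; have [lb [lb0 [lb1 bE]]] := bs.
have la_gt0 : 0 < la.
  rewrite lt_neqAle la0 andbT; apply/eqP => e; move: aE; rewrite -e lerp0 => /(p_inj sp).
  by move=> ea; case: pa => /eqP; rewrite ea.
have lb_gt0 : 0 < lb.
  rewrite lt_neqAle lb0 andbT; apply/eqP => e; move: bE; rewrite -e lerp0 => /(p_inj sp).
  by move=> eb; case: pb => /eqP; rewrite eb.
have aE' : p a = lerp (p i) (p j) (t * (1 - la)).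
  by rewrite aE mE /lerp /=; congr pair; ring.
have bE' : p b = lerp (p i) (p j) (t + (1 - t) * lb).
  by rewrite bE mE /lerp /=; congr pair; ring.
have h1 : 0 < t * la by rewrite mulr_gt0.
have h2 : 0 < (1 - t) * lb by rewrite mulr_gt0 // subr_gt0.
have ab : a != b.
  by apply/eqP => e; move: aE'; rewrite e bE' => /(lerp_inj nij); lra.
have D0 : 0 < t * la + (1 - t) * lb by rewrite addr_gt0.
apply: (tee_K4 ab pa pb).
  exists (t * la / (t * la + (1 - t) * lb)).
    rewrite divr_gt0 //= ltr_pdivrMr // mul1r ltrDl //.
  rewrite aE' bE' lerp_lerp mE; congr lerp; field; rewrite gt_eqF //.
apply: sees_sub sij _ _; first by apply: on_seg_sub as_ => //; exact: on_segl.
by apply: on_seg_sub bs => //; exact: on_segr.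
Qed.

End Tee.

(** * Interleaved chords *)

Section Interleave.
Variables (R : realType) (n : nat) (p : 'I_n -> R * R).
Hypothesis sp : simple_polygon p.
Implicit Types (x y z u v q : R * R) (t s r e f : R) (i j k m : 'I_n).
Variables a b c d : 'I_n.
Hypotheses (ac : (a < c)%N) (cb : (c < b)%N) (bd : (b < d)%N).
Hypotheses (pab : prim p a b) (pcd : prim p c d).

Notation P := (edges p predT).
Notation pS i := (p (ordS i)).

(** Edges are indexed by their first vertex, so the path from [a] to [b] is a half-open range. *)
Definition arc : pred 'I_n := [pred i : 'I_n | (a <= i)%N && (i < b)%N].
Definition half1 := (p a, p b) :: edges p arc.
Definition half2 := (p a, p b) :: edges p (predC arc).

Lemma val_ordS i : (i.+1 < n)%N -> ordS i = i.+1 :> nat.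
Proof. by move=> h; rewrite /= modn_small. Qed.

Lemma ordS_val i j : ordS i = j -> (0 < j)%N -> j = i.+1 :> nat.
Proof.
move=> <- /=; have := ltn_ord i; rewrite leq_eqVlt => /orP[/eqP ->|h].
  by rewrite modnn.
by rewrite modn_small.
Qed.

(** The chord belongs to both halves and cancels. *)
Lemma parity_halves z : parity P z = parity half1 z (+) parity half2 z.
Proof.
rewrite /parity /half1 /half2 !big_cons !big_edges addbACA addbb addFb.
by rewrite (bigID arc).
Qed.

Lemma arc_telescope (g : R * R -> bool) :
  \big[addb/false]_(i | arc i) (g (p i) (+) g (pS i)) = g (p a) (+) g (p b).
Proof.
have ltb := ltn_ord b; have ab : (a < b)%N by lia.
have lt0 : (0 < n)%N by lia.
pose G (l : nat) := g (p (insubd (Ordinal lt0) l)).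
have GE (i : 'I_n) : G i = g (p i) by rewrite /G valKd.
have GS (i : 'I_n) : (i < b)%N -> g (pS i) = G i.+1.
  by move=> ib; rewrite -GE val_ordS //; lia.
transitivity (\big[addb/false]_(a <= l < b) (G l (+) G l.+1)).
  rewrite big_geq_mkord /=.
  rewrite (big_ord_widen_cond n (fun l => (a <= l)%N) (fun l => G l (+) G l.+1)) 1?ltnW //.
  by apply: eq_bigr => i /andP[_ ib]; rewrite GE -GS.
rewrite (telescope_big (fun l l' => G l (+) G l')) ?ab ?GE // => l _.
by case: (g (p a)); case: (G l); case: (G l.+1).
Qed.

Lemma cyclic1 : cyclic half1.
Proof.
by move=> g; rewrite /half1 big_cons big_edges /= arc_telescope addbb.
Qed.

Lemma cyclic2 : cyclic half2.
Proof.
move=> g; have := cyclicP p g; rewrite !big_edges (bigID arc) /= arc_telescope => h.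
by rewrite /half2 big_cons big_edges /=.
Qed.

Lemma chord_free x : open_seg (p a) (p b) x -> off P x.
Proof.
apply: (prim_chord sp pab) => e.
  by have := ordS_val (esym e); lia.
by have := ltn_ord d; have := @val_ordS b; rewrite -e; lia.
Qed.

Lemma arc_ends i j : arc i -> ~~ arc j -> (ordS j = i -> i = a) /\ (ordS i = j -> j = b).
Proof.
rewrite /arc /= => /andP[ai ib]; rewrite negb_and -!leqNgt -ltnNge => nj.
have := ltn_ord b; have := ltn_ord d; split=> e; apply: val_inj => /=.
  case: (posnP i) => [i0|/(ordS_val e)]; lia.
have := @val_ordS i; rewrite e /=; lia.
Qed.

(** Edges of different arcs meet only at [p a] and [p b], and the open chord is free of boundary
    points. *)
Lemma off_half1 i x : ~~ arc i -> on_seg (p i) (pS i) x -> x <> p a -> x <> p b -> off half1 x.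
Proof.
move=> ai xi xa xb e; rewrite inE => /orP[/eqP -> /= h|/mem_edges[k ak ->] /= xk].
  by have /off_edges/(_ i isT) := chord_free (on_open_seg h xa xb).
have ik : i != k by apply/eqP => ik; move: ai; rewrite ik ak.
have [h1 h2] := arc_ends ak ai.
by case: (edges_meet sp ik xi xk) => -[e1 e2]; [apply: xa; rewrite -h1|apply: xb; rewrite -h2].
Qed.

Lemma off_half2 i x : arc i -> on_seg (p i) (pS i) x -> x <> p a -> x <> p b -> off half2 x.
Proof.
move=> ai xi xa xb e; rewrite inE => /orP[/eqP -> /= h|/mem_edges[k ak ->] /= xk].
  by have /off_edges/(_ i isT) := chord_free (on_open_seg h xa xb).
have ik : i != k by apply/eqP => ik; move: ak; rewrite /= -ik ai.
have [h1 h2] := arc_ends ai ak.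
by case: (edges_meet sp ik xi xk) => -[e1 e2]; [apply: xb; rewrite -h2|apply: xa; rewrite -h1].
Qed.

Lemma sub_edge i x y k z : on_seg (p i) (pS i) x -> x <> p k -> y = p i \/ y = pS i ->
  y <> p k -> on_seg x y z -> z <> p k.
Proof.
move=> xi xk yE yk zs zk; have ii := edge_neq sp i.
have ys : on_seg (p i) (pS i) y by case: yE => ->; [exact: on_segl|exact: on_segr].
have := on_seg_sub xi ys zs; rewrite zk => /(vertex_on_edge sp) kE.
case: xi => t [t0 [t1 xE]]; case: zs => e [e0 [e1 zE]].
case: kE => kE; case: yE => yE; rewrite kE in xk yk zk.
- by rewrite yE in yk.
- have tp : 0 < t.
    by rewrite lt_neqAle t0 andbT; apply/eqP => e'; apply: xk; rewrite xE -e' lerp0.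
  move: zE; rewrite zk xE yE lerp_lerpr -{1}(lerp0 (p i) (pS i)) => /(lerp_inj ii).
  by have := @conv_gt0 R t 1 e e0 e1 tp ltr01; lra.
- have tp : 0 < 1 - t.
    by rewrite subr_gt0 lt_neqAle t1 andbT; apply/eqP => e'; apply: xk; rewrite xE e' lerp1.
  move: zE; rewrite zk xE yE -{2}(lerp0 (p i) (pS i)) lerp_lerp -{1}(lerp1 (p i) (pS i)).
  move=> /(lerp_inj ii).
  by have := @conv_gt0 R (1 - t) 1 e e0 e1 tp ltr01; lra.
by rewrite yE in yk.
Qed.

Lemma edge_parity i x (E : seq ((R * R) * (R * R))) k : cyclic E ->
  (forall z, on_seg (p i) (pS i) z -> z <> p a -> z <> p b -> off E z) ->
  on_seg (p i) (pS i) x -> x <> p a -> x <> p b ->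
  k = i \/ k = ordS i -> k != a -> k != b -> parity E x = parity E (p k).
Proof.
move=> cE fE xi xa xb ki ka kb; apply: parity_free => // z zs.
have kE : p k = p i \/ p k = pS i by case: ki => ->; [left|right].
have ks : on_seg (p i) (pS i) (p k) by case: kE => ->; [exact: on_segl|exact: on_segr].
apply: fE; first exact: on_seg_sub zs.
  by apply: (sub_edge xi xa kE _ zs) => /(p_inj sp)/eqP; rewrite (negPf ka).
by apply: (sub_edge xi xb kE _ zs) => /(p_inj sp)/eqP; rewrite (negPf kb).
Qed.

(** The edges between inner vertices avoid [half2], so parity is carried from vertex to vertex,
    starting at [ordS a]. *)
Lemma inner_parity m : (a < m)%N -> (m < b)%N -> parity half2 (p m) = parity half2 (p c).
Proof.
suff step (k : nat) (hk : (k < n)%N) : (a < k)%N -> (k < b)%N ->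
    parity half2 (p (Ordinal hk)) = parity half2 (p (ordS a)).
  move=> am mb; have -> : m = Ordinal (ltn_ord m) by apply: val_inj.
  have -> : c = Ordinal (ltn_ord c) by apply: val_inj.
  by rewrite !step.
elim: k hk => // k IH hk ak kb; have hk' : (k < n)%N by lia.
have Sk : Ordinal hk = ordS (Ordinal hk') by apply: val_inj; rewrite /= modn_small.
have [ka|ka] := ltnP a k; last first.
  by congr (parity _ (p _)); rewrite Sk; congr ordS; apply: val_inj => /=; lia.
rewrite -(IH hk') //; last by lia.
apply/esym; apply: (@edge_parity (Ordinal hk')) => //.
- exact: cyclic2.
- by move=> z; apply: off_half2; rewrite /arc /=; lia.
- exact: on_segl.
- by move/(p_inj sp)/(congr1 val) => /=; lia.
- by move/(p_inj sp)/(congr1 val) => /=; lia.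
- by right.
- by apply/eqP => /(congr1 val) /=; lia.
by apply/eqP => /(congr1 val) /=; lia.
Qed.

Lemma outer_step (i : 'I_n) : (i < a)%N || (b < i)%N ->
  (ordS i < a)%N || (b < ordS i)%N -> parity half1 (p i) = parity half1 (pS i).
Proof.
move=> hi hS; apply: (@edge_parity i) => //.
- exact: cyclic1.
- by move=> z; apply: off_half1; rewrite /arc /=; lia.
- exact: on_segl.
- by move/(p_inj sp) => e; move: hi; rewrite e; lia.
- by move/(p_inj sp) => e; move: hi; rewrite e; lia.
- by right.
- by apply/eqP => e; move: hS; rewrite e; lia.
by apply/eqP => e; move: hS; rewrite e; lia.
Qed.

(** The outer vertices form two runs of indices, linked by the edge from [n - 1] to 0. *)
Lemma outer_parity m : (m < a)%N || (b < m)%N -> parity half1 (p m) = parity half1 (p d).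
Proof.
have ltd := ltn_ord d.
have right_ (k : nat) (hk : (k < n)%N) : (b < k)%N ->
    parity half1 (p (Ordinal hk)) = parity half1 (p (ordS b)).
  elim: k hk => // k IH hk bk; have hk' : (k < n)%N by lia.
  have Sk : Ordinal hk = ordS (Ordinal hk') by apply: val_inj; rewrite /= modn_small.
  have [kb|kb] := ltnP b k; last first.
    by congr (parity _ (p _)); rewrite Sk; congr ordS; apply: val_inj => /=; lia.
  rewrite -(IH hk') // Sk; apply/esym/outer_step; first by rewrite /= kb orbT.
  by rewrite -Sk /= bk orbT.
have dE : parity half1 (p d) = parity half1 (p (ordS b)).
  by rewrite -(right_ d ltd bd); congr (parity _ (p _)); apply: val_inj.
have h0 : (0 < n)%N by lia.
have left_ (k : nat) (hk : (k < n)%N) : (k < a)%N ->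
    parity half1 (p (Ordinal hk)) = parity half1 (p (Ordinal h0)).
  elim: k hk => [|k IH] hk ka; first by congr (parity _ (p _)); apply: val_inj.
  have hk' : (k < n)%N by lia.
  have Sk : Ordinal hk = ordS (Ordinal hk') by apply: val_inj; rewrite /= modn_small.
  rewrite -(IH hk'); last by lia.
  rewrite Sk; apply/esym/outer_step; first by rewrite /=; lia.
  by rewrite -Sk /= ka.
rewrite dE => /orP[ma|bm]; last first.
  by rewrite -(right_ m (ltn_ord m)) //; congr (parity _ (p _)); apply: val_inj.
have -> : m = Ordinal (ltn_ord m) by apply: val_inj.
rewrite left_ //; have hl : (n.-1 < n)%N by lia.
have Sl : Ordinal h0 = ordS (Ordinal hl) by apply: val_inj; rewrite /= prednK // modnn.
rewrite -(right_ _ hl); last by lia.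
rewrite Sl; apply/esym/outer_step; first by rewrite /=; lia.
by rewrite -Sl /=; lia.
Qed.

Lemma outer_const i x : ~~ arc i -> on_seg (p i) (pS i) x -> x <> p a -> x <> p b ->
  parity half1 x = parity half1 (p d).
Proof.
move=> ai xi xa xb; have ltd := ltn_ord d.
have Sb : ordS b = b.+1 :> nat by apply: val_ordS; lia.
have [k ki ko] : exists2 k, k = i \/ k = ordS i & (k < a)%N || (b < k)%N.
  have [ib|ib] := eqVneq i b.
    by exists (ordS i); [right | rewrite ib Sb ltnSn orbT].
  exists i; first by left.
  by move: ai ib; rewrite /arc /= -val_eqE /=; lia.
rewrite -(outer_parity ko); apply: (@edge_parity i) => //.
- exact: cyclic1.
- by move=> z; exact: off_half1.
- by apply/eqP => e; move: ko; rewrite e; lia.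
by apply/eqP => e; move: ko; rewrite e; lia.
Qed.

Lemma inner_const i x : arc i -> on_seg (p i) (pS i) x -> x <> p a -> x <> p b ->
  parity half2 x = parity half2 (p c).
Proof.
move=> ai xi xa xb; have ltb := ltn_ord b.
have Sa : ordS a = a.+1 :> nat by apply: val_ordS; lia.
have [k ki [ko1 ko2]] : exists2 k, k = i \/ k = ordS i & (a < k)%N /\ (k < b)%N.
  have [ia|ia] := eqVneq i a.
    by exists (ordS i); [right | rewrite ia Sa; lia].
  exists i; first by left.
  by move: ai ia; rewrite /arc /= -val_eqE /=; lia.
rewrite -(inner_parity ko1 ko2); apply: (@edge_parity i) => //.
- exact: cyclic2.
- by move=> z; exact: off_half2.
- by apply/eqP => e; move: ko1; rewrite e; lia.
by apply/eqP => e; move: ko2; rewrite e; lia.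
Qed.

Lemma off_cons u v (Q : pred 'I_n) z : off P z -> ~ on_seg u v z -> off ((u, v) :: edges p Q) z.
Proof.
move=> /off_edges fz nz e; rewrite inE => /orP[/eqP -> //|/mem_edges[k _ ->]].
exact: fz.
Qed.

(* A ray leaving the chord perpendicularly first hits the boundary on one of
   the two arcs, on which the parity of the opposite half is constant. *)
Lemma side_parity a' b' (s : R * R) e : (a' = a /\ b' = b) \/ (a' = b /\ b' = a) ->
  0 < e < 1 -> on_seg (p a) (p b) s ->
  let q := lerp s (normal (p a') (p b') s) e in
  off P q -> parity P q ->
  parity half1 q = parity half1 (p d) \/ parity half2 q = parity half2 (p c).
Proof.
move=> ab' e01 ss; set N := normal (p a') (p b') s => q fq pq.
have nab : p a != p b by apply: (vertex_neq sp); case: pab.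
have o0 z : on_seg (p a) (p b) z -> orient (p a') (p b') z = 0.
  by move=> /orient_on_seg h; case: ab' => -[-> ->] //; rewrite orient_swap h oppr0.
have S0 : 0 < sqd (p a') (p b').
  by apply: sqd_gt0; case: ab' => -[-> ->] //; rewrite eq_sym.
have oN t : orient (p a') (p b') (lerp s N t) = t * sqd (p a') (p b').
  by rewrite orient_lerp orient_normal (o0 s ss); ring.
have sN : s != N.
  by apply/eqP => h; have := oN 1; rewrite lerp1 -h (o0 s ss); lra.
have nchord t : 0 < t -> ~ on_seg (p a) (p b) (lerp s N t).
  by move=> t0 /o0; rewrite oN; have : 0 < t * sqd (p a') (p b') by [exact: mulr_gt0]; lra.
have [th [eth [k hk] bef]] := inside_ray sp sN e01 fq pq.
case/andP: e01 => e0 e1; have th0 : 0 < th by lra.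
have ha : lerp s N th <> p a by move=> h; apply: (nchord th th0); rewrite h; exact: on_segl.
have hb : lerp s N th <> p b by move=> h; apply: (nchord th th0); rewrite h; exact: on_segr.
have seg E : off E (lerp s N th) ->
    (forall z, off P z -> ~ on_seg (p a) (p b) z -> off E z) -> off_seg E q (lerp s N th).
  move=> fE fz z [t [t0 [t1 ->]]]; rewrite lerp_lerp.
  have l1 : e <= (1 - t) * e + t * th.
    by have := @conv01 R 0 (th - e) t t0 t1; lra.
  have [->//|tn] := eqVneq t 1.
    by have -> : (1 - 1) * e + 1 * th = th by ring.
  have l2 : (1 - t) * e + t * th < th.
    rewrite -subr_gt0; have -> : th - ((1 - t) * e + t * th) = (1 - t) * (th - e) by ring.
    by apply: mulr_gt0; rewrite subr_gt0 // lt_neqAle tn.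
  by apply: fz; [exact: bef|apply: nchord; lra].
have [ak|ak] := boolP (arc k).
  right; rewrite -(inner_const ak hk ha hb); apply: parity_free; first exact: cyclic2.
  apply: seg; first exact: off_half2 hk ha hb.
  by move=> z fz nz; exact: off_cons.
left; rewrite -(outer_const ak hk ha hb); apply: parity_free; first exact: cyclic1.
apply: seg; first exact: off_half1 hk ha hb.
by move=> z fz nz; exact: off_cons.
Qed.

Lemma on_half u v x : on_seg v (lerp u v (1 / 2)) x -> x = v \/ open_seg u v x.
Proof.
move=> [t [t0 [t1 ->]]]; have [->|tn] := eqVneq t 0; first by left; rewrite lerp0.
right; have tp : 0 < t by rewrite lt_neqAle eq_sym tn.
exists (1 - t / 2); first by apply/andP; split; lra.
by rewrite /lerp /=; congr pair; field.
Qed.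

(** If the segments were disjoint, the midpoint of [cd] would have the [half1]-parity of [p d] and
    the [half2]-parity of [p c], and these differ because the midpoint is inside. At inside points
    [q] and [q'] on the two sides of the chord the parities differ as well, so each alternative of
    [side_parity] implies the other; both points would have the [half1]-parity of [p d], although
    the chord separates them. *)
Lemma interleaved_meet : exists2 x, on_seg (p a) (p b) x & on_seg (p c) (p d) x.
Proof.
apply: contrapT => dis.
have {}dis x : on_seg (p a) (p b) x -> ~ on_seg (p c) (p d) x.
  by move=> h1 h2; apply: dis; exists x.
have nca : c != a by rewrite -val_eqE /=; lia.
have ncb : c != b by rewrite -val_eqE /=; lia.
have nda : d != a by rewrite -val_eqE /=; lia.
have ndb : d != b by rewrite -val_eqE /=; lia.
have ltd := ltn_ord d.
have arc_c : arc c by rewrite /arc /=; lia.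
have arc_d : ~~ arc d by rewrite /arc /=; lia.
have free_cd x : open_seg (p c) (p d) x -> off P x.
  apply: (prim_chord sp pcd) => e; first by have := ordS_val (esym e); lia.
  by have := ordS_val (esym e); have := ltn_ord c; lia.
have vne (k l : 'I_n) : k != l -> p k <> p l.
  by move=> kl /(p_inj sp)/eqP; rewrite (negPf kl).
have h12 : 0 < (1 / 2 : R) < 1 by apply/andP; split; lra.
have h12' : 0 <= (1 / 2 : R) /\ (1 / 2 : R) <= 1 by lra.
pose mid := lerp (p c) (p d) (1 / 2).
have om : open_seg (p c) (p d) mid by exists (1 / 2).
have fm := free_cd _ om.
have pm : parity P mid.
  by apply: (sees_parity sp _ (open_seg_on om)) => //; case: pcd.
have X1 : parity half1 mid = parity half1 (p d).
  apply/esym/(parity_free cyclic1) => x /on_half[->|ox].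
    by apply: (@off_half1 d); [|exact: on_segl|exact: vne|exact: vne].
  by apply: off_cons; [exact: free_cd|move=> /dis; apply; exact: open_seg_on].
have X2 : parity half2 mid = parity half2 (p c).
  apply/esym/(parity_free cyclic2) => x; rewrite /mid lerpC.
  have -> : (1 - 1 / 2 : R) = 1 / 2 by lra.
  move=> /on_half[->|/open_segC ox].
    by apply: (@off_half2 c); [|exact: on_segl|exact: vne|exact: vne].
  by apply: off_cons; [exact: free_cd|move=> /dis; apply; exact: open_seg_on].
pose s := lerp (p a) (p b) (1 / 2).
have os : open_seg (p a) (p b) s by exists (1 / 2).
have fs := chord_free os; have ons := open_seg_on os.
have ps : parity P s by apply: (sees_parity sp _ ons) => //; case: pab.
have [r r0 hr] := off_clear (@nondeg_edges _ _ _ sp predT) fs.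
have [f1 /andP[f10 f11] hf1] := lerp_close s (normal (p a) (p b) s) r0.
have [f2 /andP[f20 f21] hf2] := lerp_close s (normal (p b) (p a) s) r0.
pose f := Num.min f1 f2.
have f0 : 0 < f by rewrite lt_min f10.
have [fl1 fl2] : f <= f1 /\ f <= f2 by rewrite /f !ge_min !lexx orbT.
have f01 : 0 < f < 1 by rewrite f0; lra.
set q := lerp s (normal (p a) (p b) s) f; set q' := lerp s (normal (p b) (p a) s) f.
have cq : close r q s by apply: hf1; rewrite ltW.
have cq' : close r q' s by apply: hf2; rewrite ltW.
have cs : close r s s by exact: close_refl.
have pq : parity P q by rewrite -(parity_free (cyclicP p) (hr _ _ cs cq)).
have pq' : parity P q' by rewrite -(parity_free (cyclicP p) (hr _ _ cs cq')).
have fq : off P q by apply: (hr _ _ cq cq); exact: on_segl.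
have fq' : off P q' by apply: (hr _ _ cq' cq'); exact: on_segl.
have os0 : orient (p a) (p b) s = 0 by exact: orient_on_seg.
have flip : parity half1 q = ~~ parity half1 q'.
  apply: (@parity_cross _ _ _ _ _ _ (1 / 2) (1 / 2)) => //.
  - exact: cyclic1.
  - by move=> z zs; apply/off_edges => k _; move/off_edges: (hr _ _ cq cq' z zs); apply.
  - by rewrite -/s /q /q'; move: (s) => -[s1 s2]; rewrite /lerp /normal /=; congr pair; field.
  rewrite /q orient_lerp orient_normal os0 mulr0 !add0r mulf_neq0 ?gt_eqF //.
  by apply: sqd_gt0; apply: (vertex_neq sp); case: pab.
have S1 := side_parity (or_introl (conj erefl erefl)) f01 ons fq pq.
have S2 := side_parity (or_intror (conj erefl erefl)) f01 ons fq' pq'.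
move: pm pq pq' S1 S2; rewrite !parity_halves X1 X2 -/q -/q' flip.
by case: (parity half1 q'); case: (parity half1 (p d)); case: (parity half2 (p c));
  case: (parity half2 q); case: (parity half2 q') => //= _ _ _ [e1|e1] [e2|e2].
Qed.

(** No end of one primitive segment is on the other. In the collinear case [c] and [d] would be off
    [ab]: beyond the same end the segments are disjoint, beyond different ends [cd] contains [a]. *)
Lemma interleaved_cross : cross p a b c d.
Proof.
have [x x1 x2] := interleaved_meet.
have nab : p a != p b by apply: (vertex_neq sp); case: pab.
have [_ _ hab] := pab; have [_ _ hcd] := pcd.
have nv (k l : 'I_n) : k != l -> p k <> p l.
  by move=> kl /(p_inj sp)/eqP; rewrite (negPf kl).
have no_cd k : k = a \/ k = b -> ~ on_seg (p c) (p d) (p k).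
  by move=> kE /hcd; case: kE => -> [] /(congr1 val) /=; lia.
have no_ab k : k = c \/ k = d -> ~ on_seg (p a) (p b) (p k).
  by move=> kE /hab; case: kE => -> [] /(congr1 val) /=; lia.
have ox1 : open_seg (p a) (p b) x.
  by apply: on_open_seg => // e; rewrite e in x2;
    [apply: (@no_cd a); first left|apply: (@no_cd b); first right].
have ox2 : open_seg (p c) (p d) x.
  by apply: on_open_seg => // e; rewrite e in x1;
    [apply: (@no_ab c); first left|apply: (@no_ab d); first right].
split=> //; last by exists x.
apply/eqP => oc; case: ox1 => w /andP[w0 w1] xE; case: ox2 => t /andP[t0 t1] xE'.
have od : orient (p a) (p b) (p d) = 0.
  have := orient_on_seg x1; rewrite xE' orient_lerp oc mulr0 add0r => /eqP.
  by rewrite mulf_eq0 gt_eqF //= => /eqP.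
have cE := projK nab oc; have dE := projK nab od.
move: (proj _ _ _) cE (proj _ _ _) dE => kc cE kd dE.
have wE : w = (1 - t) * kc + t * kd.
  by apply: (lerp_inj nab); rewrite -xE xE' cE dE lerp_lerp.
have outc : kc < 0 \/ 1 < kc.
  have [|h] := ltP kc 0; [by left|right]; rewrite ltNge; apply/negP => h'.
  by apply: (@no_ab c); [left|rewrite cE; exact: on_seg_lerp].
have outd : kd < 0 \/ 1 < kd.
  have [|h] := ltP kd 0; [by left|right]; rewrite ltNge; apply/negP => h'.
  by apply: (@no_ab d); [right|rewrite dE; exact: on_seg_lerp].
have pa_ : (kc <= 0 /\ 0 <= kd) \/ (kd <= 0 /\ 0 <= kc) -> False.
  move=> h; apply: (@no_cd a); first by left.
  by have := on_seg_lerp3 (p a) (p b) h; rewrite lerp0 -cE -dE.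
case: outc outd => hc [] hd.
- have := @conv_gt0 R (- kc) (- kd) t (ltW t0) (ltW t1); lra.
- by apply: pa_; left; lra.
- by apply: pa_; right; lra.
have := @conv_gt0 R (kc - 1) (kd - 1) t (ltW t0) (ltW t1); lra.
Qed.

End Interleave.

(** * Counting noncrossing pairs *)

Section Noncrossing.
Variables (n : nat) (S : {set 'I_n * 'I_n}).
Local Open Scope nat_scope.
Hypothesis S_lt : forall e, e \in S -> e.1 < e.2.
Hypothesis S_nc : forall i j k l : 'I_n, (i, j) \in S -> (k, l) \in S ->
  i < k -> k < j -> j < l -> False.

Definition within (l r : nat) := [set e in S | (l <= e.1) && (e.2 <= r)].

(** Split at the largest partner [e.2 < r] of [l]. A pair reaching over [e.2] either starts after
    [l] and interleaves with [e], or starts at [l] and ends at [r] by maximality. The count is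
    [1 + (2x - 1) + (2y - 1) = 2(x + y) - 1]. *)
Lemma card_within (l r : nat) : l < r -> #|within l r| <= 2 * (r - l) - 1.
Proof.
have [m] := ubnP (r - l); elim: m l r => // m IH l r rlm lr.
have pair_eq (e : 'I_n * 'I_n) (i j : 'I_n) : e.1 = i :> nat -> e.2 = j :> nat -> e = (i, j).
  by case: e => e1 e2 /= /val_inj -> /val_inj ->.
have sub1 : #|[set e in S | (e.1 == l :> nat) && (e.2 == r :> nat)]| <= 1.
  apply/card_le1_eqP => f e.
  rewrite !inE => /andP[_ /andP[/eqP e1 /eqP e2]] /andP[_ /andP[/eqP f1 /eqP f2]].
  by rewrite (pair_eq e f.1 f.2) -?surjective_pairing // ?e1 ?f1 ?e2 ?f2.
case: (boolP [exists e in S, (e.1 == l :> nat) && (e.2 < r)]) => [|none].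
  case/existsP => e0 /andP[e0S /andP[/eqP e01 e0r]].
  pose Q (e : 'I_n * 'I_n) := (e \in S) && (e.1 == l :> nat) && (e.2 < r).
  have Q0 : Q e0 by rewrite /Q e0S e01 eqxx e0r.
  case: (arg_maxnP (fun e : 'I_n * 'I_n => e.2 : nat) Q0) => e.
  move=> /andP[/andP[eS /eqP el] er] emax.
  have e12 : l < e.2 by rewrite -el; exact: S_lt.
  have {}er : e.2 < r := er.
  have cover : within l r \subset
      [set e in S | (e.1 == l :> nat) && (e.2 == r :> nat)] :|:
      (within l e.2 :|: within e.2 r).
    apply/subsetP => f; rewrite !inE => /andP[fS /andP[lf fr]]; rewrite fS /=.
    have f12 := S_lt fS.
    case: (leqP f.2 e.2) => h1; first by rewrite lf orbT.
    case: (leqP e.2 f.1) => h2; first by rewrite fr !orbT.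
    rewrite /= !orbF; case: (ltngtP f.1 l) => h3 /=; first by lia.
      case: (S_nc (i := e.1) (j := e.2) (k := f.1) (l := f.2)) => //;
        rewrite -?surjective_pairing //.
      by rewrite el.
    case: (ltngtP f.2 r) => h4 //=; last by lia.
    have Qf : Q f by rewrite /Q fS h3 eqxx h4.
    by have : f.2 <= e.2 := emax f Qf; lia.
  have h1 : #|within l e.2| <= 2 * (e.2 - l) - 1 by apply: IH; lia.
  have h2 : #|within e.2 r| <= 2 * (r - e.2) - 1 by apply: IH; lia.
  have := subset_leq_card cover; have := (leq_card_setU (within l e.2) (within e.2 r)).1.
  have := (leq_card_setU [set e in S | (e.1 == l :> nat) && (e.2 == r :> nat)]
    (within l e.2 :|: within e.2 r)).1.
  by lia.
(* Now [l] has at most the partner [r], so at most one pair is lost in passing to [l.+1]. *)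
have cover : within l r \subset
    [set e in S | (e.1 == l :> nat) && (e.2 == r :> nat)] :|: within l.+1 r.
  apply/subsetP => f; rewrite !inE => /andP[fS /andP[lf fr]]; rewrite fS fr /= andbT.
  case: (ltngtP f.1 l) => h3 /=; [by lia|by []|].
  rewrite orbF; case: (ltngtP f.2 r) => // h4; last by lia.
  by move/existsP: none => []; exists f; rewrite fS h3 eqxx h4.
have := subset_leq_card cover.
have := (leq_card_setU [set e in S | (e.1 == l :> nat) && (e.2 == r :> nat)]
  (within l.+1 r)).1.
case: (leqP r l.+1) => h.
  have -> : within l.+1 r = set0.
    apply/setP => f; rewrite !inE; apply/negP => /andP[/S_lt fS /andP[h1 h2]]; lia.
  by rewrite cards0; lia.
by have : #|within l.+1 r| <= 2 * (r - l.+1) - 1 by [apply: IH; lia]; lia.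
Qed.

Lemma noncrossing_card : 2 <= n -> #|S| <= 2 * n - 3.
Proof.
move=> n2; have := card_within (l := 0) (r := n.-1).
have -> : within 0 n.-1 = S.
  apply/setP => e; rewrite !inE /=; case: (e \in S) => //=.
  by case: e => e1 e2 /=; have := ltn_ord e2; lia.
by lia.
Qed.

End Noncrossing.

Theorem theorem4p1 (R : realType) (n : nat) (p : 'I_n -> R * R) :
  simple_polygon p ->
  (2 * n - 3 < #|vis_edges p|)%N ->
  exists f : 'I_4 -> 'I_n,
    injective f /\ forall a b : 'I_4, a != b -> vis_adj p (f a) (f b).
Proof.
move=> sp big; apply: contrapT => noK4.
have prim_all i j : vis_adj p i j -> prim p i j.
  by move=> [ij sij]; apply: contrapT => np; have : has_K4 p := nonprim_K4 sp ij sij np.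
move: big; rewrite ltnNge => /negP; apply; apply: noncrossing_card.
- by move=> e; rewrite inE => /andP[].
- move=> i j k l; rewrite !inE /= => /andP[_ /asboolP vij] /andP[_ /asboolP vkl] ik kj jl.
  apply: noK4; apply: (cross_K4 sp (a := i) (b := j) (c := k) (d := l)).
  by apply: interleaved_cross => //; exact: prim_all.
by have := n_ge3 sp; lia.
Qed.
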